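(* Let $f\in\mathcal{SR}(\Omega_D,A)$, let $y\in\Omega_D$, let $J\in\mathbb S_A$ be such that $y\in\mathbb C_J$ and let $r>0$ be such that $\mathrm{clos}(\Sigma_A(y,r))\subset\Omega_D$. Then the following assertions hold. (i) $f$ expands as $$f(x)=\sum_{n\in\mathbb N}(x-y)^{\cdot n}\,\frac1{n!}\frac{\partial^nf}{\partial x^n}(y)\quad\text{for each }x\in\Sigma_A(y,r).$$ (ii) For each $n\in\mathbb N$, $$\frac1{n!}\frac{\partial^nf}{\partial x^n}(y)=(2\pi J)^{-1}\int_{\partial B_J(y,r)}(\zeta-y)^{-n-1}\,d\zeta\,f(\zeta).$$ Furthermore, there exists a positive real constant $\mathrm C$, depending only on $\mathfrak a$ and on $\|\cdot\|_A$, such that $$\frac1{n!}\left\|\frac{\partial^nf}{\partial x^n}(y)\right\|_A\le \mathrm C\,r^{-n}\sup_{\partial B_J(y,r)}\|f\|_A\quad\text{for each }n\in\mathbb N.$$ (iii) Suppose $\Omega(y,r)\neq\emptyset$. For each $n\in\mathbb N$, $$f(x)-\sum_{k=0}^n(x-y)^{\cdot k}\,\frac1{k!}\frac{\partial^kf}{\partial x^k}(y)=(2\pi)^{-1}\,\big((x-y)^{\cdot (n+1)}\cdot\mathrm R_{y,n}(f)\big)(x)$$ for each $x\in\Omega(y,r)$, where the product on the right is the slice product and $\mathrm R_{y,n}(f):\Omega(y,r)\to A$ is the slice regular function induced by the holomorphic stem function $$B(w,r)\cap B(\overline w,r)\ni z\longmapsto\int_{\partial B_J(y,r)}\Delta_\zeta(z)^{-1}(\zeta^c-z)J^{-1}(\zeta-y)^{-n-1}\,d\zeta\,f(\zeta),$$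 where $w=\xi+i\eta\in D$ if $y=\xi+J\eta$. Furthermore, if $A$ is associative, then for each $x\in\Omega(y,r)$ $$\mathrm R_{y,n}(f)(x)=\int_{\partial B_J(y,r)}\Delta_\zeta(x)^{-1}(\zeta^c-x)J^{-1}(\zeta-y)^{-n-1}\,d\zeta\,f(\zeta).$$ (iii') Suppose $\Omega(y,r)\neq\emptyset$ and define $\mathcal F_J(y,r):=\partial B_J(y,r)\cup\partial B_J(y^c,r)$. Then there exists a positive real constant $\mathrm C'$, depending only on $\mathfrak a$ and on $\|\cdot\|_A$, such that, for each $n\in\mathbb N$, $$\left\|f(x)-\sum_{k=0}^n(x-y)^{\cdot k}\,\frac1{k!}\frac{\partial^kf}{\partial x^k}(y)\right\|_A\le\mathrm C'\Big(\sup_{\mathcal F_J(y,r)}\|f\|_A\Big)\left(\frac{\sigma_A(x,y)}r\right)^n\frac{\sigma_A(x,y)}{r-\sigma_A(x,y)}$$ for each $x\in\Omega(y,r)$.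
   Context: Algebra. $A$ is a finite-dimensional real alternative algebra with unity $1$ (so $\mathbb R\subset A$), equipped with a real linear anti-involution $\mathfrak a:x\mapsto x^c$ (so $(x^c)^c=x$, $(xy)^c=y^cx^c$). Put $t(x):=x+x^c$, $n(x):=xx^c$. The quadratic cone is $\mathcal Q_A:=\mathbb R\cup\{x\in A: t(x)\in\mathbb R,\ n(x)\in\mathbb R,\ 4n(x)>t(x)^2\}$; $\mathbb S_A:=\{J\in\mathcal Q_A: J^2=-1\}$ is assumed non-empty; for $J\in\mathbb S_A$, $\mathbb C_J:=\mathbb R+\mathbb RJ\simeq\mathbb C$. One has $\mathcal Q_A=\bigcup_{J}\mathbb C_J$ and $\mathbb C_I\cap\mathbb C_J=\mathbb R$ if $I\ne\pm J$. $\mathrm{Re}(x):=(x+x^c)/2$, $\mathrm{Im}(x):=(x-x^c)/2$. $A$ is equipped with a norm $\|\cdot\|_A$ such that $\|x\|_A=\sqrt{n(x)}$ for all $x\in\mathcal Q_A$; $\mathrm{clos}$ denotes closure in $\mathcal Q_A$. Slice functions. $D\subset\mathbb C$ is non-empty, open, conjugation invariant, and $\Omega_D:=\{\alpha+\beta J: \alpha,\beta\in\mathbb R,\ \alpha+i\beta\in D,\ J\in\mathbb S_A\}$ (the circularization of $D$) is assumed connected. A stem function is a map $F=F_1+iF_2:D\to A\otimes_{\mathbb R}\mathbb C$ ($F_1,F_2$ $A$-valued) with $F_1(\bar z)=F_1(z)$, $F_2(\bar z)=-F_2(z)$; it induces the slice function $\mathcal I(F):\Omega_D\to A$, $\mathcal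 I(F)(\alpha+\beta J):=F_1(z)+JF_2(z)$, $z=\alpha+i\beta$ (same definitions for any other conjugation invariant open set). $f=\mathcal I(F)$ is slice regular, $f\in\mathcal{SR}(\Omega_D,A)$, if $F$ is $C^1$ and holomorphic: $\frac{\partial F}{\partial\alpha}+i\frac{\partial F}{\partial\beta}=0$. Slice derivatives: $\frac{\partial^nf}{\partial x^n}:=\mathcal I\big(\frac{\partial^nF}{\partial z^n}\big)$, $\frac{\partial}{\partial z}=\frac12(\frac\partial{\partial\alpha}-i\frac\partial{\partial\beta})$. Slice product: $\mathcal I(F)\cdot\mathcal I(G):=\mathcal I(FG)$, product in $A\otimes_{\mathbb R}\mathbb C$. For $y\in\mathcal Q_A$, $(x-y)^{\cdot n}$ is the slice function induced by $z\mapsto(z-y)^n$, and for $a\in A$, $(x-y)^{\cdot n}a$ is the value at $x$ of the slice function induced by $z\mapsto(z-y)^na$. $\Delta_\zeta(x):=x^2-x\,t(\zeta)+n(\zeta)$. Metric. For $x,y\in\mathcal Q_A$, $y\in\mathbb C_J$: $\sigma_A(x,y):=\|x-y\|_A$ if $x\in\mathbb C_J$, and $\sigma_A(x,y):=\sqrt{|\mathrm{Re}(x)-\mathrm{Re}(y)|^2+(\|\mathrm{Im}(x)\|_A+\|\mathrm{Im}(y)\|_A)^2}$ otherwise. $\Sigma_A(y,r):=\{x\in\mathcal Q_A:\sigma_A(x,y)<r\}$. $B(w,r)$ is the open disc of $\mathbb C$ of center $w$ and radius $r$; $B_J(y,r):=\{p\in\mathbb C_J:\|p-y\|_A<r\}$;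 for $y=\xi+J\eta$, $w=\xi+i\eta$, $\Omega(y,r)$ is the circularization of $B(w,r)\cap B(\overline w,r)$, i.e. $\Omega(y,r)=\{\alpha+\beta I:\alpha+i\beta\in B(w,r)\cap B(\overline w,r),\ I\in\mathbb S_A\}$. Integrals. $\partial B_J(y,r)$ is the boundary in $\mathbb C_J$, oriented counterclockwise via $\mathbb C\to\mathbb C_J$, $\alpha+i\beta\mapsto\alpha+J\beta$. For a parametrization $\zeta(t)$, $\int g(\zeta)\,d\zeta\,f(\zeta)$ means $\int \big(g(\zeta(t))\zeta'(t)\big)f(\zeta(t))\,dt$, where $g$ has values in $\mathbb C_J$ (or in $\mathbb C_J\otimes_{\mathbb R}\mathbb C$, for the stem function). *)

(* Defs.v *)
From HB Require Import structures.
From mathcomp Require Import all_boot all_order all_algebra.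
From mathcomp Require Import complex.
From mathcomp Require Import all_classical all_reals all_analysis.

Set Implicit Arguments.
Unset Strict Implicit.
Unset Printing Implicit Defensive.

Import Order.TTheory GRing.Theory Num.Theory.
Import numFieldNormedType.Exports.

Local Open Scope classical_set_scope.
Local Open Scope ring_scope.
Local Open Scope complex_scope.

#[short(type="normedVectType")]
HB.structure Definition NormedVect (R : realType) :=
  {V of NormedModule R V & Vector R V}.

(* No compatibility between the norm and the product is part of the structure:
   the condition ||x|| = sqrt (n x) on the quadratic cone is stated separately
   as [cone_norm]. *)
HB.mixin Record isAltStarAlg (R : realType) A of NormedVect R A := {
  amul : A -> A -> A;
  aone : A;
  aconj : A -> A;
  amulDl : forall x y z, amul (x + y) z = amul x z + amul y z;
  amulDr : forall x y z, amul x (y + z) = amul x y + amul x z;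
  amulZl : forall (s : R) x y, amul (s *: x) y = s *: amul x y;
  amulZr : forall (s : R) x y, amul x (s *: y) = s *: amul x y;
  amul1l : forall x, amul aone x = x;
  amul1r : forall x, amul x aone = x;
  aone_neq0 : aone != 0;
  amul_altl : forall x y, amul x (amul x y) = amul (amul x x) y;
  amul_altr : forall x y, amul (amul y x) x = amul y (amul x x);
  aconjD : forall x y, aconj (x + y) = aconj x + aconj y;
  aconjZ : forall (s : R) x, aconj (s *: x) = s *: aconj x;
  aconjK : forall x, aconj (aconj x) = x;
  aconjM : forall x y, aconj (amul x y) = amul (aconj y) (aconj x)
}.

#[short(type="altStarAlgType")]
HB.structure Definition AltStarAlg (R : realType) :=
  {A of isAltStarAlg R A & NormedVect R A}.

Notation "x ** y" := (amul x y) (at level 40, left associativity) : ring_scope.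

Section Algebra.
Context {R : realType} {A : altStarAlgType R}.
Implicit Types (x y a b J : A) (s m : R) (n : nat).

Definition areal s : A := s *: aone.

Definition apow a n : A := iter n (amul a) aone.

(* Two-sided inverses are unique in an alternative algebra; junk value 0. *)
Definition ainv a : A := xget 0 [set b | a ** b = aone /\ b ** a = aone].

Definition atrace x : A := x + aconj x.
Definition asqnorm x : A := x ** aconj x.

Definition aRe x : A := 2^-1 *: (x + aconj x).
Definition aIm x : A := 2^-1 *: (x - aconj x).

Definition QA : set A :=
  [set x | (exists s, x = areal s) \/
           (exists s m, [/\ atrace x = areal s, asqnorm x = areal m
                          & s ^+ 2 < 4 * m])].

Definition SA : set A := [set J | QA J /\ J ** J = - aone].

Definition CJ J : set A := [set areal p.1 + p.2 *: J | p in [set: R * R]].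

Definition Omega (D : set R[i]) : set A :=
  [set x | exists alpha beta J,
     [/\ SA J, D (alpha +i* beta) & x = areal alpha + beta *: J]].

(* On the cone [aRe x] is a real multiple of 1, so that the absolute value of
   Re x - Re y is its norm in A. *)
Definition sigmaA x y : R :=
  if `[< exists J, [/\ SA J, CJ J x & CJ J y] >] then `|x - y|
  else Num.sqrt (`|aRe x - aRe y| ^+ 2 + (`|aIm x| + `|aIm y|) ^+ 2).

Definition SigmaA y (r : R) : set A := [set x | QA x /\ sigmaA x y < r].

Definition closQ (E : set A) : set A := closure E `&` QA.

Definition BJ J y (r : R) : set A := [set p | CJ J p /\ `|p - y| < r].

(* boundary relative to C_J, which is not open in A *)
Definition bdBJ J y (r : R) : set A :=
  CJ J `&` closure (BJ J y r) `&` closure (CJ J `\` BJ J y r).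

Definition supnorm (E : set A) (f : A -> A) : R := sup [set `|f p| | p in E].

End Algebra.

Definition cone_norm {R : realType} (A : altStarAlgType R) :=
  forall (x : A) (s : R), QA x -> asqnorm x = areal s -> `|x| = Num.sqrt s.

(* A (x)_R C is realized on A * A: the pair (a, b) stands for
   a (x) 1 + b (x) i. *)

Section Complexification.
Context {R : realType} {A : altStarAlgType R}.
Implicit Types (p q : A * A) (a : A) (z : R[i]) (n : nat).

Definition cmul p q : A * A :=
  (p.1 ** q.1 - p.2 ** q.2, p.1 ** q.2 + p.2 ** q.1).
Definition cone : A * A := (aone, 0).
Definition cimul p : A * A := (- p.2, p.1).
Definition cpow p n : A * A := iter n (cmul p) cone.
Definition cinv p : A * A := xget 0 [set q | cmul p q = cone /\ cmul q p = cone].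
Definition calg a : A * A := (a, 0).
Definition cscal z : A * A := (areal (complex.Re z), areal (complex.Im z)).

End Complexification.

(* A stem function on D is a total function whose values outside D are
   irrelevant. *)

Section Slice.
Context {R : realType} {A : altStarAlgType R}.
Implicit Types (D : set R[i]) (F G : R[i] -> A * A) (f : A -> A).

Definition stem D F : Prop :=
  forall z, D z -> F (z^*)%C = ((F z).1, - (F z).2).

Definition slice_coord (x : A) : R * R * A :=
  xget (0, 0, 0) [set p | SA p.2 /\ x = areal p.1.1 + p.1.2 *: p.2].

(* The value does not depend on the decomposition x = a + b J (lemma
   [sliceE] below). *)
Definition slice F (x : A) : A :=
  let: (a, b, J) := slice_coord x in (F (a +i* b)).1 + J ** (F (a +i* b)).2.

Definition dalpha F (z : R[i]) : A * A :=
  derive1 (fun a : R => F (a +i* complex.Im z)) (complex.Re z).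
Definition dbeta F (z : R[i]) : A * A :=
  derive1 (fun b : R => F (complex.Re z +i* b)) (complex.Im z).

Definition C1_on D F : Prop := forall z, D z ->
  [/\ derivable (fun a : R => F (a +i* complex.Im z)) (complex.Re z) 1,
      derivable (fun b : R => F (complex.Re z +i* b)) (complex.Im z) 1,
      {for z, continuous (dalpha F : R[i]^o -> A * A)}
    & {for z, continuous (dbeta F : R[i]^o -> A * A)}].

Definition holomorphic_on D F : Prop :=
  C1_on D F /\ forall z, D z -> dalpha F z + cimul (dbeta F z) = 0.

Definition dz F (z : R[i]) : A * A :=
  2^-1 *: (dalpha F z - cimul (dbeta F z)).

(* F is determined by f on D: it serves as the handle on f through which slice
   derivatives are defined. *)
Definition slice_regular D F f : Prop :=
  [/\ stem D F, holomorphic_on D F & forall x, Omega D x -> f x = slice F x].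

Definition slice_deriv F (n : nat) (x : A) : A := slice (iter n dz F) x.

Definition pow_stem (y : A) (n : nat) (z : R[i]) : A * A :=
  cpow (cscal z - calg y) n.

(* (x - y)^{.n} a *)
Definition slice_pow (y : A) (n : nat) (a x : A) : A :=
  slice (fun z => cmul (pow_stem y n z) (calg a)) x.

Definition taylor_term F (y : A) (n : nat) (x : A) : A :=
  slice_pow y n (n`!%:R^-1 *: slice_deriv F n y) x.

Definition disc (w : R[i]) (r : R) : set R[i] := [set z | `|z - w| < r%:C].

Definition lens (w : R[i]) (r : R) : set R[i] := disc w r `&` disc (w^*)%C r.

End Slice.

Section Integrals.
Context {R : realType}.

(* Coordinatewise integral of a function with values in a finite-dimensional
   space; it does not depend on the basis. *)
Definition vintegral (V : vectType R) (a b : R) (g : R -> V) : V :=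
  \sum_(i < \dim {:V})
    (\int[lebesgue_measure]_(t in `[a, b]) coord (vbasis {:V}) i (g t))
      *: (vbasis {:V})`_i.

Context {A : altStarAlgType R}.
Implicit Types (J y : A) (r : R) (f : A -> A).

Definition circ J y r (t : R) : A := y + r *: (areal (cos t) + sin t *: J).
Definition dcirc J r (t : R) : A := r *: (areal (- sin t) + cos t *: J).

(* \int g(zeta) dzeta f(zeta), with values in A, resp. in A (x) C *)
Definition circle_int J y r (g : A -> A) f : A :=
  vintegral 0 (2 * pi)
    (fun t => (g (circ J y r t) ** dcirc J r t) ** f (circ J y r t)).

Definition circle_intC J y r (g : A -> A * A) f : A * A :=
  vintegral 0 (2 * pi)
    (fun t => cmul (cmul (g (circ J y r t)) (calg (dcirc J r t)))
                   (calg (f (circ J y r t)))).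

Definition Delta (zeta x : A) : A :=
  x ** x - x ** atrace zeta + asqnorm zeta.

Definition DeltaC (zeta : A) (z : R[i]) : A * A :=
  cmul (cscal z) (cscal z) - cmul (cscal z) (calg (atrace zeta))
  + calg (asqnorm zeta).

Definition rem_stem J y r f (n : nat) (z : R[i]) : A * A :=
  circle_intC J y r
    (fun zeta =>
       cmul (cmul (cmul (cinv (DeltaC zeta z)) (calg (aconj zeta) - cscal z))
                  (calg (ainv J)))
            (calg (ainv (apow (zeta - y) n.+1)))) f.

End Integrals.

Section Facts.
Context {R : realType} {A : altStarAlgType R}.

Lemma SA_conj (J : A) : SA J -> aconj J = - J.
Proof.
have aconj1 : aconj (aone : A) = aone.
  by rewrite -[RHS]aconjK -[aconj aone in RHS]amul1l aconjM aconjK amul1l.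
have NN (x y : A) : x ** (- y) = - (x ** y).
  by rewrite -scaleN1r amulZr scaleN1r.
have nosq (s : R) : areal s ** areal s <> - aone :> A.
  rewrite /areal amulZl amulZr amul1l scalerA -scaleN1r => /eqP.
  rewrite -subr_eq0 -scalerBl scaler_eq0 (negbTE aone_neq0) orbF subr_eq0.
  by move=> /eqP h; have := sqr_ge0 s; rewrite expr2 h oppr_ge0 ler10.
case=> -[[s ->] /nosq //|[s [m [ht hn _]]] JJ].
have cJ : aconj J = areal s - J by rewrite -ht /atrace addrAC subrr add0r.
have [s0|s0] := eqVneq s 0; first by rewrite cJ s0 /areal scale0r sub0r.
exfalso; move: hn; rewrite /asqnorm cJ amulDr NN JJ opprK /areal amulZr amul1r.
move=> /(canRL (addrK _)); rewrite -[X in _ - X]scale1r -scalerBl => hJ.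
apply: (@nosq (s^-1 * (m - 1))).
by rewrite /areal -scalerA -hJ scalerA mulVf// scale1r.
Qed.

Lemma slice_coord_uniq (a b a' b' : R) (J J' : A) : SA J -> SA J' ->
  areal a + b *: J = areal a' + b' *: J' ->
  [/\ a = a', b *: J = b' *: J' & (b' == b) || (b' == - b)].
Proof.
move=> SJ SJ' e.
have aconj1 : aconj (aone : A) = aone.
  by rewrite -[RHS]aconjK -[aconj aone in RHS]amul1l aconjM aconjK amul1l.
have e2 : areal a - b *: J = areal a' - b' *: J'.
  have := congr1 aconj e.
  by rewrite !aconjD !aconjZ aconj1 (SA_conj SJ) (SA_conj SJ') !scalerN.
have ea : a = a'.
  have : (2 * a) *: (aone : A) = (2 * a') *: aone.
    have := congr2 +%R e e2.
    rewrite addrACA subrr addr0 [RHS]addrACA subrr addr0 /areal -!scalerDl.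
    by rewrite !mulr_natl !mulr2n.
  move/eqP; rewrite -subr_eq0 -scalerBl scaler_eq0 (negbTE aone_neq0) orbF.
  by rewrite -mulrBr mulf_eq0 pnatr_eq0 /= subr_eq0 => /eqP.
have eb : b *: J = b' *: J' by move: e; rewrite ea => /addrI.
split=> //.
have := congr2 amul eb eb; rewrite !amulZl !amulZr !scalerA SJ.2 SJ'.2.
rewrite !scalerN => /oppr_inj /eqP.
rewrite -subr_eq0 -scalerBl scaler_eq0 (negbTE aone_neq0) orbF subr_eq0.
by rewrite -!expr2 eqf_sqr eq_sym => /orP[|] /eqP ->;
  rewrite ?opprK eqxx ?orbT.
Qed.

Lemma sliceE (D : set R[i]) (F : R[i] -> A * A) (a b : R) (J : A) :
  stem D F -> D (a +i* b) -> SA J ->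
  slice F (areal a + b *: J) = (F (a +i* b)).1 + J ** (F (a +i* b)).2.
Proof.
move=> sF Dz SJ; rewrite /slice /slice_coord.
case: xgetP => [[[a' b'] J'] _ /= [SJ' e]|/(_ (a, b, J)) /= []]; last by [].
have [ea eb] := slice_coord_uniq SJ SJ' e; rewrite -ea.
have [b0|b0] := eqVneq b 0.
  have F20 : (F (a +i* 0)).2 = 0.
    move: (sF _ Dz); rewrite b0 /= oppr0 => /(congr1 snd) /= /eqP.
    rewrite -addr_eq0 -mulr2n -scaler_nat scaler_eq0 pnatr_eq0 /=.
    by move/eqP.
  have M0 (x : A) : x ** 0 = 0 by rewrite -(scale0r (0 : A)) amulZr !scale0r.
  by rewrite b0 oppr0 orbb => /eqP ->; rewrite F20 !M0.
case/orP=> /eqP eb'.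
  by move: eb; rewrite eb' => /(scalerI b0) ->.
move: eb; rewrite eb' scaleNr -scalerN => /(scalerI b0) ->.
rewrite -[a -i* b]/((a +i* b)^*)%C (sF _ Dz) /=.
have -> (x y : A) : x ** (- y) = - (x ** y) by rewrite -scaleN1r amulZr scaleN1r.
by rewrite -!(scaleN1r J') amulZl scaleN1r.
Qed.

End Facts.

(* Main.v *)
(* For an imaginary unit J, left multiplication by J is a complex structure on A
   (left alternativity), and F |-> phi, phi (a + i b) := F1 + J F2 = f (a + b J),
   turns holomorphic stem functions into A-valued functions that are holomorphic
   for that structure.  Conversely F is recovered from phi at z and at its conjugate.
   Evaluating A (x) C at i |-> J and at i |-> - J splits the commutative algebra
   C_J (x) C into two copies of C, so that every product with a factor in C_J (x) C
   becomes a pair of scalar multiplications.  The theorem thus reduces to the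
   classical one-variable statements for phi: the Cauchy formula on a disc
   (obtained by differentiating in s the integral of
   h (z + s (zeta - z)) / (zeta - z) over the circle), the finite geometric
   expansion of the Cauchy kernel, and the resulting bound of the remainder.
   The value at a + b I is a combination of the values at a + b J and a - b J,
   and sigma_A is exactly the larger of the two corresponding plane distances. *)

Require Import Defs.
From HB Require Import structures.
From mathcomp Require Import all_boot all_order all_algebra.
From mathcomp Require Import complex.
From mathcomp Require Import all_classical all_reals all_analysis.
From mathcomp Require Import ring lra.

Set Implicit Arguments.
Unset Strict Implicit.
Unset Printing Implicit Defensive.

Import Order.TTheory GRing.Theory Num.Theory.
Import numFieldNormedType.Exports.

Local Open Scope classical_set_scope.
Local Open Scope ring_scope.
Local Open Scope complex_scope.

(** * Integrals of continuous functions depending on a parameter *)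

Section RealIntegrals.
Context {R : realType}.
Implicit Types (f g F : R -> R) (a b : R).

Local Notation mu := (@lebesgue_measure R).

(** Two defects of [A] shape the argument. It is not associative, so a triple product is regrouped
    only through left alternativity, in the form [J ** (J ** v) = - v]. The integrands are bracketed
    to the left: everything before the last factor lies in C_J, resp. C_J (x) C, and acts on the
    value of f as one complex scalar. Moreover the norm is prescribed only on the quadratic cone, so
    neither |J v| = |v| nor a bound of [vintegral] with constant 1 is at hand. Finite dimension
    supplies the two numbers from which C and C' are built: [K] bounds the product, [K1] compares
    the coordinatewise integral with the norm; both depend on [A] and its norm alone. The scalar
    theory is transported by the functionals [lc J i], which are complex linear for the structure
    given by J and jointly separate points. There are as many of them as real coordinates, so they
    are redundant, and a family of scalar derivatives has to be shown to come from one vector. A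
    scalar holomorphic function is always carried together with its continuous derivative ([hol]),
    which is what differentiation under the integral consumes. *)

Lemma continuous_integrable a b f : continuous f ->
  mu.-integrable `[a, b] (EFin \o f).
Proof.
move=> cf; apply: continuous_compact_integrable; first exact: segment_compact.
exact: continuous_subspaceT.
Qed.

Lemma Rintegral_derive f F a b : a < b -> continuous f ->
  (forall x : R, is_derive x 1 F (f x)) ->
  \int[mu]_(t in `[a, b]) f t = F b - F a.
Proof.
move=> ab cf dF; rewrite /Rintegral (@continuous_FTC2 _ f F)//.
- exact: continuous_subspaceT.
- have dF1 x : derivable F x 1 by have [] := dF x.
  have cF : continuous F.
    by move=> x; apply/differentiable_continuous/derivable1_diffP.
  split => [x _//||]; first by apply: cvg_at_right_filter; exact: cF.
  by apply: cvg_at_left_filter; exact: cF.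
- by move=> x _; rewrite derive1E; have [] := dF x.
Qed.

Lemma le_normr_Rintegral_cst f a b (M : R) : a <= b -> continuous f ->
  (forall t, t \in `[a, b] -> `|f t| <= M) ->
  `|\int[mu]_(t in `[a, b]) f t| <= M * (b - a).
Proof.
move=> ab cf fM.
apply: (le_trans (le_normr_Rintegral _ _)) => //; first exact: continuous_integrable.
have -> : M * (b - a) = \int[mu]_(t in `[a, b]) (cst M) t.
  rewrite Rintegral_cst//= lebesgue_measure_itv/= lte_fin.
  by case: ltgtP ab => // ->; rewrite subrr.
apply: le_Rintegral => //.
- apply: (@continuous_integrable _ _ (fun t => `|f t|)).
  by move=> x; apply: cvg_norm; exact: cf.
- by apply: (@continuous_integrable _ _ (cst M)); move=> x; exact: cvg_cst.
Qed.

(** Compactness of the segment makes continuity at the points [(z, t)] uniform in [t]. Both passages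
    to the limit under the integral, continuity and differentiation, rest on this. *)
Lemma tube_near (T : topologicalType) (G : T -> R -> R) (z : T) a b (e : R) :
  0 < e ->
  (forall t, t \in `[a, b] -> {for (z, t), continuous (fun p => G p.1 p.2)}) ->
  \forall z' \near z, forall t, t \in `[a, b] -> `|G z' t - G z t| < e.
Proof.
move=> e0 cG.
have /compact_near_coveringP/(_ T (nbhs z)
  (fun z' t => `|G z' t - G z t| < e) _) : compact (`[a, b]%classic : set R).
  exact: segment_compact.
apply=> t /= tab.
have ct := cG _ tab.
have c1 : \forall p \near (z, t), `|G z t - G p.1 p.2| < e / 2.
  by move: ct => /cvgrPdist_lt; apply; rewrite divr_gt0.
case: c1 => -[U V] /= [Uz Vt] UV.
near=> t' z' => /=.
have h1 : `|G z t - G z' t'| < e / 2.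
  apply: (UV (z', t')); split => /=; first by near: z'.
  by near: t'.
have h2 : `|G z t - G z t'| < e / 2.
  apply: (UV (z, t')); split => /=; first exact: nbhs_singleton.
  by near: t'.
rewrite -[X in X < _]normrN opprB (splitr e).
rewrite (_ : _ - _ = (G z t - G z' t') - (G z t - G z t')); last first.
  by rewrite opprB [RHS]addrC subrKA.
by rewrite (le_lt_trans (ler_normB _ _))// ltrD.
Unshelve. all: by end_near. Qed.

Lemma continuous_Rintegral (T : topologicalType) (G : T -> R -> R) (z : T) a b :
  a <= b ->
  (forall t, t \in `[a, b] -> {for (z, t), continuous (fun p => G p.1 p.2)}) ->
  (\forall z' \near z, continuous (G z')) ->
  {for z, continuous (fun z' => \int[mu]_(t in `[a, b]) G z' t)}.
Proof.
move=> ab cG cGz; apply/cvgrPdist_le => /= e e0.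
have b0 : 0 < b - a + 1 by rewrite ltr_wpDl// subr_ge0.
have d0 : 0 < e / (b - a + 1) by rewrite divr_gt0.
have H := tube_near d0 cG.
have cz := nbhs_singleton cGz.
near=> z'.
have cz' : continuous (G z') by near: z'.
rewrite distrC -RintegralB//; [|exact: continuous_integrable..].
apply: (@le_trans _ _ (e / (b - a + 1) * (b - a))).
  apply: le_normr_Rintegral_cst => //.
    by move=> x; apply: cvgB; [exact: cz'|exact: cz].
  by move=> t tab; apply/ltW; move: t tab; near: z'.
by rewrite mulrAC ler_pdivrMr// ler_pM2l// lerDl.
Unshelve. all: by end_near. Qed.

Lemma is_derive_cvgP (V : normedModType R) (f : R -> V) (x : R) (d : V) :
  is_derive x 1 f d <->
  (fun h : R => h^-1 *: ((f \o shift x) (h *: 1) - f x)) @ 0^' --> d.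
Proof.
split=> [[/cvg_ex[l fl] dE]|H].
  by move: dE; rewrite /derive (cvg_lim _ fl)// => <-.
by apply: DeriveDef; [apply/cvg_ex; exists d|exact/cvg_lim].
Qed.

(** The division-free form of the derivative: it includes the increment 0, and it combines directly
    with norm bounds of linear maps and with mean value estimates. *)
Lemma is_deriveP (V : normedModType R) (f : R -> V) (x : R) (d : V) :
  (forall e, 0 < e ->
    \forall y \near x, `|f y - f x - (y - x) *: d| <= e * `|y - x|)
  <-> is_derive x 1 f d.
Proof.
have est (h : R) : h != 0 ->
    `|d - h^-1 *: ((f \o shift x) (h *: 1) - f x)| * `|h| =
    `|f (x + h) - f x - h *: d|.
  move=> h0; rewrite mulrC -normrZ scalerBr scalerA divff// scale1r /=.
  by rewrite [h *: _]mulr1 -normrN opprB [h + x]addrC.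
split=> [H|/is_derive_cvgP/cvgrPdist_le H e e0].
  apply/is_derive_cvgP/cvgrPdist_le => /= e e0; rewrite near_withinE.
  have /nbhs0P He := H _ e0; near=> h => h0.
  rewrite -(ler_pM2r (_ : 0 < `|h|)) ?normr_gt0// est//.
  have : `|f (x + h) - f x - (x + h - x) *: d| <= e * `|x + h - x| by near: h.
  by rewrite [X in X - x]addrC addrK.
have := H _ e0; rewrite near_withinE => He.
apply/nbhs0P; near=> h; rewrite [X in X - x]addrC addrK.
have [->|h0] := eqVneq h 0.
  by rewrite addr0 subrr scale0r subrr !normr0 mulr0.
by rewrite -est// ler_wpM2r//; move: h0; near: h.
Unshelve. all: by end_near. Qed.

(** The intermediate point is located by its distance to [x], so that both orders of [x] and [y] are
    covered and [c] stays in every ball around [x] that contains [y]. *)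
Lemma MVT_dist f g (x y : R) :
  (forall c : R, `|c - x| <= `|y - x| -> is_derive c 1 f (g c)) ->
  exists2 c : R, `|c - x| <= `|y - x| & f y - f x = g c * (y - x).
Proof.
have mvt (u v : R) : u <= v ->
    (forall c : R, c \in `[u, v] -> is_derive c 1 f (g c)) ->
    exists2 c, c \in `[u, v] & f v - f u = g c * (v - u).
  move=> uv H.
  have H1 : {within `[u, v], continuous f}.
    by apply: derivable_within_continuous => c cuv; have [] := H c cuv.
  have H2 (c : R) : c \in `]u, v[ -> is_derive c 1 f (g c).
    by move=> cuv; apply: H; exact: subset_itv_oo_cc cuv.
  by have [c cuv e] := MVT_segment uv H2 H1; exists c.
move=> H; have [xy|/ltW yx] := leP x y.
  have xyH c : c \in `[x, y] -> `|c - x| <= `|y - x|.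
    by rewrite in_itv/= => /andP[xc cy]; rewrite !ger0_norm ?subr_ge0// lerD2r.
  have [c /xyH cxy e] := mvt _ _ xy (fun c h => H c (xyH c h)).
  by exists c.
have xyH c : c \in `[y, x] -> `|c - x| <= `|y - x|.
  rewrite in_itv/= => /andP[yc cx].
  by rewrite distrC [leRHS]distrC !ger0_norm ?subr_ge0// lerD2l lerN2.
have [c /xyH cxy e] := mvt _ _ yx (fun c h => H c (xyH c h)).
by exists c => //; rewrite -opprB e -mulrN opprB.
Qed.

(** For each [t] the mean value theorem writes the increment of [G ^~ t] as [G1 c t * (y - s)] with
    [c] near [s], and [tube_near] bounds [G1 c t - G1 s t] uniformly in [t]. The two continuity
    hypotheses on sections provide integrability. *)
Lemma derivable_under_Rintegral (G G1 : R -> R -> R) (s a b : R) : a < b ->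
  (\forall s' \near s, forall t, t \in `[a, b] -> is_derive (s' : R) 1 (G ^~ t) (G1 s' t)) ->
  (forall t, t \in `[a, b] -> {for (s, t), continuous (fun p => G1 p.1 p.2)}) ->
  (\forall s' \near s, continuous (G s')) -> continuous (G1 s) ->
  is_derive s 1 (fun s' => \int[mu]_(t in `[a, b]) G s' t)
    (\int[mu]_(t in `[a, b]) G1 s t).
Proof.
move=> ab dG cG1 cG cG1s; apply/is_deriveP => e e0.
have d0 : 0 < e / (b - a) by rewrite divr_gt0// subr_gt0.
have tb := tube_near d0 cG1.
have [r /= r0 Hr] : \forall s' \near s,
   (forall t, t \in `[a, b] -> is_derive (s' : R) 1 (G ^~ t) (G1 s' t)) /\
   (forall t, t \in `[a, b] -> `|G1 s' t - G1 s t| < e / (b - a)).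
  by near=> s'; split; near: s'.
have cGs := nbhs_singleton cG.
near=> y.
have yr : `|s - y| < r by near: y; exists r.
have cGy : continuous (G y) by near: y.
rewrite -RintegralB//; [|exact: continuous_integrable..].
rewrite /GRing.scale/= -RintegralZl//; last exact: continuous_integrable.
rewrite -RintegralB//; last 2 first.
- apply: (@continuous_integrable _ _ (fun t => G y t - G s t)) => x.
  by apply: cvgB; [exact: cGy|exact: cGs].
- apply: (@continuous_integrable _ _ (fun t => (y - s) * G1 s t)) => x.
  by apply: cvgM; [exact: cvg_cst|exact: cG1s].
have -> : e * `|y - s| = e / (b - a) * `|y - s| * (b - a).
  by rewrite mulrAC divfK// gt_eqF// subr_gt0.
apply: le_normr_Rintegral_cst; first exact: ltW.
  move=> x; apply: cvgB; first by apply: cvgB; [exact: cGy|exact: cGs].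
  by apply: cvgM; [exact: cvg_cst|exact: cG1s].
move=> t tab.
have [|c cy ->] := @MVT_dist (G ^~ t) (G1 ^~ t) s y.
  move=> c cy; have [] := Hr c; last by move=> + _; exact.
  by rewrite /= distrC (le_lt_trans cy)// distrC.
rewrite mulrC -mulrBr normrM mulrC ler_wpM2r// ltW//.
have [|_ ->//] := Hr c.
by rewrite /= distrC (le_lt_trans cy)// distrC.
Unshelve. all: by end_near. Qed.

Lemma is_derive0_eq f a b : a < b -> {within `[a, b], continuous f} ->
  (forall x : R, x \in `]a, b[ -> is_derive x 1 f 0) -> f a = f b.
Proof.
move=> ab cf df; apply/eqP; rewrite eq_sym -subr_eq0.
have [c _ ->] := MVT ab (df : forall x : R, _ -> is_derive x 1 f (cst 0 x))
  cf.
by rewrite mul0r.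
Qed.

End RealIntegrals.

(** * Holomorphic functions of one complex variable *)

Section ComplexTopology.
Context {R : realType}.
Implicit Types (z w : R[i]) (a b : R).

Local Notation Re := (@complex.Re R).
Local Notation Im := (@complex.Im R).

(** Balls of [R[i]^o] have their radius in [R[i]]; a positive radius is real, which allows the
    real-valued modulus to be used throughout. *)
Lemma nbhs_complexP z (P : set R[i]) : nbhs (z : R[i]^o) P <->
  exists2 e : R, 0 < e & forall z', Normc.normc (z' - z) < e -> P z'.
Proof.
rewrite -nbhs_ballE; split=> [[e /= e0 eP]|[e e0 eP]].
  have eR : e = (Re e)%:C by rewrite RRe_real// gtr0_real.
  exists (Re e); first by rewrite -ltcR -eR.
  move=> z' zz'; apply: eP; rewrite /ball/= eR distrC.
  by rewrite -[`|_|]/((Normc.normc (z' - z))%:C) ltcR.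
exists e%:C; first by rewrite /= ltcR.
move=> z'; rewrite /ball/= distrC -[`|_|]/((Normc.normc (z' - z))%:C) ltcR.
exact: eP.
Qed.

Lemma normcE_sqrt z : Normc.normc z = Num.sqrt (Re z ^+ 2 + Im z ^+ 2).
Proof. by case: z. Qed.

Lemma normr_Re_le z : `|Re z| <= Normc.normc z.
Proof. by rewrite normcE_sqrt -sqrtr_sqr ler_wsqrtr// lerDl sqr_ge0. Qed.

Lemma normr_Im_le z : `|Im z| <= Normc.normc z.
Proof. by rewrite normcE_sqrt -sqrtr_sqr ler_wsqrtr// lerDr sqr_ge0. Qed.

Lemma normc_le_ReIm z : Normc.normc z <= `|Re z| + `|Im z|.
Proof.
rewrite normcE_sqrt -(ler_pXn2r (_ : 0 < 2)%N) ?nnegrE ?sqrtr_ge0 ?addr_ge0//.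
rewrite sqr_sqrtr ?addr_ge0 ?sqr_ge0// sqrrD !real_normK ?num_real//.
by rewrite lerD2r lerDl mulrn_wge0// mulr_ge0.
Qed.

Lemma continuous_Re : continuous (Re : R[i]^o -> R).
Proof.
move=> z; have FF : Filter (nbhs (z : R[i]^o)) by exact: nbhs_filter.
apply/(@cvgrPdist_lt _ _ _ _ FF) => e e0; apply/nbhs_complexP; exists e => // z' H.
rewrite distrC (le_lt_trans _ H)// (le_trans _ (normr_Re_le _))//.
by case: z z' {FF H} => ? ? [].
Qed.

Lemma continuous_Im : continuous (Im : R[i]^o -> R).
Proof.
move=> z; have FF : Filter (nbhs (z : R[i]^o)) by exact: nbhs_filter.
apply/(@cvgrPdist_lt _ _ _ _ FF) => e e0; apply/nbhs_complexP; exists e => // z' H.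
rewrite distrC (le_lt_trans _ H)// (le_trans _ (normr_Im_le _))//.
by case: z z' {FF H} => ? ? [].
Qed.

Lemma cvg_Complex (T : Type) (F : set_system T) (FF : Filter F) (f g : T -> R) a b :
  f @ F --> a -> g @ F --> b ->
  (fun t => (f t +i* g t) : R[i]^o) @ F --> ((a +i* b) : R[i]^o).
Proof.
move=> fa gb U /nbhs_complexP[e e0 eU].
have e20 : 0 < e / 2 by rewrite divr_gt0.
move/cvgrPdist_lt : fa => /(_ _ e20) fa; move/cvgrPdist_lt : gb => /(_ _ e20) gb.
apply: filterS2 fa gb => t fa gb; apply: eU.
rewrite (le_lt_trans (normc_le_ReIm _))// [e]splitr ltrD//= distrC//.
Qed.

Lemma cvg_complexP (T : Type) (F : set_system T) (FF : Filter F) (f : T -> R[i]) z :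
  (f : T -> R[i]^o) @ F --> (z : R[i]^o) <->
  ((fun t => Re (f t)) @ F --> Re z /\ (fun t => Im (f t)) @ F --> Im z).
Proof.
split=> [fz|[f1 f2]].
  split; first exact: (cvg_comp (f : T -> R[i]^o) Re fz (@continuous_Re z)).
  exact: (cvg_comp (f : T -> R[i]^o) Im fz (@continuous_Im z)).
have := cvg_Complex FF f1 f2; rewrite (_ : Re z +i* Im z = z); last by case: z {f1 f2}.
by apply: cvg_trans; apply: near_eq_cvg; near=> t; case: (f t).
Unshelve. all: by end_near. Qed.

End ComplexTopology.

(** * Derivatives of curves in the complex plane *)

Section ComplexDerivatives.
Context {R : realType}.
Implicit Types (z w : R[i]) (g k : R -> R[i]) (D E : set R[i]) (t : R).

Local Notation Re := (@complex.Re R).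
Local Notation Im := (@complex.Im R).

(** The derivative in a real variable is taken on the real and imaginary parts, so that the calculus
    of real functions applies to each. *)
Definition cder g t (d : R[i]) :=
  is_derive t 1 (fun s => Re (g s)) (Re d) /\
  is_derive t 1 (fun s => Im (g s)) (Im d).

Lemma ReM z w : Re (z * w) = Re z * Re w - Im z * Im w.
Proof. by case: z w => ? ? []. Qed.

Lemma ImM z w : Im (z * w) = Re z * Im w + Im z * Re w.
Proof. by case: z w => ? ? []. Qed.

Lemma ReD z w : Re (z + w) = Re z + Re w. Proof. by case: z w => ? ? []. Qed.
Lemma ImD z w : Im (z + w) = Im z + Im w. Proof. by case: z w => ? ? []. Qed.
Lemma ReN z : Re (- z) = - Re z. Proof. by case: z. Qed.
Lemma ImN z : Im (- z) = - Im z. Proof. by case: z. Qed.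

Lemma ReV z : Re z^-1 = Re z / (Re z ^+ 2 + Im z ^+ 2).
Proof. by case: z. Qed.
Lemma ImV z : Im z^-1 = - Im z / (Re z ^+ 2 + Im z ^+ 2).
Proof. by case: z => a b /=; rewrite mulNr. Qed.

Lemma complex_eqP z w : Re z = Re w -> Im z = Im w -> z = w.
Proof. by case: z w => ? ? [? ?] /= -> ->. Qed.

Lemma cder_uniq g t d d' : cder g t d -> cder g t d' -> d = d'.
Proof.
move=> [[_ g1] [_ g2]] [[_ h1] [_ h2]].
by apply: complex_eqP; [rewrite -g1 -h1|rewrite -g2 -h2].
Qed.

Lemma cder_cst z t : cder (cst z) t 0.
Proof. by split; exact: is_derive_cst. Qed.

Lemma cderD g k t d e : cder g t d -> cder k t e ->
  cder (fun s => g s + k s) t (d + e).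
Proof.
move=> [g1 g2] [k1 k2]; split.
  under eq_fun do rewrite ReD; rewrite ReD; exact: is_deriveD.
under eq_fun do rewrite ImD; rewrite ImD; exact: is_deriveD.
Qed.

Lemma cderM g k t d e : cder g t d -> cder k t e ->
  cder (fun s => g s * k s) t (d * k t + g t * e).
Proof.
move=> [g1 g2] [k1 k2]; split.
  under eq_fun do rewrite ReM.
  have H := is_deriveB (is_deriveM g1 k1) (is_deriveM g2 k2).
  by apply: (@is_derive_eq _ _ _ _ _ _ _ _ H); rewrite ReD !ReM /GRing.scale/=; ring.
under eq_fun do rewrite ImM.
have H := is_deriveD (is_deriveM g1 k2) (is_deriveM g2 k1).
by apply: (@is_derive_eq _ _ _ _ _ _ _ _ H); rewrite ImD !ImM /GRing.scale/=; ring.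
Qed.


Lemma cderV g t d : cder g t d -> g t != 0 ->
  cder (fun s => (g s)^-1) t (- (g t)^-1 ^+ 2 * d).
Proof.
move=> [g1 g2] gt0.
pose n (s : R) : R := Re (g s) * Re (g s) + Im (g s) * Im (g s).
have nE s : n s = Re (g s) ^+ 2 + Im (g s) ^+ 2 by [].
have n0 : n t != 0.
  apply: contra gt0; rewrite nE paddr_eq0 ?sqr_ge0// !sqrf_eq0 => /andP[/eqP a /eqP b].
  by rewrite eq_complex a b /= !eqxx.
have dn : is_derive t 1 n (2 * Re (g t) * Re d + 2 * Im (g t) * Im d).
  have H := is_deriveD (is_deriveM g1 g1) (is_deriveM g2 g2).
  by apply: (@is_derive_eq _ _ _ _ _ _ _ _ H); rewrite /GRing.scale/=; ring.
have dV : is_derive t 1 (fun s => (n s)^-1)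
    (- (n t) ^- 2 * (2 * Re (g t) * Re d + 2 * Im (g t) * Im d)).
  case: dn => dn vn; apply: DeriveDef; first exact: derivableV.
  by rewrite deriveV// vn.
split.
  under eq_fun do rewrite ReV -nE.
  have H := is_deriveM g1 dV; apply: (@is_derive_eq _ _ _ _ _ _ _ _ H).
  rewrite /GRing.scale/= !(ReM, ReN, ReV, ImV, ImN, ImM, expr2) -!expr2 -!nE.
  rewrite nE; move: n0; rewrite nE => n0; field.
  by [].
under eq_fun do rewrite ImV -nE.
have g2' : is_derive t 1 (fun s => - Im (g s)) (- Im d) := is_deriveN g2.
have H := is_deriveM g2' dV; apply: (@is_derive_eq _ _ _ _ _ _ _ _ H).
rewrite /GRing.scale/= !(ReM, ReN, ReV, ImV, ImN, ImM, expr2) -!expr2 -!nE.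
rewrite nE; move: n0; rewrite nE => n0; field.
by [].
Qed.

Lemma cderX g t d n : cder g t d ->
  cder (fun s => g s ^+ n.+1) t (n.+1%:R * g t ^+ n * d).
Proof.
move=> dg; elim: n => [|n IH].
  by under eq_fun do rewrite expr1; rewrite expr0 !mul1r.
under eq_fun do rewrite exprS.
have := cderM dg IH; congr (cder _ _ _).
by rewrite !exprS -[n.+2%:R]natr1; ring.
Qed.

Lemma cderZ g t d w : cder g t d -> cder (fun s => w * g s) t (w * d).
Proof.
by move=> dg; have := cderM (cder_cst w t) dg; rewrite mul0r add0r.
Qed.

Lemma cder_near g k t d : (\forall s \near t, g s = k s) -> cder g t d -> cder k t d.
Proof.
move=> gk [g1 g2]; split.
  by apply: near_eq_is_derive g1; apply: filterS gk => s ->.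
by apply: near_eq_is_derive g2; apply: filterS gk => s ->.
Qed.

Lemma cder_continuous g t d : cder g t d -> {for t, continuous (g : R -> R[i]^o)}.
Proof.
move=> [[g1 _] [g2 _]]; apply/cvg_complexP; split.
  exact/differentiable_continuous/derivable1_diffP.
exact/differentiable_continuous/derivable1_diffP.
Qed.

End ComplexDerivatives.

(** * Continuously differentiable functions in the plane, chain rule and Cauchy-Riemann equations *)

Section Holomorphic.
Context {R : realType}.
Implicit Types (z w : R[i]) (g k : R -> R[i]) (D E : set R[i]) (t : R).
Implicit Types (h : R[i] -> R[i]).

Local Notation Re := (@complex.Re R).
Local Notation Im := (@complex.Im R).

Lemma le_normc z w : `|Re z| <= `|Re w| -> `|Im z| <= `|Im w| ->
  Normc.normc z <= Normc.normc w.
Proof.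
move=> h1 h2; rewrite !normcE_sqrt ler_wsqrtr// lerD//.
  by rewrite -(real_normK (num_real (Re z))) -(real_normK (num_real (Re w))) lerXn2r ?nnegrE.
by rewrite -(real_normK (num_real (Im z))) -(real_normK (num_real (Im w))) lerXn2r ?nnegrE.
Qed.

(** The increment from [z] to [k] is split along two sides of a rectangle, horizontal at height
    [Im k] and vertical above [Re z]. The mean value theorem on each side gives partial derivatives
    at points no farther from [z] than [k]. *)
Lemma C1_estimate (u ua ub : R[i] -> R) z :
  (\forall z' \near (z : R[i]^o),
     is_derive (Re z') 1 (fun a => u (a +i* Im z')) (ua z') /\
     is_derive (Im z') 1 (fun b => u (Re z' +i* b)) (ub z')) ->
  {for z, continuous (ua : R[i]^o -> R)} ->
  {for z, continuous (ub : R[i]^o -> R)} ->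
  forall e, 0 < e -> \forall k \near (z : R[i]^o),
    `|u k - u z - ((Re k - Re z) * ua z + (Im k - Im z) * ub z)| <=
    e * (`|Re k - Re z| + `|Im k - Im z|).
Proof.
move=> du ca cb e e0.
have FF : Filter (nbhs (z : R[i]^o)) by exact: nbhs_filter.
move/(@cvgrPdist_le _ _ _ _ FF) : ca => /(_ _ e0) ca.
move/(@cvgrPdist_le _ _ _ _ FF) : cb => /(_ _ e0) cb.
have [d d0 H] := (nbhs_complexP _ _).1 (filterI du (filterI ca cb)).
apply/nbhs_complexP; exists d => // k kd.
have [|c1 c1k e1] := @MVT_dist R (fun a => u (a +i* Im k)) (fun a => ua (a +i* Im k))
    (Re z) (Re k).
  move=> c ck; have [|[+ _] _] := H (c +i* Im k); last by [].
  apply: le_lt_trans kd; by apply: le_normc; rewrite ?ReD ?ReN ?ImD ?ImN.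
have [|c2 c2k e2] := @MVT_dist R (fun b => u (Re z +i* b)) (fun b => ub (Re z +i* b))
    (Im z) (Im k).
  move=> c ck; have [|[_ +] _] := H (Re z +i* c); last by [].
  apply: le_lt_trans kd; apply: le_normc; rewrite ?ReD ?ReN ?ImD ?ImN/=.
    by rewrite subrr normr0.
  by [].
have -> : u k - u z = ua (c1 +i* Im k) * (Re k - Re z) + ub (Re z +i* c2) * (Im k - Im z).
  by rewrite -e1 -e2 addrA subrK; case: (k) (z) => ? ? [].
set x := Re k - Re z; set y := Im k - Im z.
rewrite (_ : _ - _ = (ua (c1 +i* Im k) - ua z) * x + (ub (Re z +i* c2) - ub z) * y); last by ring.
rewrite (le_trans (ler_normD _ _))// [leRHS]mulrDr !normrM lerD// ler_wpM2r//.
  rewrite distrC; have [|_ [+ _]] := H (c1 +i* Im k); last by [].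
  by apply: le_lt_trans kd; apply: le_normc; rewrite ?ReD ?ReN ?ImD ?ImN.
rewrite distrC; have [|_ [_ +]] := H (Re z +i* c2); last by [].
by apply: le_lt_trans kd; apply: le_normc; rewrite ?ReD ?ReN ?ImD ?ImN//= subrr normr0.
Qed.

Lemma C1_chain (u ua ub : R[i] -> R) g t d :
  (\forall z' \near (g t : R[i]^o),
     is_derive (Re z') 1 (fun a => u (a +i* Im z')) (ua z') /\
     is_derive (Im z') 1 (fun b => u (Re z' +i* b)) (ub z')) ->
  {for g t, continuous (ua : R[i]^o -> R)} ->
  {for g t, continuous (ub : R[i]^o -> R)} ->
  cder g t d ->
  is_derive t 1 (fun s => u (g s)) (ua (g t) * Re d + ub (g t) * Im d).
Proof.
move=> du ca cb dg; apply/is_deriveP => e e0.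
(* The error has two sources, each allotted e / 2: linearizing [g] (tolerance [e1], multiplied by
   the partial derivatives, below [M]) and linearizing [u] (tolerance [e2], multiplied by the
   increment of [g], at most [N] times that of [t] because [e1] is at most 1). *)
pose M := `|ua (g t)| + `|ub (g t)| + 1.
have M0 : 0 < M by rewrite ltr_wpDl// addr_ge0.
pose e1 := Num.min 1 (e / (M * 2)).
have e10 : 0 < e1 by rewrite lt_min ltr01/= divr_gt0// mulr_gt0.
pose N := `|Re d| + `|Im d| + 2.
have N0 : 0 < N by rewrite ltr_wpDl// addr_ge0.
pose e2 := e / (N * 2).
have e20 : 0 < e2 by rewrite divr_gt0// mulr_gt0.
have est := C1_estimate du ca cb e20.
have cg : \forall s \near t,
  `|u (g s) - u (g t) - ((Re (g s) - Re (g t)) * ua (g t) + (Im (g s) - Im (g t)) * ub (g t))| <=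
    e2 * (`|Re (g s) - Re (g t)| + `|Im (g s) - Im (g t)|).
  exact: (cder_continuous dg est).
have [/is_deriveP/(_ _ e10) d1 /is_deriveP/(_ _ e10) d2] := dg.
near=> s.
have h0 : `|u (g s) - u (g t) - ((Re (g s) - Re (g t)) * ua (g t) + (Im (g s) - Im (g t)) * ub (g t))| <=
   e2 * (`|Re (g s) - Re (g t)| + `|Im (g s) - Im (g t)|) by near: s.
have h1 : `|Re (g s) - Re (g t) - (s - t) * Re d| <= e1 * `|s - t| by near: s.
have h2 : `|Im (g s) - Im (g t) - (s - t) * Im d| <= e1 * `|s - t| by near: s.
set X := Re (g s) - Re (g t) in h0 h1 *; set Y := Im (g s) - Im (g t) in h0 h2 *.
have le1 : e1 <= 1 by rewrite ge_min lexx.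
have bX : `|X| <= (`|Re d| + 1) * `|s - t|.
  rewrite -(subrK ((s - t) * Re d) X) (le_trans (ler_normD _ _))//.
  by rewrite normrM [leRHS]mulrDl mul1r addrC [`|s - t| * _]mulrC lerD2l (le_trans h1)// ler_piMl.
have bY : `|Y| <= (`|Im d| + 1) * `|s - t|.
  rewrite -(subrK ((s - t) * Im d) Y) (le_trans (ler_normD _ _))//.
  by rewrite normrM [leRHS]mulrDl mul1r addrC [`|s - t| * _]mulrC lerD2l (le_trans h2)// ler_piMl.
rewrite /GRing.scale/=.
rewrite (_ : _ - _ = (u (g s) - u (g t) - (X * ua (g t) + Y * ub (g t))) +
  ((X - (s - t) * Re d) * ua (g t) + (Y - (s - t) * Im d) * ub (g t))); last by ring.
rewrite (le_trans (ler_normD _ _))// [e in leRHS]splitr [leRHS]mulrDl lerD//.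
  rewrite (le_trans h0)// (@le_trans _ _ (e2 * (N * `|s - t|)))//.
    rewrite ler_pM2l// (le_trans (lerD bX bY))// -mulrDl ler_wpM2r//.
    by rewrite addrACA (_ : 1 + 1 = 2).
  by rewrite mulrA (_ : e2 * N = e / 2)// /e2; field; rewrite gt_eqF.
rewrite (le_trans (ler_normD _ _))// !normrM.
apply: (@le_trans _ _ (e1 * `|s - t| * M)).
  rewrite (le_trans (lerD (ler_wpM2r (normr_ge0 _) h1) (ler_wpM2r (normr_ge0 _) h2)))//.
  by rewrite -mulrDr ler_wpM2l ?lerDl// mulr_ge0// ltW.
rewrite mulrAC ler_wpM2r//.
apply: (@le_trans _ _ (e / (M * 2) * M)); first by rewrite ler_wpM2r ?(ltW M0)// ge_min lexx orbT.
by rewrite (_ : e / (M * 2) * M = e / 2)//; field; rewrite gt_eqF.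
Unshelve. all: by end_near. Qed.

(* [h] is C^1 on [D] with complex derivative [h']. *)
Definition hol D (h h' : R[i] -> R[i]) := forall z, D z ->
  [/\ cder (fun a => h (a +i* Im z)) (Re z) (h' z),
      cder (fun b => h (Re z +i* b)) (Im z) ('i%C * h' z)
    & {for z, continuous (h' : R[i]^o -> R[i]^o)}].

(** By the Cauchy-Riemann equations Re h has partial derivatives Re h' and - Im h', and Im h has Im
    h' and Re h'; the two real chain rules then recombine into one complex product. *)
Lemma hol_chain D h h' g t d : open (D : set R[i]^o) -> hol D h h' ->
  D (g t) -> cder g t d -> cder (fun s => h (g s)) t (h' (g t) * d).
Proof.
move=> oD hh Dt dg.
have nD : nbhs (g t : R[i]^o) D by exact: open_nbhs_nbhs.
have [_ _ /cvg_complexP[c1 c2]] := hh _ Dt.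
split.
  rewrite ReM -mulNr.
  apply: (@C1_chain (fun z => Re (h z)) (fun z => Re (h' z)) (fun z => - Im (h' z))) => //.
  - apply: filterS nD => z /hh [[h1 _] [h2 _] _]; split=> //.
    by move: h2; rewrite ReM /= mul0r mul1r sub0r.
  - exact: (cvgN c2).
rewrite ImM addrC.
apply: (@C1_chain (fun z => Im (h z)) (fun z => Im (h' z)) (fun z => Re (h' z))) => //.
apply: filterS nD => z /hh [[_ h1] [_ h2] _]; split=> //.
by move: h2; rewrite ImM /= mul0r mul1r add0r.
Qed.

Lemma hol_continuous D h h' z : open (D : set R[i]^o) -> hol D h h' -> D z ->
  {for z, continuous (h : R[i]^o -> R[i]^o)}.
Proof.
move=> oD hh Dz.
have nD : nbhs (z : R[i]^o) D by exact: open_nbhs_nbhs.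
have [_ _ /cvg_complexP[c1 c2]] := hh _ Dz.
have FF : Filter (nbhs (z : R[i]^o)) by exact: nbhs_filter.
have key (u ua ub : R[i] -> R) :
  (\forall z' \near (z : R[i]^o),
     is_derive (Re z') 1 (fun a => u (a +i* Im z')) (ua z') /\
     is_derive (Im z') 1 (fun b => u (Re z' +i* b)) (ub z')) ->
  {for z, continuous (ua : R[i]^o -> R)} ->
  {for z, continuous (ub : R[i]^o -> R)} -> {for z, continuous (u : R[i]^o -> R)}.
  move=> du ca cb; apply/(@cvgrPdist_le _ _ _ _ FF) => e e0.
  have [d d0 H] := (nbhs_complexP _ _).1 (C1_estimate du ca cb ltr01).
  (* A Lipschitz constant at [z]: the 2 absorbs the error of [C1_estimate] with tolerance 1, since
     |X| + |Y| is at most twice the modulus. *)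
  pose M := `|ua z| + `|ub z| + 2.
  have M0 : 0 < M by rewrite ltr_wpDl// addr_ge0.
  apply/nbhs_complexP; exists (Num.min d (e / M)); first by rewrite lt_min d0 divr_gt0.
  move=> k; rewrite lt_min => /andP[/H + ke]; rewrite mul1r => est.
  have eX : `|Re k - Re z| <= Normc.normc (k - z) by rewrite -ReN -ReD normr_Re_le.
  have eY : `|Im k - Im z| <= Normc.normc (k - z) by rewrite -ImN -ImD normr_Im_le.
  move: est; set X := Re k - Re z in eX *; set Y := Im k - Im z in eY * => est.
  rewrite distrC -(subrK (X * ua z + Y * ub z) (_ - _)).
  rewrite (le_trans (ler_normD _ _))// (le_trans (lerD est (ler_normD _ _)))// !normrM.
  apply: (@le_trans _ _ (Normc.normc (k - z) * M)); last by rewrite -ler_pdivlMr// ltW.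
  rewrite /M [leRHS]mulrDr [X in _ <= _ + X]mulr_natr mulr2n addrC lerD//; last exact: lerD.
  by rewrite mulrDr lerD// ler_wpM2r.
apply/cvg_complexP; split.
  apply: (key (fun z => Re (h z)) (fun z => Re (h' z)) (fun z => - Im (h' z))) => //.
  - apply: filterS nD => k /hh [[h1 _] [h2 _] _]; split=> //.
    by move: h2; rewrite ReM /= mul0r mul1r sub0r.
  - exact: (cvgN c2).
apply: (key (fun z => Im (h z)) (fun z => Im (h' z)) (fun z => Re (h' z))) => //.
apply: filterS nD => k /hh [[_ h1] [_ h2] _]; split=> //.
by move: h2; rewrite ImM /= mul0r mul1r add0r.
Qed.

End Holomorphic.

(** * Complex-valued integrals over a period *)

Section CircleIntegrals.
Context {R : realType}.
Implicit Types (z w : R[i]) (g k : R -> R[i]) (D E : set R[i]) (t : R).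
Implicit Types (h : R[i] -> R[i]).

Local Notation Re := (@complex.Re R).
Local Notation Im := (@complex.Im R).
Local Notation mu := (@lebesgue_measure R).

Definition cint g : R[i] :=
  (\int[mu]_(t in `[0, 2 * pi]) Re (g t)) +i* (\int[mu]_(t in `[0, 2 * pi]) Im (g t)).

Lemma twopi_gt0 : 0 < 2 * pi :> R.
Proof. by rewrite mulr_gt0// pi_gt0. Qed.

Lemma continuous_ReIm g : continuous (g : R -> R[i]^o) ->
  continuous (fun t => Re (g t)) /\ continuous (fun t => Im (g t)).
Proof. by move=> cg; split=> t; have /cvg_complexP[] := cg t. Qed.

Lemma cintZ w g : continuous (g : R -> R[i]^o) ->
  cint (fun t => w * g t) = w * cint g.
Proof.
move=> /continuous_ReIm[c1 c2]; have i1 := continuous_integrable 0 (2 * pi) c1.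
have i2 := continuous_integrable 0 (2 * pi) c2.
have cZ (a : R) (f : R -> R) : continuous f -> continuous (fun x => a * f x).
  by move=> cf x; apply: cvgM; [exact: cvg_cst|exact: cf].
apply: complex_eqP; rewrite ?ReM ?ImM /=.
  under eq_Rintegral do rewrite ReM.
  rewrite RintegralB// ?RintegralZl//; exact/continuous_integrable/cZ.
under eq_Rintegral do rewrite ImM.
rewrite RintegralD// ?RintegralZl//; exact/continuous_integrable/cZ.
Qed.

Lemma cintD g k : continuous (g : R -> R[i]^o) -> continuous (k : R -> R[i]^o) ->
  cint (fun t => g t + k t) = cint g + cint k.
Proof.
move=> /continuous_ReIm[g1 g2] /continuous_ReIm[k1 k2].
apply: complex_eqP; rewrite ?ReD ?ImD /=.
  by under eq_Rintegral do rewrite ReD; rewrite RintegralD//; exact: continuous_integrable.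
by under eq_Rintegral do rewrite ImD; rewrite RintegralD//; exact: continuous_integrable.
Qed.

Lemma cint_cst w : cint (cst w) = (2 * pi)%:C * w.
Proof.
apply: complex_eqP; rewrite ?ReM ?ImM /= Rintegral_cst//= lebesgue_measure_itv/=
  lte_fin twopi_gt0/= subr0 mul0r ?subr0 ?addr0 mulrC//.
Qed.

Lemma cint_derive g k : continuous (k : R -> R[i]^o) ->
  (forall t, cder g t (k t)) -> cint k = g (2 * pi) - g 0.
Proof.
move=> /continuous_ReIm[c1 c2] gk; apply: complex_eqP => /=.
  rewrite ReD ReN; apply: (@Rintegral_derive _ (fun t => Re (k t)) (fun t => Re (g t))) => //; first exact: twopi_gt0.
  by move=> t; have [] := gk t.
rewrite ImD ImN; apply: (@Rintegral_derive _ (fun t => Im (k t)) (fun t => Im (g t))) => //; first exact: twopi_gt0.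
by move=> t; have [] := gk t.
Qed.

Lemma continuous_cint (T : topologicalType) (G : T -> R -> R[i]) (x : T) :
  (forall t, {for (x, t), continuous (fun p => G p.1 p.2 : R[i]^o)}) ->
  (\forall y \near x, continuous (G y : R -> R[i]^o)) ->
  {for x, continuous (fun y => cint (G y) : R[i]^o)}.
Proof.
move=> cG cGz; apply/cvg_complexP; split.
  apply: (@continuous_Rintegral _ _ (fun y t => Re (G y t))).
  - exact/ltW/twopi_gt0.
  - by move=> t _; have /cvg_complexP[] := cG t.
  - by apply: filterS cGz => y /continuous_ReIm[].
apply: (@continuous_Rintegral _ _ (fun y t => Im (G y t))).
- exact/ltW/twopi_gt0.
- by move=> t _; have /cvg_complexP[] := cG t.
- by apply: filterS cGz => y /continuous_ReIm[].
Qed.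

Lemma cder_cint (G G1 : R -> R -> R[i]) (s : R) :
  (\forall s' \near s, forall t, cder (G ^~ t) s' (G1 s' t)) ->
  (forall t, {for (s, t), continuous (fun p : R * R => G1 p.1 p.2 : R[i]^o)}) ->
  (\forall s' \near s, continuous (G s' : R -> R[i]^o)) ->
  continuous (G1 s : R -> R[i]^o) ->
  cder (fun s' => cint (G s')) s (cint (G1 s)).
Proof.
move=> dG cG1 cG /continuous_ReIm[c1 c2]; split.
  apply: (@derivable_under_Rintegral _ (fun s t => Re (G s t)) (fun s t => Re (G1 s t))) => //.
  - exact: twopi_gt0.
  - by apply: filterS dG => s' H t _; have [] := H t.
  - by move=> t _; have /cvg_complexP[] := cG1 t.
  - by apply: filterS cG => y /continuous_ReIm[].
apply: (@derivable_under_Rintegral _ (fun s t => Im (G s t)) (fun s t => Im (G1 s t))) => //.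
- exact: twopi_gt0.
- by apply: filterS dG => s' H t _; have [] := H t.
- by move=> t _; have /cvg_complexP[] := cG1 t.
- by apply: filterS cG => y /continuous_ReIm[].
Qed.

Lemma cvg_complexM (T : Type) (F : set_system T) (FF : Filter F)
    (f k : T -> R[i]) z w :
  (f : T -> R[i]^o) @ F --> (z : R[i]^o) -> (k : T -> R[i]^o) @ F --> (w : R[i]^o) ->
  (fun x => f x * k x : R[i]^o) @ F --> (z * w : R[i]^o).
Proof.
move=> /cvg_complexP[f1 f2] /cvg_complexP[k1 k2]; apply/cvg_complexP; split.
  under eq_fun do rewrite ReM; rewrite ReM.
  by apply: cvgB; apply: cvgM.
under eq_fun do rewrite ImM; rewrite ImM.
by apply: cvgD; apply: cvgM.
Qed.

Lemma cvg_complexB (T : Type) (F : set_system T) (FF : Filter F)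
    (f k : T -> R[i]) z w :
  (f : T -> R[i]^o) @ F --> (z : R[i]^o) -> (k : T -> R[i]^o) @ F --> (w : R[i]^o) ->
  (fun x => f x - k x : R[i]^o) @ F --> (z - w : R[i]^o).
Proof. by move=> fz kw; exact: cvgB fz kw. Qed.

Lemma cvg_complexV (T : Type) (F : set_system T) (FF : Filter F)
    (f : T -> R[i]) z : z != 0 ->
  (f : T -> R[i]^o) @ F --> (z : R[i]^o) ->
  (fun x => (f x)^-1 : R[i]^o) @ F --> (z^-1 : R[i]^o).
Proof. by move=> z0 fz; exact: cvgV z0 fz. Qed.

Lemma cvg_complexX (T : Type) (F : set_system T) (FF : Filter F)
    (f : T -> R[i]) z n :
  (f : T -> R[i]^o) @ F --> (z : R[i]^o) ->
  (fun x => f x ^+ n : R[i]^o) @ F --> (z ^+ n : R[i]^o).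
Proof.
move=> fz; elim: n => [|n IH]; first exact: cvg_cst.
by under eq_fun do rewrite exprS; rewrite exprS; exact: cvg_complexM.
Qed.

End CircleIntegrals.

(** * Cauchy-type integrals and their holomorphy *)

Section KernelIntegrals.
Context {R : realType}.
Implicit Types (z w : R[i]) (g k zeta : R -> R[i]) (D E : set R[i]) (t : R).
Implicit Types (h : R[i] -> R[i]).

Local Notation Re := (@complex.Re R).
Local Notation Im := (@complex.Im R).
Local Notation normc := (@Normc.normc R).

(** A Cauchy-type integral with arbitrary density: [g] absorbs both the differential and the
    integrated function. *)
Definition kernel_int zeta g n z : R[i] :=
  cint (fun t => (zeta t - z)^-1 ^+ n * g t).

Section Kernel.
Variables (zeta g : R -> R[i]) (E : set R[i]).
Hypothesis czeta : continuous (zeta : R -> R[i]^o).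
Hypothesis cg : continuous (g : R -> R[i]^o).
Hypothesis oE : open (E : set R[i]^o).
Hypothesis zetaE : forall z t, E z -> zeta t - z != 0.

Lemma continuous_kernel (T : topologicalType) (L : T -> R[i]) n (x : T) t :
  {for x, continuous (L : T -> R[i]^o)} -> E (L x) ->
  {for (x, t), continuous
     (fun p : T * R => (zeta p.2 - L p.1)^-1 ^+ n * g p.2 : R[i]^o)}.
Proof.
move=> cL Ex.
have c1 : (fun p : T * R => L p.1 : R[i]^o) @ (x, t) --> (L x : R[i]^o).
  by apply: (cvg_comp fst L _ cL); exact: cvg_fst.
have c2 : (fun p : T * R => zeta p.2 : R[i]^o) @ (x, t) --> (zeta t : R[i]^o).
  exact: (cvg_comp (snd : T * R -> R) (zeta : R -> R[i]^o) cvg_snd (@czeta t)).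
have c3 : (fun p : T * R => g p.2 : R[i]^o) @ (x, t) --> (g t : R[i]^o).
  exact: (cvg_comp (snd : T * R -> R) (g : R -> R[i]^o) cvg_snd (@cg t)).
have FF : Filter (nbhs (x, t)) by exact: nbhs_filter.
have c4 := cvg_complexX FF (n:=n) (cvg_complexV FF (zetaE t Ex) (cvg_complexB FF c2 c1)).
exact: (cvg_complexM FF c4 c3).
Qed.

Lemma continuous_kernel1 n z : E z ->
  continuous (fun t => (zeta t - z)^-1 ^+ n * g t : R[i]^o).
Proof.
move=> Ez t.
have H := @continuous_kernel _ (fun z : R[i]^o => z) n (z : R[i]^o) t (@cvg_id _ _) Ez.
have c : (fun s : R => (z, s)) @ t --> ((z : R[i]^o), t).
  apply: (@cvg_pair _ _ _ (nbhs t) (nbhs (z : R[i]^o)) (nbhs t) _ _ _ (cst z) id).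
    exact: cvg_cst.
  exact: cvg_id.
exact: (cvg_comp _ _ c H).
Qed.

(** The point moves with constant velocity [v]: this covers the horizontal and vertical lines of the
    definition of [hol] and the segment along which the constant Cauchy integral is transported. *)
Lemma cder_kernel (L : R -> R[i]) n s (v : R[i]) :
  (forall a, cder L a v) -> E (L s) ->
  cder (fun a => kernel_int zeta g n.+1 (L a)) s
    (v * (n.+1%:R * kernel_int zeta g n.+2 (L s))).
Proof.
move=> dL Es.
have cL a := cder_continuous (dL a).
have nE : \forall a \near s, E (L a).
  by apply: (cL s); exact: open_nbhs_nbhs.
pose G1 a t := v * n.+1%:R * ((zeta t - L a)^-1 ^+ n.+2 * g t).
rewrite /kernel_int mulrA -cintZ; last exact: continuous_kernel1.
apply: (@cder_cint _ (fun a t => (zeta t - L a)^-1 ^+ n.+1 * g t) G1).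
- apply: filterS nE => a Ea t.
  have d1 : cder (fun a => zeta t - L a) a (- v).
    have := cderD (cder_cst (zeta t) a) (cderZ (-1) (dL a)).
    by rewrite mulN1r add0r; under eq_fun do rewrite mulN1r.
  have := cderM (cderX n (cderV d1 (zetaE t Ea))) (cder_cst (g t) a).
  congr (cder _ _ _); rewrite /G1 mulr0 addr0 /cst !exprS; ring.
- move=> t; apply: cvg_complexM; first exact: cvg_cst.
  exact: continuous_kernel.
- by apply: filterS nE => a Ea; exact: continuous_kernel1.
- by move=> t; apply: cvg_complexM; [exact: cvg_cst|exact: continuous_kernel1].
Qed.

Lemma hol_kernel n : hol E (kernel_int zeta g n.+1)
  (fun z => n.+1%:R * kernel_int zeta g n.+2 z).
Proof.
move=> z Ez.
have zE : z = Re z +i* Im z by case: (z).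
split.
- rewrite -[_ * _]mul1r [X in _ * (_ * _ X)]zE.
  apply: (@cder_kernel (fun a => a +i* Im z)); last by rewrite -zE.
  by move=> a; split; [exact: is_derive_id|exact: is_derive_cst].
- rewrite [X in _ * (_ * _ X)]zE.
  apply: (@cder_kernel (fun b => Re z +i* b)); last by rewrite -zE.
  by move=> a; split; [exact: is_derive_cst|exact: is_derive_id].
- have FF : Filter (nbhs (z : R[i]^o)) by exact: nbhs_filter.
  apply: (cvg_complexM FF); first exact: cvg_cst.
  apply: (@continuous_cint R (R[i]^o) (fun y t => (zeta t - y)^-1 ^+ n.+2 * g t) z).
    by move=> t; apply: (@continuous_kernel (R[i]^o) id n.+2 z t) => //; exact: cvg_id.
  have : nbhs (z : R[i]^o) E by exact: open_nbhs_nbhs.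
  by apply: filterS => y; exact: continuous_kernel1.
Qed.

End Kernel.

Definition circle w (r : R) t : R[i] := w + r%:C * (cos t +i* sin t).

(** Hence the factor [circle w r t - w] in the integrals below stands for the differential of zeta
    divided by i dt, and the normalizing constant is 2 pi instead of 2 pi i. *)
Lemma cder_circle w r t : cder (circle w r) t ('i%C * (circle w r t - w)).
Proof.
have d1 : cder (fun t => cos t +i* sin t) t ('i%C * (cos t +i* sin t)).
  split.
    rewrite ReM /= mul0r mul1r sub0r; exact: is_derive_cos.
  rewrite ImM /= mul0r mul1r add0r; exact: is_derive_sin.
have := cderD (cder_cst w t) (cderZ r%:C d1); congr (cder _ _ _).
by rewrite /circle add0r addrC addKr mulrCA.
Qed.

Lemma continuous_circle w r : continuous (circle w r : R -> R[i]^o).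
Proof. by move=> t; exact: cder_continuous (cder_circle w r t). Qed.

Lemma normc_circle w (r : R) t : 0 <= r -> normc (circle w r t - w) = r.
Proof.
move=> r0; rewrite /circle addrAC subrr add0r Normc.normcM !normcE_sqrt /=.
by rewrite cos2Dsin2 sqrtr1 mulr1 expr0n addr0 sqrtr_sqr ger0_norm.
Qed.

Lemma circle_periodic w r : circle w r (2 * pi) = circle w r 0.
Proof. by rewrite /circle mulr_natl cos2pi sin2pi cos0 sin0. Qed.

Lemma discP w (r : R) z : disc w r z <-> normc (z - w) < r.
Proof. by rewrite /disc /= -[`|_|]/((normc (z - w))%:C) ltcR. Qed.

Lemma open_disc w (r : R) : open (disc w r : set R[i]^o).
Proof.
rewrite openE => z /discP zr; apply/nbhs_complexP.
exists (r - normc (z - w)); first by rewrite subr_gt0.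
move=> z' H; apply/discP; rewrite -(subrKA z) (le_lt_trans (le_normcD _ _))//.
by rewrite -ltrBrDr.
Qed.

Lemma disc_circle_neq w (r : R) z t : 0 < r -> disc w r z -> circle w r t - z != 0.
Proof.
move=> r0 /discP; apply: contraTneq => /subr0_eq <-.
by rewrite normc_circle ?ltxx// ltW.
Qed.

End KernelIntegrals.

(** * The Cauchy formula on a disc *)

Section CauchyFormula.
Context {R : realType}.
Implicit Types (z w : R[i]) (g k zeta : R -> R[i]) (D E : set R[i]) (t : R).
Implicit Types (h : R[i] -> R[i]).

Local Notation Re := (@complex.Re R).
Local Notation Im := (@complex.Im R).
Local Notation normc := (@Normc.normc R).

Lemma cder0_eq g (a b : R) : a < b ->
  {within `[a, b], continuous (g : R -> R[i]^o)} ->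
  (forall s, s \in `]a, b[ -> cder g s 0) -> g a = g b.
Proof.
move=> ab cg dg.
have cg2 x : {for x, continuous (fun s : subspace `[a, b] => Re (g s))} /\
    {for x, continuous (fun s : subspace `[a, b] => Im (g s))}.
  by have /cvg_complexP[] := cg x.
apply: complex_eqP.
  apply: (@is_derive0_eq _ (fun s => Re (g s)) _ _ ab) => [x|x /dg[]//].
  by have [] := cg2 x.
apply: (@is_derive0_eq _ (fun s => Im (g s)) _ _ ab) => [x|x /dg[]//].
by have [] := cg2 x.
Qed.

Lemma cder_affine z w (s : R) : cder (fun s => z + s%:C * w) s w.
Proof.
have d1 : cder (fun s : R => s%:C) s 1.
  by split; [exact: is_derive_id|exact: is_derive_cst].
have := cderD (cder_cst z s) (cderM d1 (cder_cst w s)).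
by rewrite add0r mul1r mulr0 addr0.
Qed.

(** As a function of [z] the integral has derivative zero, hence is constant along the segment from
    [w] to [z]; at [w] the integrand is 1. *)
Lemma cauchy_cst w (r : R) z : 0 < r -> disc w r z ->
  cint (fun t => (circle w r t - z)^-1 * (circle w r t - w)) = (2 * pi)%:C.
Proof.
move=> r0 zr; set zeta := circle w r.
have cz : continuous (zeta : R -> R[i]^o) by exact: continuous_circle.
pose g t : R[i] := zeta t - w.
have cg : continuous (g : R -> R[i]^o).
  move=> t; have FF : Filter (nbhs t) by exact: nbhs_filter.
  by apply: (cvg_complexB FF); [exact: cz|exact: cvg_cst].
have zd y t : disc w r y -> zeta t - y != 0 by exact: disc_circle_neq.
have K2 y : disc w r y -> kernel_int zeta g 2 y = 0.
  move=> yr; rewrite /kernel_int.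
  (* The integrand of the derivative has this periodic primitive, so its integral over a period
     vanishes. *)
  rewrite (@cint_derive _ (fun t => 'i%C * (zeta t - y)^-1)).
  - by rewrite /zeta circle_periodic subrr.
  - exact: (continuous_kernel1 cz cg zd).
  - move=> t.
    have d1 : cder (fun t => zeta t - y) t ('i%C * g t).
      by rewrite -['i%C * _]addr0; apply: cderD; [exact: cder_circle|exact: cder_cst].
    have := cderZ 'i%C (cderV d1 (zd _ t yr)); congr (cder _ _ _).
    by rewrite mulNr mulrCA mulrN (mulrA 'i%C 'i%C) -expr2 sqr_i mulN1r opprK.
pose L (s : R) : R[i] := w + s%:C * (z - w).
have Ld (s : R) : 0 <= s <= 1 -> disc w r (L s).
  move=> /andP[s0 s1]; apply/discP; rewrite /L addrAC subrr add0r Normc.normcM.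
  move/discP : zr; apply: le_lt_trans; rewrite normcE_sqrt/= expr0n addr0 sqrtr_sqr.
  by rewrite ger0_norm// ler_piMl// normcE_sqrt sqrtr_ge0.
have dL (s : R) : cder L s (z - w) by exact: cder_affine.
have dK (s : R) : 0 <= s <= 1 -> cder (fun s => kernel_int zeta g 1 (L s)) s 0.
  move=> /Ld sd; have := cder_kernel cz cg (open_disc (w:=w) (r:=r)) zd 0 dL sd.
  by rewrite K2// !mulr0.
pose K (s : R) := kernel_int zeta g 1 (L s).
have K01 : K 0 = K 1.
  apply: (@cder0_eq K 0 1 ltr01).
    apply: continuous_in_subspaceT => s; rewrite inE/= in_itv/= => /dK.
    exact: cder_continuous.
  by move=> s; rewrite in_itv/= => /andP[/ltW s0 /ltW s1]; apply: dK; rewrite s0 s1.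
transitivity (K 1); first by rewrite /K /L mul1r addrC subrK.
rewrite -K01 /K /L mul0r addr0 /kernel_int -[RHS]mulr1 -cint_cst; congr cint.
apply/funext => t; rewrite expr1 mulVf//; apply: zd.
by apply/discP; rewrite subrr Normc.normc0.
Qed.

Lemma cauchy_disc D h h' w (r : R) z : open (D : set R[i]^o) -> hol D h h' ->
  0 < r -> (forall y, normc (y - w) <= r -> D y) -> disc w r z ->
  cint (fun t => (circle w r t - z)^-1 * ((circle w r t - w) * h (circle w r t)))
  = (2 * pi)%:C * h z.
Proof.
move=> oD hh r0 rD zr; set zeta := circle w r.
have cz : continuous (zeta : R -> R[i]^o) by exact: continuous_circle.
have zd t : zeta t - z != 0 by exact: disc_circle_neq.
pose k t : R[i] := (zeta t - z)^-1 * (zeta t - w).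
have ck : continuous (k : R -> R[i]^o).
  move=> t; have FF : Filter (nbhs t) by exact: nbhs_filter.
  apply: (cvg_complexM FF).
    by apply: (cvg_complexV FF (zd t)); apply: (cvg_complexB FF); [exact: cz|exact: cvg_cst].
  by apply: (cvg_complexB FF); [exact: cz|exact: cvg_cst].
pose gam (s t : R) : R[i] := z + s%:C * (zeta t - z).
have gamD (s t : R) : 0 <= s <= 1 -> D (gam s t).
  move=> /andP[s0 s1]; apply: rD.
  have -> : gam s t - w = (1 - s)%:C * (z - w) + s%:C * (zeta t - w).
    by rewrite /gam rmorphB rmorph1; ring.
  have nC (a : R) : 0 <= a -> normc a%:C = a.
    by move=> a0; rewrite normcE_sqrt/= expr0n addr0 sqrtr_sqr ger0_norm.
  rewrite (le_trans (le_normcD _ _))// !Normc.normcM !nC ?subr_ge0// (normc_circle _ _ (ltW r0)).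
  move/discP : zr => /ltW zr.
  rewrite (@le_trans _ _ ((1 - s) * r + s * r))//; last by rewrite -mulrDl subrK mul1r.
  by rewrite lerD2r ler_wpM2l// subr_ge0.
(* A continuous retraction of the line onto [0, 1]. The contracted circle [gam s] is known to lie in
   [D] only for these [s]; precomposing with [c] gives continuity in full neighbourhoods of the
   endpoints 0 and 1. *)
pose c (s : R) : R := (`|s| - `|s - 1| + 1) / 2.
have cE (s : R) : 0 <= s <= 1 -> c s = s.
  move=> /andP[s0 s1]; rewrite /c ger0_norm// ler0_norm ?subr_le0//; lra.
have c01 (s : R) : 0 <= c s <= 1.
  rewrite /c; case: (ger0P s) => s0; case: (ger0P (s - 1)) => s1; apply/andP; split; lra.
have cc : continuous c.
  move=> s; apply: cvgM; last exact: cvg_cst.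
  apply: cvgD; last exact: cvg_cst.
  apply: cvgB; apply: cvg_norm; first exact: cvg_id.
  by apply: cvgB; [exact: cvg_id|exact: cvg_cst].
have cgam (d : R -> R) (x t : R) : {for x, continuous d} ->
    (fun p : R * R => gam (d p.1) p.2 : R[i]^o) @ (x, t) --> (gam (d x) t : R[i]^o).
  move=> cd; have FF : Filter (nbhs (x, t)) by exact: nbhs_filter.
  have c1 : (fun p : R * R => (d p.1)%:C : R[i]^o) @ (x, t) --> ((d x)%:C : R[i]^o).
    apply: (cvg_Complex FF); last exact: cvg_cst.
    by apply: (cvg_comp fst d _ cd); exact: cvg_fst.
  have c2 : (fun p : R * R => zeta p.2 : R[i]^o) @ (x, t) --> (zeta t : R[i]^o).
    exact: (cvg_comp (snd : R * R -> R) (zeta : R -> R[i]^o) cvg_snd (cz t)).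
  have c0 : (fun p : R * R => z : R[i]^o) @ (x, t) --> (z : R[i]^o) by exact: cvg_cst.
  exact: (cvgD c0 (cvg_complexM FF c1 (cvg_complexB FF c2 c0))).
have cpair (x t : R) : (fun s : R => (x, s)) @ t --> (x, t).
  apply: (@cvg_pair _ _ _ (nbhs t) (nbhs x) (nbhs t) _ _ _ (cst x) id).
    exact: cvg_cst.
  exact: cvg_id.
have ckp (x t : R) : (fun p : R * R => k p.2 : R[i]^o) @ (x, t) --> (k t : R[i]^o).
  exact: (cvg_comp (snd : R * R -> R) (k : R -> R[i]^o) cvg_snd (ck t)).
have czp (x t : R) : (fun p : R * R => zeta p.2 : R[i]^o) @ (x, t) --> (zeta t : R[i]^o).
  exact: (cvg_comp (snd : R * R -> R) (zeta : R -> R[i]^o) cvg_snd (cz t)).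
have hc y : D y -> {for y, continuous (h : R[i]^o -> R[i]^o)}.
  by move=> Dy; exact: hol_continuous oD hh Dy.
have hc' y : D y -> {for y, continuous (h' : R[i]^o -> R[i]^o)} by move=> /hh[].
pose G (s t : R) : R[i] := k t * h (gam s t).
pose G1 (s t : R) : R[i] := k t * (h' (gam s t) * (zeta t - z)).
have cG1 (x t : R) : 0 <= x <= 1 ->
    (fun p : R * R => G1 p.1 p.2 : R[i]^o) @ (x, t) --> (G1 x t : R[i]^o).
  move=> x01; have FF : Filter (nbhs (x, t)) by exact: nbhs_filter.
  apply: (cvg_complexM FF) => //; first exact: ckp.
  apply: (cvg_complexM FF).
    apply: (cvg_comp _ (h' : R[i]^o -> R[i]^o) (cgam id x t (@cvg_id _ _))).
    exact/hc'/gamD.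
  by apply: (cvg_complexB FF); [exact: czp|exact: cvg_cst].
have cG (d : R -> R) (x t : R) : {for x, continuous d} -> 0 <= d x <= 1 ->
    (fun p : R * R => G (d p.1) p.2 : R[i]^o) @ (x, t) --> (G (d x) t : R[i]^o).
  move=> cd x01; have FF : Filter (nbhs (x, t)) by exact: nbhs_filter.
  apply: (cvg_complexM FF) => //; first exact: ckp.
  apply: (cvg_comp _ (h : R[i]^o -> R[i]^o) (cgam d x t cd)).
  exact/hc/gamD.
have cGs (x : R) : 0 <= x <= 1 -> continuous (G x : R -> R[i]^o).
  move=> x01 t; exact: (cvg_comp _ _ (cpair x t) (cG id x t (@cvg_id _ _) x01)).
have cG1s (x : R) : 0 <= x <= 1 -> continuous (G1 x : R -> R[i]^o).
  move=> x01 t; exact: (cvg_comp _ _ (cpair x t) (cG1 x t x01)).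
have near01 (s : R) : s \in `]0, 1[ -> \forall x \near s, 0 <= x <= 1.
  move=> s01; have : nbhs s (`]0, 1[%classic : set R).
    by apply: open_nbhs_nbhs; split => //; exact: interval_open.
  by apply: filterS => x /=; rewrite in_itv/= => /andP[/ltW -> /ltW ->].
have dG (s : R) : s \in `]0, 1[ -> cder (fun s => cint (G s)) s (cint (G1 s)).
  move=> s01; have s01' := nbhs_singleton (near01 _ s01).
  apply: cder_cint.
  - apply: filterS (near01 _ s01) => x x01 t.
    have := cderM (cder_cst (k t) x)
      (hol_chain (g := fun s => gam s t) oD hh (gamD _ t x01) (cder_affine z (zeta t - z) x)).
    by rewrite mul0r add0r.
  - by move=> t; exact: cG1.
  - by apply: filterS (near01 _ s01) => x; exact: cGs.
  - exact: cG1s.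
(* The factors zeta - z cancel in [G1], and s i times [G1 s t] is the derivative in [t] of the
   periodic function [h (gam s t)]. Division by s i requires [s] to be nonzero, whence the open
   interval. *)
have G10 (s : R) : s \in `]0, 1[ -> cint (G1 s) = 0.
  move=> s01; have s01' := nbhs_singleton (near01 _ s01).
  have sn0 : s%:C * 'i%C != 0 :> R[i].
    move: s01; rewrite in_itv/= => /andP[s0 _].
    by rewrite mulf_neq0// eq_complex/= ?(gt_eqF s0)// oner_eq0 andbF.
  have -> : cint (G1 s) = (s%:C * 'i%C)^-1 * (s%:C * 'i%C * cint (G1 s)).
    by rewrite mulKf.
  rewrite -cintZ; last exact: cG1s.
  rewrite (@cint_derive _ (fun t => h (gam s t))).
  - by rewrite /gam /zeta circle_periodic subrr mulr0.
  - move=> t; have FF : Filter (nbhs t) by exact: nbhs_filter.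
    by apply: (cvg_complexM FF); [exact: cvg_cst|exact: cG1s].
  - move=> t.
    have d1 : cder (gam s) t (s%:C * ('i%C * (zeta t - w))).
      rewrite -[_ * _]add0r; apply: cderD; first exact: cder_cst.
      apply: cderZ; rewrite -['i%C * _]addr0.
      by apply: cderD; [exact: cder_circle|exact: cder_cst].
    have := hol_chain oD hh (gamD _ t s01') d1; congr (cder _ _ _).
    by rewrite /G1 /k; field.
have K01 : cint (G (c 0)) = cint (G (c 1)).
  apply: (@cder0_eq (fun s => cint (G (c s))) 0 1 ltr01).
    apply: continuous_subspaceT => x.
    apply: (@continuous_cint _ _ (fun s => G (c s))) => [t|].
      exact: (cG c x t (cc x)).
    by near=> y; exact: cGs.
  move=> s s01; have := dG _ s01; rewrite G10//; apply: cder_near.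
  by apply: filterS (near01 _ s01) => x x01; rewrite cE.
transitivity (cint (G 1)).
  congr cint; apply/funext => t.
  by rewrite /G /k /gam mul1r mulrA [z + _]addrC subrK.
rewrite -[in LHS](cE 1) ?lexx ?ler01// -K01 cE ?lexx ?ler01//.
rewrite mulrC -(cauchy_cst r0 zr) -cintZ; last exact: ck.
by congr cint; apply/funext => t; rewrite /G /gam mul0r addr0 mulrC.
Unshelve. all: by end_near. Qed.

End CauchyFormula.

(** * Taylor coefficients, remainders and higher derivatives in one variable *)

Section CauchyConsequences.
Context {R : realType}.
Implicit Types (z w : R[i]) (g zeta : R -> R[i]) (D E : set R[i]) (t r : R).
Implicit Types (h k : R[i] -> R[i]).

Local Notation Re := (@complex.Re R).
Local Notation Im := (@complex.Im R).
Local Notation normc := (@Normc.normc R).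

Lemma hol_sub D E h h' : E `<=` D -> hol D h h' -> hol E h h'.
Proof. by move=> ED hh z /ED; exact: hh. Qed.

Lemma holZ D h h' (a : R[i]) : hol D h h' -> hol D (fun z => a * h z) (fun z => a * h' z).
Proof.
move=> hh z /hh[h1 h2 c]; split; [exact: cderZ|by rewrite mulrCA; exact: cderZ|].
have FF : Filter (nbhs (z : R[i]^o)) by exact: nbhs_filter.
by apply: (cvg_complexM FF); first exact: cvg_cst.
Qed.

Lemma nbhs_lines E z : open (E : set R[i]^o) -> E z ->
  (\forall a \near Re z, E (a +i* Im z)) /\ (\forall b \near Im z, E (Re z +i* b)).
Proof.
move=> oE Ez; have zE : z = Re z +i* Im z by case: (z).
have nE : nbhs (Re z +i* Im z : R[i]^o) E by apply: open_nbhs_nbhs; rewrite -zE.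
split.
  apply: (@cvg_Complex _ _ (nbhs (Re z)) _ id (cst (Im z)) (Re z) (Im z) _ _ E nE).
    exact: cvg_id.
  exact: cvg_cst.
apply: (@cvg_Complex _ _ (nbhs (Im z)) _ (cst (Re z)) id (Re z) (Im z) _ _ E nE).
  exact: cvg_cst.
exact: cvg_id.
Qed.

Lemma hol_eq E h k h' k' : open (E : set R[i]^o) -> (forall z, E z -> h z = k z) ->
  (forall z, E z -> h' z = k' z) -> hol E h h' -> hol E k k'.
Proof.
move=> oE hk h'k' hh z Ez; have [d1 d2 c] := hh _ Ez.
have [n1 n2] := nbhs_lines oE Ez; have e0 := h'k' z Ez; split; rewrite -?e0.
- by apply: cder_near d1; apply: filterS n1 => a /hk.
- by apply: cder_near d2; apply: filterS n2 => a /hk.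
- have nE : nbhs (z : R[i]^o) E by exact: open_nbhs_nbhs.
  rewrite /prop_for /continuous_at -e0.
  have e : {near (z : R[i]^o), h' =1 k'} by apply: filterS nE => y /h'k'.
  exact: cvg_trans (near_eq_cvg e) c.
Qed.

Lemma hol_uniq E h h1 h2 z : hol E h h1 -> hol E h h2 -> E z -> h1 z = h2 z.
Proof.
move=> k1 k2 Ez; have [a _ _] := k1 _ Ez; have [b _ _] := k2 _ Ez.
exact: cder_uniq a b.
Qed.

(** A total candidate for the complex derivative, taken in the real direction. It agrees with any
    derivative that [hol] provides, so second derivatives can be named without a choice. *)
Definition cderive h z : R[i] :=
  derive1 (fun a => Re (h (a +i* Im z))) (Re z) +i*
  derive1 (fun a => Im (h (a +i* Im z))) (Re z).

Lemma hol_cderive E h h' z : hol E h h' -> E z -> cderive h z = h' z.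
Proof.
move=> hh /hh[[[_ d1] [_ d2]] _ _]; apply: complex_eqP; rewrite /cderive/= derive1E.
  exact: d1.
exact: d2.
Qed.

Section Disc.
Variables (D : set R[i]) (w : R[i]) (r : R).
Hypothesis oD : open (D : set R[i]^o).
Hypothesis r0 : 0 < r.
Hypothesis rD : forall y, normc (y - w) <= r -> D y.

(** The classical coefficient with exponent - n - 1: one power of zeta - w is cancelled by the
    differential. *)
Definition ccoef n h : R[i] :=
  (2 * pi)%:C^-1 * cint (fun t => (circle w r t - w)^-1 ^+ n * h (circle w r t)).

(** The Cauchy integral of h(zeta) (zeta - w)^(-n); the last factor zeta - w is the differential. *)
Definition crem n h z : R[i] :=
  (2 * pi)%:C^-1 * cint (fun t => (circle w r t - z)^-1 *
    (circle w r t - w)^-1 ^+ n * (circle w r t - w) * h (circle w r t)).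

Let twopi_neq0 : (2 * pi)%:C != 0 :> R[i].
Proof. by rewrite eq_complex/= gt_eqF// twopi_gt0. Qed.

Let wd : disc w r w.
Proof. by apply/discP; rewrite subrr Normc.normc0. Qed.

Lemma crem0 h h' z : hol D h h' -> disc w r z -> crem 0 h z = h z.
Proof.
move=> hh zr; rewrite -[RHS](mulKf twopi_neq0) -(cauchy_disc oD hh r0 rD zr).
by congr (_ * cint _); apply/funext => t; rewrite expr0 mulr1 mulrA.
Qed.

Lemma continuous_circle_sub z : continuous (fun t => circle w r t - z : R[i]^o).
Proof.
move=> t; have FF : Filter (nbhs t) by exact: nbhs_filter.
by apply: (cvg_complexB FF); [exact: continuous_circle|exact: cvg_cst].
Qed.

Lemma continuous_circle_inv z n : disc w r z ->
  continuous (fun t => (circle w r t - z)^-1 ^+ n : R[i]^o).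
Proof.
move=> zr t; have FF : Filter (nbhs t) by exact: nbhs_filter.
apply: (cvg_complexX FF); apply: (cvg_complexV FF); last exact: continuous_circle_sub.
exact: disc_circle_neq.
Qed.

(** One step of the geometric expansion: 1 / (zeta - z) = 1 / (zeta - w) + (z - w) / ((zeta - z)
    (zeta - w)), integrated against h(zeta) (zeta - w)^(-n). *)
Lemma cremS h z n : continuous (fun t => h (circle w r t) : R[i]^o) -> disc w r z ->
  crem n h z = ccoef n h + (z - w) * crem n.+1 h z.
Proof.
move=> ch zr; rewrite /crem /ccoef mulrCA -mulrDr; congr (_ * _).
have cw := @continuous_circle_inv w _ wd.
have cz := @continuous_circle_inv z 1 zr.
have c1 : continuous (fun t => (circle w r t - w)^-1 ^+ n * h (circle w r t) : R[i]^o).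
  move=> t; have FF : Filter (nbhs t) by exact: nbhs_filter.
  by apply: (cvg_complexM FF); [exact: cw|exact: ch].
have c2 : continuous (fun t => (circle w r t - z)^-1 *
    (circle w r t - w)^-1 ^+ n.+1 * (circle w r t - w) * h (circle w r t) : R[i]^o).
  move=> t; have FF : Filter (nbhs t) by exact: nbhs_filter.
  apply: (cvg_complexM FF); last exact: ch.
  apply: (cvg_complexM FF); last exact: continuous_circle_sub.
  by apply: (cvg_complexM FF); [exact: cz|exact: cw].
have c3 : continuous (fun t => (z - w) * ((circle w r t - z)^-1 *
    (circle w r t - w)^-1 ^+ n.+1 * (circle w r t - w) * h (circle w r t)) : R[i]^o).
  move=> t; have FF : Filter (nbhs t) by exact: nbhs_filter.
  by apply: (cvg_complexM FF); [exact: cvg_cst|exact: c2].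
rewrite -(cintZ (z - w) c2) -(cintD c1 c3).
congr cint; apply/funext => t; rewrite exprS.
have n1 : circle w r t - z != 0 by exact: disc_circle_neq.
have n2 : circle w r t - w != 0 by exact: disc_circle_neq.
set u := (_ - w)^-1 ^+ n; set v := h _.
by field; rewrite n1 n2.
Qed.

Lemma crem_taylor h h' z n : hol D h h' -> disc w r z ->
  h z - \sum_(0 <= i < n) (z - w) ^+ i * ccoef i h = (z - w) ^+ n * crem n h z.
Proof.
move=> hh zr.
have ch : continuous (fun t => h (circle w r t) : R[i]^o).
  move=> t; apply: (cvg_comp (circle w r : R -> R[i]^o) (h : R[i]^o -> R[i]^o)
    (@continuous_circle _ w r t)).
  by apply: (hol_continuous oD hh); apply: rD; rewrite normc_circle// ltW.
elim: n => [|n IH]; first by rewrite big_nil subr0 expr0 mul1r (crem0 hh).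
rewrite big_nat_recr//= opprD addrA IH (cremS n ch zr).
by rewrite exprSr; ring.
Qed.

(** The remainder is a Cauchy-type integral, so continuity of the boundary values suffices for its
    holomorphy. This yields the holomorphy of the remainder stem function. *)
Lemma hol_crem n h : continuous (fun t => h (circle w r t) : R[i]^o) ->
  exists h', hol (disc w r) (crem n h) h'.
Proof.
move=> ch; pose g t : R[i] := (circle w r t - w)^-1 ^+ n * (circle w r t - w) * h (circle w r t).
have cg : continuous (g : R -> R[i]^o).
  move=> t; have FF : Filter (nbhs t) by exact: nbhs_filter.
  apply: (cvg_complexM FF); last exact: ch.
  by apply: (cvg_complexM FF); [exact: continuous_circle_inv|exact: continuous_circle_sub].
have H := holZ (2 * pi)%:C^-1 (hol_kernel (@continuous_circle _ w r) cg
  (@open_disc _ w r) (fun z t => @disc_circle_neq _ w r z t r0) 0).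
eexists; apply: hol_eq H; [exact: open_disc| |by []].
move=> z _; congr (_ * cint _); apply/funext => t.
by rewrite expr1 /g !mulrA.
Qed.

(** The formula is proved on the whole open disc, not only at the centre, so that the induction can
    differentiate it and conclude by uniqueness of the derivative. *)
Lemma hol_iter_kernel (hs : nat -> R[i] -> R[i]) n z :
  (forall n, hol D (hs n) (hs n.+1)) -> disc w r z ->
  hs n z = n`!%:R * (2 * pi)%:C^-1 *
    kernel_int (circle w r) (fun t => (circle w r t - w) * hs 0 (circle w r t)) n.+1 z.
Proof.
move=> hhs; set g := fun t => _.
have dD : disc w r `<=` D by move=> y /discP /ltW; exact: rD.
have cg : continuous (g : R -> R[i]^o).
  move=> t; have FF : Filter (nbhs t) by exact: nbhs_filter.
  apply: (cvg_complexM FF); first exact: continuous_circle_sub.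
  apply: (cvg_comp (circle w r : R -> R[i]^o) (hs 0 : R[i]^o -> R[i]^o)
    (@continuous_circle _ w r t)).
  by apply: (hol_continuous oD (hhs 0)); apply: rD; rewrite normc_circle// ltW.
elim: n z => [|n IH] z zr.
  rewrite mul1r -(crem0 (hhs 0) zr) /crem; congr (_ * cint _).
  by apply/funext => t; rewrite expr0 mulr1 expr1 /g mulrA.
have H := holZ (n`!%:R * (2 * pi)%:C^-1) (hol_kernel (@continuous_circle _ w r) cg
  (@open_disc _ w r) (fun z t => @disc_circle_neq _ w r z t r0) n).
have H2 : hol (disc w r) (hs n) _ := hol_eq (@open_disc _ w r)
   (fun z zr => esym (IH z zr)) (fun z _ => erefl) H.
rewrite (hol_uniq (hol_sub dD (hhs n)) H2 zr) /= factS natrM mulrA.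
by congr (_ * _); ring.
Qed.

Lemma hol_iter_ccoef (hs : nat -> R[i] -> R[i]) n :
  (forall n, hol D (hs n) (hs n.+1)) -> hs n w = n`!%:R * ccoef n (hs 0%N).
Proof.
move=> hhs; rewrite (hol_iter_kernel n hhs wd) -mulrA; congr (_ * (_ * cint _)).
apply/funext => t; rewrite exprSr -mulrA mulKf//; exact: disc_circle_neq.
Qed.

End Disc.

(** Near each point the Cauchy formula represents [h], hence also [h'], by a Cauchy-type integral,
    which can be differentiated again. This is what makes iterated slice derivatives meaningful. *)
Lemma hol_smooth D h h' : open (D : set R[i]^o) -> hol D h h' ->
  hol D h' (cderive h').
Proof.
move=> oD hh z Dz.
have /nbhs_complexP[e e0 eD] : nbhs (z : R[i]^o) D by exact: open_nbhs_nbhs.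
have r0 : 0 < e / 2 by rewrite divr_gt0.
have rD (y : R[i]) : normc (y - z) <= e / 2 -> D y.
  by move=> H; apply: eD; rewrite (le_lt_trans H)// ltr_pdivrMr// ltr_pMr// ltrDl.
pose r := e / 2.
pose g t : R[i] := (circle z r t - z) * h (circle z r t).
have cg : continuous (g : R -> R[i]^o).
  move=> t; have FF : Filter (nbhs t) by exact: nbhs_filter.
  apply: (cvg_complexM FF); first exact: continuous_circle_sub.
  apply: (cvg_comp (circle z r : R -> R[i]^o) (h : R[i]^o -> R[i]^o)
    (@continuous_circle _ z r t)).
  by apply: (hol_continuous oD hh); apply: rD; rewrite normc_circle// ltW.
have zd (y : R[i]) t : disc z r y -> circle z r t - y != 0 by exact: disc_circle_neq.
have K n := hol_kernel (@continuous_circle _ z r) cg (@open_disc _ z r) zd n.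
have dD : disc z r `<=` D by move=> y /discP /ltW; exact: rD.
have h1 y : disc z r y -> h y = (2 * pi)%:C^-1 * kernel_int (circle z r) g 1 y.
  move=> yr; rewrite -(crem0 oD r0 rD hh yr) /crem; congr (_ * cint _).
  by apply/funext => t; rewrite expr0 mulr1 expr1 /g mulrA.
have H1 : hol (disc z r) h _ := hol_eq (@open_disc _ z r)
   (fun y yr => esym (h1 y yr)) (fun y _ => erefl) (holZ (2 * pi)%:C^-1 (K 0)).
have H2 : hol (disc z r) h' _ := hol_eq (@open_disc _ z r)
   (fun y yr => esym (hol_uniq (hol_sub dD hh) H1 yr)) (fun y _ => erefl)
   (holZ (2 * pi)%:C^-1 (holZ 1%:R (K 1))).
have zz : disc z r z by apply/discP; rewrite subrr Normc.normc0.
have := hol_eq (@open_disc _ z r) (fun y _ => erefl)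
  (fun y yr => esym (hol_cderive H2 yr)) H2.
exact.
Qed.

End CauchyConsequences.

(** * Finite-dimensional normed spaces *)

Section FiniteDimension.
Context {R : realType}.

Section Coordinates.
Variable V : vectType R.
Implicit Types (v : V).

Local Notation e_ := (vbasis {:V}).

Lemma coordE v : v = \sum_(i < \dim {:V}) coord e_ i v *: e_`_i.
Proof. exact: coord_vbasis (memvf v). Qed.

Lemma coord_sum (k : 'I_(\dim {:V}) -> R) i :
  coord e_ i (\sum_(j < \dim {:V}) k j *: e_`_j) = k i.
Proof. exact/coord_sum_free/basis_free/vbasisP. Qed.

Lemma coord_eq u v : (forall i, coord e_ i u = coord e_ i v) -> u = v.
Proof.
by move=> uv; rewrite [u]coordE [v]coordE; apply: eq_bigr => i _; rewrite uv.
Qed.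

Lemma linear_coordE (W : lmodType R) (T : V -> W) v : linear T ->
  T v = \sum_(i < \dim {:V}) coord e_ i v *: T e_`_i.
Proof.
move=> lT; pose mT := GRing.isLinear.Build R V W *:%R T lT.
pose lin : {linear V -> W} := HB.pack T mT.
rewrite -[T]/(lin : V -> W) {1}[v]coordE linear_sum.
by apply: eq_bigr => i _; rewrite linearZ.
Qed.

End Coordinates.

Lemma continuous_sum (n : nat) (f : 'I_n -> R -> R) : (forall i, continuous (f i)) ->
  continuous (fun t => \sum_(i < n) f i t).
Proof.
elim: n f => [|n IH] f cf.
  by under eq_fun do rewrite big_ord0; move=> t; exact: cvg_cst.
under eq_fun do rewrite big_ord_recr.
by move=> t; apply: cvgD; [exact: (IH (fun i => f (widen_ord (leqnSn n) i)))|exact: cf].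
Qed.

Lemma Rintegral_sum (n : nat) (f : 'I_n -> R -> R) (a b : R) :
  (forall i, continuous (f i)) ->
  \int[lebesgue_measure]_(t in `[a, b]) (\sum_(i < n) f i t) =
  \sum_(i < n) \int[lebesgue_measure]_(t in `[a, b]) f i t.
Proof.
elim: n f => [|n IH] f cf.
  under eq_Rintegral do rewrite big_ord0.
  by rewrite big_ord0 Rintegral_cst//= mul0r.
under eq_Rintegral do rewrite big_ord_recr.
rewrite big_ord_recr/= RintegralD//; last 2 first.
- exact/continuous_integrable/continuous_sum.
- exact: continuous_integrable.
by rewrite IH.
Qed.

Section VectorIntegral.

Definition coord_continuous (U : vectType R) (g : R -> U) :=
  forall i, continuous (fun t => coord (vbasis {:U}) i (g t) : R).

Lemma coord_continuousD (U : vectType R) (g k : R -> U) :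
  coord_continuous g -> coord_continuous k -> coord_continuous (fun t => g t + k t).
Proof.
move=> cg ck i; under eq_fun do rewrite linearD.
by move=> t; apply: cvgD; [exact: cg|exact: ck].
Qed.

Variables (V W : vectType R) (T : V -> W) (g : R -> V).
Hypotheses (lT : linear T) (cg : coord_continuous g).

Lemma coord_continuous_linear : coord_continuous (fun t => T (g t)).
Proof.
move=> k; under eq_fun do rewrite (linear_coordE _ lT) linear_sum.
apply: continuous_sum => i; under eq_fun do rewrite linearZ/=.
by move=> t; apply: cvgM; [exact: cg|exact: cvg_cst].
Qed.

Lemma coord_vintegral (a b : R) i : coord (vbasis {:V}) i (vintegral a b g) =
  \int[lebesgue_measure]_(t in `[a, b]) coord (vbasis {:V}) i (g t).
Proof. exact: coord_sum. Qed.

(** The tool that moves J and the evaluations of A (x) C through integrals defined in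
    coordinates. *)
Lemma linear_vintegral (a b : R) : T (vintegral a b g) = vintegral a b (fun t => T (g t)).
Proof.
rewrite [LHS](linear_coordE _ lT).
under eq_bigr do rewrite coord_vintegral.
apply: coord_eq => k; rewrite [RHS]coord_sum linear_sum/=.
under [RHS]eq_Rintegral do rewrite (linear_coordE _ lT) linear_sum.
rewrite Rintegral_sum; last first.
  move=> i; under eq_fun do rewrite linearZ/=.
  by move=> t; apply: cvgM; [exact: cg|exact: cvg_cst].
apply: eq_bigr => i _; rewrite linearZ/=.
under [RHS]eq_Rintegral do rewrite linearZ/=.
by rewrite RintegralZr//; exact: continuous_integrable.
Qed.

End VectorIntegral.

Section Norm.
Variable V : normedVectType R.
Local Notation e_ := (vbasis {:V}).

(** Equivalence of norms: |f| attains on the compact unit sphere of the sup norm a minimum that is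
    positive because the basis is free; the constant is its inverse. *)
Lemma coord_bound : exists2 c : R, 0 < c & forall v i, `|coord e_ i v| <= c * `|v|.
Proof.
pose f (x : 'rV[R]_(\dim {:V})) : V := \sum_i x 0 i *: e_`_i.
have fE v : f (\row_i coord e_ i v) = v.
  by rewrite [RHS]coordE; apply: eq_bigr => i _; rewrite mxE.
have fZ (a : R) x : f (a *: x) = a *: f x.
  by rewrite /f scaler_sumr; apply: eq_bigr => i _; rewrite mxE scalerA.
have fB x y : f x - f y = f (x - y).
  by rewrite /f -sumrB; apply: eq_bigr => i _; rewrite !mxE scalerBl.
pose S : R := \sum_i `|e_`_(i : 'I_(\dim {:V}))|.
have xle (x : 'rV[R]_(\dim {:V})) i : `|x 0 i| <= `|x|.
  rewrite [leRHS]/Num.norm/= mx_normrE.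
  by apply/bigmax_geP; right; exists (0, i).
have fle x : `|f x| <= `|x| * S.
  rewrite (le_trans (ler_norm_sum _ _ _))// mulr_sumr ler_sum// => i _.
  by rewrite normrZ ler_wpM2r.
have cf : continuous f.
  move=> x; have FF : Filter (nbhs x) by exact: nbhs_filter.
  apply/(@cvgrPdist_le _ _ _ _ FF) => /= e e0.
  have S0 : 0 < S + 1 by rewrite ltr_wpDl// sumr_ge0.
  near=> y; rewrite fB (le_trans (fle _))//.
  rewrite (@le_trans _ _ (e / (S + 1) * (S + 1)))//; last by rewrite divfK ?gt_eqF.
  apply: ler_pM => //; [exact: sumr_ge0| |by rewrite lerDl].
  near: y; apply: cvgr_dist_le; first exact: cvg_id.
  by rewrite divr_gt0.
have cN : continuous (fun x : 'rV[R]_(\dim {:V}) => `|f x|).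
  by move=> x; exact: cvg_norm (cf x).
pose A := [set x : 'rV[R]_(\dim {:V}) | `|x| = 1].
have cA : compact A.
  apply: bounded_closed_compact.
    exists 1; split; first exact: num_real.
    by move=> M M1 x; rewrite /A/= => ->; exact: ltW.
  rewrite (_ : A = (fun x : 'rV[R]_(\dim {:V}) => `|x|) @^-1` [set 1])//.
  apply: preimage_closed; last exact: closed_eq.
  by move=> x _; exact: norm_continuous.
(* An empty sphere forces every coordinate vector to vanish, since a nonzero one could be
   normalized; any constant then works. *)
have [A0|A0] := pselect (A !=set0); last first.
  exists 1 => // v i; have [x0|x0] := eqVneq (\row_i coord e_ i v) 0.
    have -> : coord e_ i v = 0 by move/rowP : x0 => /(_ i); rewrite !mxE.
    by rewrite normr0 mul1r.
  exfalso; apply: A0; exists (`|\row_i coord e_ i v|^-1 *: \row_i coord e_ i v).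
  by rewrite /A/= normrZ normfV normr_id mulVf// normr_eq0.
have [x0 /[!inE] Ax0 min] := EVT_min_rV A0 cA (continuous_subspaceT cN).
have m0 : 0 < `|f x0|.
  rewrite normr_gt0; apply/eqP => fx0.
  have : x0 = 0.
    apply/rowP => i; rewrite mxE -(coord_sum (fun i => x0 0 i) i).
    by rewrite -/(f x0) fx0 linear0.
  by move=> x00; move: Ax0; rewrite /A/= x00 normr0 => /esym/eqP; rewrite oner_eq0.
exists `|f x0|^-1; first by rewrite invr_gt0.
move=> v i; rewrite mulrC ler_pdivlMr//.
set x := \row_i coord e_ i v.
have -> : coord e_ i v = x 0 i by rewrite mxE.
rewrite (le_trans (ler_wpM2r (ltW m0) (xle x i)))//.
have [->|xn0] := eqVneq x 0; first by rewrite normr0 mul0r.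
have : `|f x0| <= `|f (`|x|^-1 *: x)|.
  by apply: min; rewrite inE /A/= normrZ normfV normr_id mulVf// normr_eq0.
by rewrite fZ normrZ normfV normr_id fE mulrC ler_pdivlMr ?normr_gt0// mulrC.
Unshelve. all: by end_near. Qed.

Lemma linear_bound (W : normedModType R) (T : V -> W) : linear T ->
  exists2 c : R, 0 < c & forall v, `|T v| <= c * `|v|.
Proof.
move=> lT; have [c c0 cb] := coord_bound.
have S0 : 0 <= \sum_(i < \dim {:V}) `|T e_`_i| by exact: sumr_ge0.
exists (c * (1 + \sum_(i < \dim {:V}) `|T e_`_i|)); first by rewrite mulr_gt0// ltr_pwDl.
move=> v; rewrite (linear_coordE _ lT) (le_trans (ler_norm_sum _ _ _))//.
apply: (@le_trans _ _ (c * `|v| * \sum_(i < \dim {:V}) `|T e_`_i|)).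
  by rewrite mulr_sumr ler_sum// => i _; rewrite normrZ ler_wpM2r.
by rewrite mulrAC ler_wpM2r// ler_pM2l// lerDr.
Qed.

Lemma linear_cvg (W : normedModType R) (T : V -> W) (S : Type)
    (F : set_system S) (FF : Filter F) (f : S -> V) (v : V) : linear T ->
  f @ F --> v -> (fun s => T (f s)) @ F --> T v.
Proof.
move=> lT /cvgrPdist_le fv; have [c c0 cb] := linear_bound lT.
apply/cvgrPdist_le => e e0; have ec : 0 < e / c by rewrite divr_gt0.
apply: filterS (fv _ ec) => s H.
have -> : T v - T (f s) = T (v - f s).
  by rewrite [v - f s]addrC -[- f s]scaleN1r lT scaleN1r addrC.
by rewrite (le_trans (cb _))// mulrC -ler_pdivlMr.
Qed.

Lemma coord_cvgP (S : Type) (F : set_system S) (FF : Filter F) (f : S -> V) (v : V) :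
  (forall i, (fun s => coord e_ i (f s) : R) @ F --> (coord e_ i v : R)) ->
  f @ F --> v.
Proof.
move=> fv; apply/cvgrPdist_le => e e0.
pose B := 1 + \sum_(i < \dim {:V}) `|e_`_i|.
have B0 : 0 < B by rewrite ltr_pwDl// sumr_ge0.
have eB : 0 < e / B by rewrite divr_gt0.
have H : \forall s \near F, forall i, `|coord e_ i v - coord e_ i (f s)| <= e / B.
  apply: filter_forall => i.
  by have /cvgrPdist_le/(_ _ eB) := fv i.
apply: filterS H => s H.
rewrite [v - f s]coordE (le_trans (ler_norm_sum _ _ _))//.
apply: (@le_trans _ _ (e / B * \sum_(i < \dim {:V}) `|e_`_i|)).
  by rewrite mulr_sumr ler_sum// => i _; rewrite normrZ ler_wpM2r// linearB; exact: H.
apply: (@le_trans _ _ (e / B * B)); last by rewrite divfK ?gt_eqF.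
by rewrite ler_pM2l// lerDr.
Qed.

Lemma coord_continuousP (g : R -> V) : continuous g -> coord_continuous g.
Proof.
move=> cg i t; have lT : linear (fun v => coord e_ i v : R^o).
  by move=> a u v; rewrite linearP.
exact: (linear_cvg _ lT (cg t)).
Qed.

Lemma is_derive_coord (f : R -> V) (x : R) (d : V) :
  (forall i, is_derive x 1 (fun s => coord e_ i (f s) : R) (coord e_ i d : R)) ->
  is_derive x 1 f d.
Proof.
move=> df; apply/is_derive_cvgP; apply: coord_cvgP => i.
have /is_derive_cvgP := df i; apply: cvg_trans; apply: near_eq_cvg.
by near=> h; rewrite [RHS]linearZ/= [in RHS]linearB.
Unshelve. all: by end_near. Qed.

(** The coordinates are bounded separately and reassembled; the price is the factor c B, which
    depends on the space and the basis but not on [g]. *)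
Lemma vintegral_bound : exists2 K : R, 0 < K & forall (a b M : R) (g : R -> V),
  a <= b -> coord_continuous g -> (forall t, t \in `[a, b] -> `|g t| <= M) ->
  `|vintegral a b g| <= K * M * (b - a).
Proof.
have [c c0 cb] := coord_bound.
pose B := 1 + \sum_(i < \dim {:V}) `|e_`_i|.
have B0 : 0 < B by rewrite ltr_pwDl// sumr_ge0.
exists (c * B); first by rewrite mulr_gt0.
move=> a b M g ab cg gM.
have M0 : 0 <= M.
  by rewrite (le_trans _ (gM a _))//= in_itv/= lexx ab.
rewrite (le_trans (ler_norm_sum _ _ _))//.
apply: (@le_trans _ _ (c * M * (b - a) * \sum_(i < \dim {:V}) `|e_`_i|)).
  rewrite mulr_sumr ler_sum// => i _; rewrite normrZ ler_wpM2r//.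
  apply: le_normr_Rintegral_cst => // t /gM tM.
  by rewrite (le_trans (cb _ _))// ler_pM2l.
rewrite -!mulrA ler_pM2l// [leRHS]mulrCA ler_wpM2l// [leRHS]mulrC ler_wpM2l ?subr_ge0//.
by rewrite lerDr.
Qed.

End Norm.

Lemma is_derive_linear (V W : normedModType R) (T : V -> W) (c : R) (f : R -> V)
    (x : R) (d : V) : linear T -> (forall v, `|T v| <= c * `|v|) ->
  is_derive x 1 f d -> is_derive x 1 (fun s => T (f s)) (T d).
Proof.
move=> lT cb /is_deriveP df; apply/is_deriveP => e e0.
have c1 : 0 < `|c| + 1 by rewrite ltr_wpDl.
have ec : 0 < e / (`|c| + 1) by rewrite divr_gt0.
apply: filterS (df _ ec) => y H.
have TB u v : T (u - v) = T u - T v by rewrite [u - v]addrC -[- v]scaleN1r lT scaleN1r addrC.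
have TZ (a : R) v : T (a *: v) = a *: T v.
  have T0 : T 0 = 0 by have := TB 0 0; rewrite !subrr.
  by rewrite -[a *: v]addr0 lT T0 addr0.
rewrite -TZ -!TB (le_trans (cb _))//.
apply: (@le_trans _ _ ((`|c| + 1) * (e / (`|c| + 1) * `|y - x|))).
  apply: le_trans (ler_wpM2l (ltW c1) H); apply: ler_wpM2r => //.
  by rewrite (le_trans (ler_norm _))// lerDl.
by rewrite mulrA mulrCA divff ?gt_eqF// mulr1.
Qed.

(** Expanding [x] in a basis reduces the bilinear product to finitely many linear maps of [y], each
    of which is bounded. *)
Lemma amul_bound (A : altStarAlgType R) : exists2 K : R, 0 < K &
  forall x y : A, `|x ** y| <= K * `|x| * `|y|.
Proof.
have [c c0 cb] := coord_bound A.
have lin (x : A) : linear (fun y => x ** y : A).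
  by move=> a u v; rewrite amulDr amulZr.
have kex (i : 'I_(\dim {:A})) :
    exists k : R, 0 < k /\ forall y, `|(vbasis {:A})`_i ** y| <= k * `|y|.
  by have [k k0 kb] := linear_bound (lin (vbasis {:A})`_i); exists k.
have [k kP] := choice kex.
have k0 i : 0 <= k i by have [/ltW] := kP i.
exists (c * (1 + \sum_i k i)); first by rewrite mulr_gt0// ltr_pwDl// sumr_ge0.
move=> x y; have lx : linear (fun x => x ** y : A).
  by move=> a u v; rewrite amulDl amulZl.
rewrite (linear_coordE _ lx) (le_trans (ler_norm_sum _ _ _))//.
apply: (@le_trans _ _ (c * `|x| * `|y| * \sum_i k i)).
  rewrite mulr_sumr ler_sum// => i _; rewrite normrZ -mulrA ler_pM//.
  by have [_ /(_ y)] := kP i; rewrite mulrC.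
rewrite [leRHS](_ : _ = c * `|x| * `|y| * (1 + \sum_i k i)); last by ring.
by rewrite ler_wpM2l// ?lerDr// !mulr_ge0// ltW.
Qed.

End FiniteDimension.

(** * The complex structure defined by an imaginary unit *)

Section ComplexStructure.
Context {R : realType} {A : altStarAlgType R}.
Implicit Types (x y u v : A) (c d : R[i]) (z w : R[i]) (D E : set R[i]).

Local Notation Re := (@complex.Re R).
Local Notation Im := (@complex.Im R).
Local Notation e_ := (vbasis {:A}).

Lemma amul0r x : x ** 0 = 0.
Proof. by rewrite -(scale0r (0 : A)) amulZr !scale0r. Qed.
Lemma amulNr x y : x ** (- y) = - (x ** y).
Proof. by rewrite -scaleN1r amulZr scaleN1r. Qed.
Lemma amulNl x y : (- x) ** y = - (x ** y).
Proof. by rewrite -scaleN1r amulZl scaleN1r. Qed.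
Lemma amulBr x y u : x ** (y - u) = x ** y - x ** u.
Proof. by rewrite amulDr amulNr. Qed.
Lemma amulBl x y u : (y - u) ** x = y ** x - u ** x.
Proof. by rewrite amulDl amulNl. Qed.
Lemma linear_amul x : linear (fun y => x ** y : A).
Proof. by move=> s u v; rewrite amulDr amulZr. Qed.

Lemma coordD i u v : coord e_ i (u + v) = coord e_ i u + coord e_ i v :> R.
Proof. exact: linearD. Qed.
Lemma coordN i v : coord e_ i (- v) = - coord e_ i v :> R.
Proof. exact: linearN. Qed.
Lemma coordZ i (s : R) v : coord e_ i (s *: v) = s * coord e_ i v :> R.
Proof. exact: linearZ. Qed.

Variable J : A.
Hypothesis hJ : J ** J = - aone.

Lemma amulJJ v : J ** (J ** v) = - v.
Proof. by rewrite amul_altl hJ amulNl amul1l. Qed.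

(* The action of C on A by left multiplication through i |-> J. *)
Definition cact c v : A := Re c *: v + Im c *: (J ** v).
Definition emb c : A := areal (Re c) + Im c *: J.

Lemma cactDr c u v : cact c (u + v) = cact c u + cact c v.
Proof. by rewrite /cact amulDr !scalerDr addrACA. Qed.
Lemma cactZr c (s : R) v : cact c (s *: v) = s *: cact c v.
Proof. by rewrite /cact amulZr scalerDr !scalerA [s * _]mulrC [s * Im c]mulrC. Qed.
Lemma linear_cact c : linear (cact c).
Proof. by move=> s u v; rewrite cactDr cactZr. Qed.
Lemma cactDl c d v : cact (c + d) v = cact c v + cact d v.
Proof. by rewrite /cact ReD ImD !scalerDl addrACA. Qed.
Lemma cactM c d v : cact c (cact d v) = cact (c * d) v.
Proof.
rewrite /cact !amulDr !amulZr amulJJ ReM ImM.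
by apply: coord_eq => i; rewrite !(coordD, coordN, coordZ); ring.
Qed.
Lemma cact1 v : cact 1 v = v.
Proof. by rewrite /cact /= scale1r scale0r addr0. Qed.
Lemma cactR (s : R) v : cact s%:C v = s *: v.
Proof. by rewrite /cact /= scale0r addr0. Qed.
Lemma cacti v : cact 'i%C v = J ** v.
Proof. by rewrite /cact /= scale1r scale0r add0r. Qed.
Lemma embE c v : emb c ** v = cact c v.
Proof. by rewrite /emb amulDl !amulZl amul1l. Qed.
Lemma emb_cact c : emb c = cact c aone.
Proof. by rewrite -embE amul1r. Qed.
Lemma embM c d : emb c ** emb d = emb (c * d).
Proof. by rewrite embE !emb_cact cactM. Qed.
Lemma embD c d : emb (c + d) = emb c + emb d.
Proof. by rewrite !emb_cact cactDl. Qed.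
Lemma embN c : emb (- c) = - emb c.
Proof. by rewrite /emb ReN ImN /areal !scaleNr opprD. Qed.
Lemma embB c d : emb (c - d) = emb c - emb d.
Proof. by rewrite embD embN. Qed.
Lemma emb1 : emb 1 = aone.
Proof. by rewrite emb_cact cact1. Qed.
Lemma apow_emb c n : apow (emb c) n = emb (c ^+ n).
Proof.
elim: n => [|n IH]; first by rewrite expr0 emb1.
by rewrite /apow iterS -/(apow _ n) IH embM exprS.
Qed.

Lemma ainv_emb c : c != 0 -> ainv (emb c) = emb c^-1.
Proof.
move=> c0; rewrite /ainv; case: xgetP => [q _ /= [q1 _]|/(_ (emb c^-1)) []].
  by rewrite -[RHS]amul1r -q1 !embE cactM mulVf// cact1.
by rewrite /= !embM mulfV// mulVf// emb1.
Qed.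

(** The functional with real part [coord e_ i] that is complex linear for the structure defined by
    J; the minus sign turns left multiplication by J into multiplication by i. *)
Definition lc i v : R[i] := coord e_ i v -i* coord e_ i (J ** v).

Lemma lc_eq u v : (forall i, lc i u = lc i v) -> u = v.
Proof. by move=> uv; apply: coord_eq => i; have [] := uv i. Qed.
Lemma lcD i u v : lc i (u + v) = lc i u + lc i v.
Proof. by rewrite /lc amulDr !coordD; apply: complex_eqP; rewrite ?ReD ?ImD//= opprD. Qed.
Lemma lcN i v : lc i (- v) = - lc i v.
Proof. by rewrite /lc amulNr !coordN; apply: complex_eqP; rewrite ?ReN ?ImN. Qed.
Lemma lcB i u v : lc i (u - v) = lc i u - lc i v.
Proof. by rewrite lcD lcN. Qed.
Lemma lcM i c v : lc i (cact c v) = c * lc i v.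
Proof.
apply: complex_eqP; rewrite ?ReM ?ImM /lc /cact /= ?amulDr ?amulZr ?amulJJ.
  by rewrite !(coordD, coordN, coordZ); ring.
by rewrite !(coordD, coordN, coordZ); ring.
Qed.
Lemma lcZ i (s : R) v : lc i (s *: v) = s%:C * lc i v.
Proof. by rewrite -cactR lcM. Qed.
Lemma lc0 i : lc i 0 = 0.
Proof. by rewrite -(scale0r (0 : A)) lcZ mul0r. Qed.
Lemma lc_sum i n (f : nat -> A) :
  lc i (\sum_(0 <= k < n) f k) = \sum_(0 <= k < n) lc i (f k).
Proof.
by elim: n => [|n IH]; rewrite ?big_nil ?lc0// !big_nat_recr//= lcD IH.
Qed.

Lemma linear_coordJ i : linear (fun v => - coord e_ i (J ** v) : R^o).
Proof. by move=> s u v; rewrite amulDr amulZr linearP/= opprD scalerN. Qed.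

Lemma linear_coord i : linear (fun v => coord e_ i v : R^o).
Proof. by move=> s u v; rewrite linearP. Qed.

Lemma lc_cvgP (S : Type) (F : set_system S) (FF : Filter F) (f : S -> A) v :
  f @ F --> v <-> (forall i, (fun s => lc i (f s) : R[i]^o) @ F --> (lc i v : R[i]^o)).
Proof.
split=> [fv i|fv].
  apply/cvg_complexP; split; first exact: (linear_cvg FF (linear_coord i) fv).
  exact: (linear_cvg FF (linear_coordJ i) fv).
by apply: (coord_cvgP FF) => i; have /cvg_complexP[] := fv i.
Qed.

Lemma lc_cderP (f : R -> A) (t : R) v :
  is_derive t 1 f v <-> forall i, cder (fun s => lc i (f s)) t (lc i v).
Proof.
split=> [df i|df].
  have [c _ cb] := linear_bound (linear_coord i).
  have [k _ kb] := linear_bound (linear_coordJ i).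
  split; first exact: is_derive_linear (linear_coord i) cb df.
  exact: is_derive_linear (linear_coordJ i) kb df.
by apply: is_derive_coord => i; have [] := df i.
Qed.

Lemma lc_vintegral i (g : R -> A) : coord_continuous g ->
  lc i (vintegral 0 (2 * pi) g) = cint (fun t => lc i (g t)).
Proof.
move=> cg; apply: complex_eqP; first by rewrite /= coord_vintegral.
rewrite /= (linear_vintegral (linear_amul J) cg) coord_vintegral.
rewrite -mulN1r -RintegralZl//; last first.
  exact/continuous_integrable/(coord_continuous_linear (linear_amul J) cg).
by apply: eq_Rintegral => t _; rewrite mulN1r.
Qed.

(* phi is C^1 and holomorphic on D for the complex structure defined by J,
   with complex derivative psi. *)
Definition vhol D (phi psi : R[i] -> A) :=
  forall i, hol D (fun z => lc i (phi z)) (fun z => lc i (psi z)).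

Lemma vhol_chain D phi psi (g : R -> R[i]) (t : R) d : open (D : set R[i]^o) ->
  vhol D phi psi -> D (g t) -> cder g t d ->
  is_derive t 1 (fun s => phi (g s)) (cact d (psi (g t))).
Proof.
move=> oD hh Dt dg; apply/lc_cderP => i; rewrite lcM mulrC.
exact: hol_chain oD (hh i) Dt dg.
Qed.

Lemma vhol_continuous D phi psi z : open (D : set R[i]^o) ->
  vhol D phi psi -> D z -> {for z, continuous (phi : R[i]^o -> A)}.
Proof.
move=> oD hh Dz; have FF : Filter (nbhs (z : R[i]^o)) by exact: nbhs_filter.
by apply/(lc_cvgP FF) => i; exact: hol_continuous oD (hh i) Dz.
Qed.

Definition vder (phi : R[i] -> A) z : A :=
  derive1 (fun a => phi (a +i* Im z)) (Re z).

(** The scalar derivatives of the redundant functionals are tied together by the derivative of [phi]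
    in the real direction, assembled from the real coordinates. *)
Lemma vhol_vder D phi : open (D : set R[i]^o) ->
  (forall i, exists h', hol D (fun z => lc i (phi z)) h') ->
  vhol D phi (vder phi).
Proof.
move=> oD H i; have [h' hh'] := H i.
apply: (hol_eq oD _ _ hh') => // z Dz.
pose d : A := \sum_(j < \dim {:A})
   derive1 (fun a => coord e_ j (phi (a +i* Im z)) : R) (Re z) *: e_`_j.
have dphi : is_derive (Re z) 1 (fun a => phi (a +i* Im z)) d.
  apply: is_derive_coord => j; rewrite coord_sum derive1E.
  have [k hk] := H j; have [[[d1 _] _] _ _] := hk _ Dz.
  exact: derivableP.
have [d1 _ _] := hh' _ Dz; apply: (cder_uniq d1).
rewrite /vder derive1E; have [_ ->] := dphi.
by move/lc_cderP : dphi => /(_ i).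
Qed.

End ComplexStructure.

(** * Stem functions *)

Section StemFunctions.
Context {R : realType} {A : altStarAlgType R}.
Implicit Types (x u v : A) (p q : A * A) (z w : R[i]) (D E : set R[i]).
Implicit Types (F G : R[i] -> A * A) (phi psi : R[i] -> A).

Local Notation Re := (@complex.Re R).
Local Notation Im := (@complex.Im R).

Lemma is_derive_pair (f g : R -> A) (t : R) u v :
  is_derive t 1 f u -> is_derive t 1 g v ->
  is_derive t 1 (fun s => (f s, g s) : A * A) ((u, v) : A * A).
Proof.
move=> /is_derive_cvgP fu /is_derive_cvgP gv; apply/is_derive_cvgP.
exact: (cvg_pair fu gv).
Qed.

Lemma linear_fst : linear (fst : A * A -> A). Proof. by []. Qed.
Lemma linear_snd : linear (snd : A * A -> A). Proof. by []. Qed.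

Lemma norm_fst_le p : `|p.1| <= 1 * `|p|.
Proof. by rewrite mul1r [leRHS]prod_normE le_max lexx. Qed.
Lemma norm_snd_le p : `|p.2| <= 1 * `|p|.
Proof. by rewrite mul1r [leRHS]prod_normE le_max lexx orbT. Qed.

Lemma is_derive_fst (f : R -> A * A) (t : R) p :
  is_derive t 1 f p -> is_derive t 1 (fun s => (f s).1) p.1.
Proof. exact: is_derive_linear linear_fst norm_fst_le. Qed.
Lemma is_derive_snd (f : R -> A * A) (t : R) p :
  is_derive t 1 f p -> is_derive t 1 (fun s => (f s).2) p.2.
Proof. exact: is_derive_linear linear_snd norm_snd_le. Qed.

Lemma is_derive_amul x (f : R -> A) (t : R) u :
  is_derive t 1 f u -> is_derive t 1 (fun s => x ** f s) (x ** u).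
Proof.
have [c _ cb] := linear_bound (linear_amul x).
exact: is_derive_linear (linear_amul x) cb.
Qed.

Lemma dalpha_eq D F G z : open (D : set R[i]^o) -> (forall z, D z -> F z = G z) ->
  D z -> dalpha F z = dalpha G z /\ dbeta F z = dbeta G z.
Proof.
move=> oD FG Dz; have [n1 n2] := nbhs_lines oD Dz.
rewrite /dalpha /dbeta !derive1E; split; apply: near_eq_derive.
  by apply: filterS n1 => a /FG.
by apply: filterS n2 => a /FG.
Qed.

Lemma holomorphic_on_eq D F G : open (D : set R[i]^o) ->
  (forall z, D z -> F z = G z) -> holomorphic_on D F -> holomorphic_on D G.
Proof.
move=> oD FG [hF CR]; split=> z Dz; last first.
  by have [<- <-] := dalpha_eq oD FG Dz; exact: CR.
have [n1 n2] := nbhs_lines oD Dz; have [d1 d2 c1 c2] := hF _ Dz.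
have [e1 e2] := dalpha_eq oD FG Dz.
have nD : nbhs (z : R[i]^o) D by exact: open_nbhs_nbhs.
split.
- by apply: near_eq_derivable d1; apply: filterS n1 => a /FG.
- by apply: near_eq_derivable d2; apply: filterS n2 => a /FG.
- rewrite /prop_for /continuous_at -e1.
  have e : {near (z : R[i]^o), dalpha F =1 dalpha G}.
    by apply: filterS nD => y /(dalpha_eq oD FG)[].
  exact: cvg_trans (near_eq_cvg e) c1.
- rewrite /prop_for /continuous_at -e2.
  have e : {near (z : R[i]^o), dbeta F =1 dbeta G}.
    by apply: filterS nD => y /(dalpha_eq oD FG)[].
  exact: cvg_trans (near_eq_cvg e) c2.
Qed.

Variable J : A.
Hypothesis hJ : J ** J = - aone.

Local Notation lc := (lc J).
Local Notation cact := (cact J).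
Local Notation vhol := (vhol J).

(* Evaluation of A (x) C at i |-> J and at i |-> - J. *)
Definition evp p : A := p.1 + J ** p.2.
Definition evm p : A := p.1 - J ** p.2.

(** The solution (F1, F2) of F1 + J F2 = u and F1 - J F2 = v, that is, the inverse of the pair of
    evaluations. *)
Definition stempair u v : A * A := (2^-1 *: (u + v), - (2^-1 *: (J ** (u - v)))).

Lemma half_add u : 2^-1 *: (u + u) = u :> A.
Proof. by rewrite scalerDr -scalerDl [2^-1 + _](_ : _ = 1) ?scale1r//; field. Qed.

Lemma evp_stempair u v : evp (stempair u v) = u.
Proof.
rewrite /evp /= amulNr amulZr amulJJ// -scalerN opprK -scalerDr.
by rewrite addrACA subrr addr0 half_add.
Qed.

Lemma evm_stempair u v : evm (stempair u v) = v.
Proof.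
rewrite /evm /= amulNr amulZr amulJJ// -scalerN opprK -scalerBr.
by rewrite opprB [v - u]addrC addrACA subrr add0r half_add.
Qed.

Lemma stempairK p : stempair (evp p) (evm p) = p.
Proof.
rewrite /stempair /evp /evm addrACA subrr addr0 half_add opprD opprK addrACA subrr add0r.
by rewrite -amulDr amulJJ// scalerN opprK half_add; case: p.
Qed.

Lemma ev_inj p q : evp p = evp q -> evm p = evm q -> p = q.
Proof. by move=> e1 e2; rewrite -[p]stempairK -[q]stempairK e1 e2. Qed.

Lemma cimul_stempair u v : cimul (stempair u v) = stempair (J ** u) (- (J ** v)).
Proof.
rewrite /cimul /stempair /= opprK opprK -!amulBr; congr (_, _).
by rewrite -amulDr amulJJ// scalerN opprK.
Qed.

Definition stemify phi z : A * A := stempair (phi z) (phi (z^*)%C).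

Lemma stem_stemify D phi : stem D (stemify phi).
Proof.
by move=> z _; rewrite /stemify /stempair conjcK /= opprK addrC -scalerN -amulNr opprB.
Qed.

Lemma evp_conj D F z : stem D F -> D z -> evp (F (z^*)%C) = evm (F z).
Proof. by move=> sF Dz; rewrite sF// /evp /= amulNr. Qed.

Lemma stemE D F z : stem D F -> D z -> F z = stemify (fun z => evp (F z)) z.
Proof.
by move=> sF Dz; rewrite /stemify (evp_conj sF Dz) stempairK.
Qed.

(** In terms of evaluations the two parity conditions of a stem function become one: conjugating the
    point exchanges J and - J. Products are checked to be stem functions in this form. *)
Lemma stem_ev D F : (forall z, D z -> D (z^*)%C) ->
  (forall z, D z -> evp (F (z^*)%C) = evm (F z)) -> stem D F.
Proof.
move=> cD H z Dz; apply: ev_inj; first by rewrite H// /evp /evm /= amulNr.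
by rewrite -H ?conjcK//; [rewrite /evp /evm /= amulNr opprK|exact: cD].
Qed.

Lemma is_derive_evp (f : R -> A * A) (t : R) p :
  is_derive t 1 f p -> is_derive t 1 (fun s => evp (f s)) (evp p).
Proof.
move=> df; exact: is_deriveD (is_derive_fst df) (is_derive_amul J (is_derive_snd df)).
Qed.

Lemma evp_cimul p : evp (cimul p) = J ** evp p.
Proof. by rewrite /evp /= amulDr amulJJ// addrC. Qed.

Lemma is_derive_stempair (f g : R -> A) (t : R) u v :
  is_derive t 1 f u -> is_derive t 1 g v ->
  is_derive t 1 (fun s => stempair (f s) (g s)) (stempair u v).
Proof.
move=> df dg; have d1 := is_deriveZ 2^-1 (is_deriveD df dg).
have d2 := is_deriveN (is_deriveZ 2^-1 (is_derive_amul J (is_deriveB df dg))).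
exact: (is_derive_pair d1 d2).
Qed.

Lemma holomorphic_derive D F z : holomorphic_on D F -> D z ->
  is_derive (Re z) 1 (fun a => F (a +i* Im z)) (dalpha F z) /\
  is_derive (Im z) 1 (fun b => F (Re z +i* b)) (cimul (dalpha F z)).
Proof.
move=> [hF CR] Dz; have [/derivableP d1 /derivableP d2 _ _] := hF _ Dz.
rewrite -!derive1E in d1 d2; split=> //.
suff -> : cimul (dalpha F z) = dbeta F z by [].
have /eqP := CR _ Dz; rewrite addr_eq0 => /eqP ->.
by case: (dbeta F z) => a b; rewrite /cimul /= opprK; congr (_, _); rewrite opprK.
Qed.

Lemma dz_holomorphic D F z : holomorphic_on D F -> D z -> dz F z = dalpha F z.
Proof.
move=> [_ CR] Dz; have /eqP := CR _ Dz; rewrite addr_eq0 => /eqP e.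
by rewrite /dz e -opprD scalerN scalerDr -scalerDl [2^-1 + _](_ : _ = 1) ?scale1r//; field.
Qed.

Lemma holomorphic_vhol D F : open (D : set R[i]^o) -> holomorphic_on D F ->
  vhol D (fun z => evp (F z)) (fun z => evp (dz F z)).
Proof.
move=> oD hF i.
apply: (@hol_eq _ D (fun z => lc i (evp (F z))) _ (fun z => lc i (evp (dalpha F z)))) => //.
  by move=> z Dz; rewrite (dz_holomorphic hF Dz).
move=> z Dz; have [d1 d2] := holomorphic_derive hF Dz; split.
- by have /(lc_cderP J _ _ _)/(_ i) := is_derive_evp d1.
- have /(lc_cderP J _ _ _)/(_ i) := is_derive_evp d2.
  by rewrite evp_cimul -cacti lcM.
- have FF : Filter (nbhs (z : R[i]^o)) by exact: nbhs_filter.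
  have [_ _ c _] := hF.1 _ Dz.
  have c1 : (fun y : R[i]^o => (dalpha F y).1) @ (z : R[i]^o) --> (dalpha F z).1.
    by apply: (cvg_comp _ _ c); exact: cvg_fst.
  have c2 : (fun y : R[i]^o => (dalpha F y).2) @ (z : R[i]^o) --> (dalpha F z).2.
    by apply: (cvg_comp _ _ c); exact: cvg_snd.
  have c3 := @cvgD _ _ _ _ FF _ _ _ _ c1 (linear_cvg FF (linear_amul J) c2).
  exact: (iffLR (lc_cvgP J FF (fun y : R[i]^o => evp (dalpha F y)) _) c3 i).
Qed.

(** The second evaluation is [phi] at the conjugate point, whose derivative in the imaginary
    direction carries - J. By [cimul_stempair] this is the action of i on A (x) C, so the pair
    satisfies the Cauchy-Riemann equation. *)
Lemma vhol_holomorphic D phi psi : open (D : set R[i]^o) ->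
  (forall z, D z -> D (z^*)%C) -> vhol D phi psi ->
  holomorphic_on D (stemify phi) /\
  forall z, D z -> dz (stemify phi) z = stemify psi z.
Proof.
move=> oD cD hh.
have zE z : z = Re z +i* Im z by case: z.
have dA z : D z ->
    is_derive (Re z) 1 (fun a => stemify phi (a +i* Im z)) (stemify psi z).
  move=> Dz.
  have d1 : is_derive (Re z) 1 (fun a => phi (a +i* Im z)) (psi z).
    rewrite -(cact1 J (psi z)) [X in psi X]zE.
    apply: (vhol_chain hJ (g := fun a => a +i* Im z) oD hh); first by rewrite -zE.
    by split; [exact: is_derive_id|exact: is_derive_cst].
  have d2 : is_derive (Re z) 1 (fun a => phi (a +i* - Im z)) (psi (z^*)%C).
    rewrite -(cact1 J (psi _)) [X in psi (X^*)%C]zE.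
    apply: (vhol_chain hJ (g := fun a => a +i* - Im z) oD hh).
      by have := cD _ Dz; rewrite {1}[z]zE.
    by split; [exact: is_derive_id|exact: is_derive_cst].
  exact: is_derive_stempair d1 d2.
have dB z : D z ->
    is_derive (Im z) 1 (fun b => stemify phi (Re z +i* b)) (cimul (stemify psi z)).
  move=> Dz; rewrite cimul_stempair.
  have d1 : is_derive (Im z) 1 (fun b => phi (Re z +i* b)) (J ** psi z).
    rewrite -cacti [X in psi X]zE.
    apply: (vhol_chain hJ (g := fun b => Re z +i* b) oD hh); first by rewrite -zE.
    by split; [exact: is_derive_cst|exact: is_derive_id].
  have d2 : is_derive (Im z) 1 (fun b => phi (Re z +i* - b)) (- (J ** psi (z^*)%C)).
    have -> : - (J ** psi (z^*)%C) = cact (- 'i%C) (psi (Re z +i* - Im z)).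
      by rewrite /cact /= oppr0 scale0r scaleN1r add0r; case: (z).
    apply: (vhol_chain hJ (g := fun b => Re z +i* - b) oD hh).
      by have := cD _ Dz; rewrite {1}[z]zE.
    split=> /=; first by rewrite oppr0; exact: is_derive_cst.
    exact: is_deriveN.
  exact: is_derive_stempair d1 d2.
have eA z : D z -> dalpha (stemify phi) z = stemify psi z.
  by move=> /dA[_ dE]; rewrite /dalpha derive1E.
have eB z : D z -> dbeta (stemify phi) z = cimul (stemify psi z).
  by move=> /dB[_ dE]; rewrite /dbeta derive1E.
have CR p : p + cimul (cimul p) = 0.
  by case: p => a b; rewrite /cimul /=; congr (_, _) => /=; rewrite subrr.
have hol : holomorphic_on D (stemify phi).
  split=> z Dz; last by rewrite eA// eB.
  have cpsi (y : R[i]) : D y -> {for y, continuous (psi : R[i]^o -> A)}.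
    move=> Dy; have FF : Filter (nbhs (y : R[i]^o)) by exact: nbhs_filter.
    by apply/(lc_cvgP J FF _ _) => i; have [_ _] := hh i _ Dy.
  have FF : Filter (nbhs (z : R[i]^o)) by exact: nbhs_filter.
  have cconj : (fun y : R[i]^o => ((y : R[i])^*)%C : R[i]^o) @ (z : R[i]^o) --> ((z^*)%C : R[i]^o).
    apply/(cvg_complexP FF); split.
      rewrite (_ : (fun y : R[i]^o => Re ((y : R[i])^*)%C) = (Re : R[i]^o -> R)).
        by rewrite (_ : Re (z^*)%C = Re z); [exact: continuous_Re|case: (z)].
      by apply/funext => -[].
    rewrite (_ : (fun y : R[i]^o => Im ((y : R[i])^*)%C) = (fun y : R[i]^o => - Im y)).
      rewrite (_ : Im (z^*)%C = - Im z); last by case: (z).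
      exact: (@cvgN _ _ _ _ FF _ _ (@continuous_Im R z)).
    by apply/funext => -[].
  have c1 : psi @ (z : R[i]^o) --> psi z by exact: cpsi.
  have c2 : (fun y : R[i]^o => psi ((y : R[i])^*)%C) @ (z : R[i]^o) --> psi (z^*)%C.
    by apply: (cvg_comp _ (psi : R[i]^o -> A) cconj); exact: cpsi (cD _ Dz).
  have s1 := @cvgZl_tmp _ _ _ _ FF 2^-1 _ _ (@cvgD _ _ _ _ FF _ _ _ _ c1 c2).
  have s2 := @cvgN _ _ _ _ FF _ _ (@cvgZl_tmp _ _ _ _ FF 2^-1 _ _ (linear_cvg FF (linear_amul J) (@cvgB _ _ _ _ FF _ _ _ _ c1 c2))).
  have nD : nbhs (z : R[i]^o) D by exact: open_nbhs_nbhs.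
  split.
  - by have [] := dA _ Dz.
  - by have [] := dB _ Dz.
  - rewrite /prop_for /continuous_at eA//.
    have e : {near (z : R[i]^o), stemify psi =1 dalpha (stemify phi)}.
      by apply: filterS nD => y /eA.
    exact: cvg_trans (near_eq_cvg e) (cvg_pair s1 s2).
  - rewrite /prop_for /continuous_at eB//.
    have e : {near (z : R[i]^o), (fun y => cimul (stemify psi y)) =1 dbeta (stemify phi)}.
      by apply: filterS nD => y /eB.
    exact: cvg_trans (near_eq_cvg e) (cvg_pair (@cvgN _ _ _ _ FF _ _ s2) s1).
by split=> // z Dz; rewrite (dz_holomorphic hol Dz) eA.
Qed.

(** [hol_smooth] differentiates each scalar coordinate of the evaluation of [dz F]; [vhol_vder]
    assembles these derivatives and [vhol_holomorphic] returns to stem functions. *)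
Lemma stem_holomorphic_dz D F : open (D : set R[i]^o) ->
  (forall z, D z -> D (z^*)%C) -> stem D F -> holomorphic_on D F ->
  stem D (dz F) /\ holomorphic_on D (dz F).
Proof.
move=> oD cD sF hF; have hh := holomorphic_vhol oD hF.
have [_ dE] := vhol_holomorphic oD cD hh.
have FE z : D z -> F z = stemify (fun z => evp (F z)) z by exact: stemE sF.
have dzE z : D z -> stemify (fun z => evp (dz F z)) z = dz F z.
  move=> Dz; have [e1 e2] := dalpha_eq oD FE Dz.
  by rewrite -(dE z Dz) [LHS]/dz [RHS]/dz e1 e2.
split.
  by move=> z Dz; rewrite -(dzE z Dz) -(dzE _ (cD z Dz)); exact: stem_stemify Dz.
have h2 : vhol D (fun z => evp (dz F z)) (vder (fun z => evp (dz F z))).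
  by apply: (vhol_vder oD) => i; exists (cderive (fun z => lc i (evp (dz F z)))); exact: hol_smooth oD (hh i).
have [h3 _] := vhol_holomorphic oD cD h2.
exact: holomorphic_on_eq oD dzE h3.
Qed.

Lemma stem_holomorphic_iter D F n : open (D : set R[i]^o) ->
  (forall z, D z -> D (z^*)%C) -> stem D F -> holomorphic_on D F ->
  stem D (iter n dz F) /\ holomorphic_on D (iter n dz F).
Proof.
move=> oD cD sF hF; elim: n => [//|n [sn hn]].
exact: stem_holomorphic_dz oD cD sn hn.
Qed.

End StemFunctions.

(** * Arithmetic of C_J (x) C and the representation formula *)

Section Evaluation.
Context {R : realType} {A : altStarAlgType R}.
Implicit Types (x u v a : A) (p q : A * A) (z w c d : R[i]) (D E : set R[i]).
Implicit Types (F G : R[i] -> A * A) (phi psi : R[i] -> A).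

Local Notation Re := (@complex.Re R).
Local Notation Im := (@complex.Im R).

Variable J : A.
Hypothesis hJ : J ** J = - aone.

Local Notation cact := (cact J).
Local Notation emb := (emb J).
Local Notation evp := (evp J).
Local Notation evm := (evm J).
Local Notation stempair := (stempair J).

Lemma evpD p q : evp (p + q) = evp p + evp q.
Proof. by rewrite /evp /= amulDr addrACA. Qed.
Lemma evmD p q : evm (p + q) = evm p + evm q.
Proof. by rewrite /evm /= amulDr opprD addrACA. Qed.
Lemma evpN p : evp (- p) = - evp p.
Proof. by rewrite /evp /= amulNr opprD. Qed.
Lemma evmN p : evm (- p) = - evm p.
Proof. by rewrite /evm /= amulNr opprD. Qed.

(* Multiplication by an element (a, b) of C_J (x) C: it acts through the scalar
   a + i b under i |-> J, and through a - i b under i |-> - J. *)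
Lemma evp_cmul c d q : evp (cmul (emb c, emb d) q) = cact (c + 'i%C * d) (evp q).
Proof.
rewrite /evp /cmul /= !embE// /cact !(amulDr, amulZr, amulNr, amulJJ hJ) ReD ImD ReM ImM /=.
by apply: coord_eq => i; rewrite !(coordD, coordN, coordZ); ring.
Qed.

Lemma evm_cmul c d q : evm (cmul (emb c, emb d) q) = cact (c - 'i%C * d) (evm q).
Proof.
rewrite /evm /cmul /= !embE// /cact !(amulDr, amulZr, amulNr, amulJJ hJ).
rewrite ReD ImD ReN ImN ReM ImM /=.
by apply: coord_eq => i; rewrite !(coordD, coordN, coordZ); ring.
Qed.

(* The element of C_J (x) C whose evaluations at i |-> J and i |-> - J are c and d. *)
Definition kap c d : A * A := stempair (emb c) (emb d).

Lemma evp_kap c d : evp (kap c d) = emb c. Proof. exact: evp_stempair. Qed.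
Lemma evm_kap c d : evm (kap c d) = emb d. Proof. exact: evm_stempair. Qed.

Lemma kapE c d : kap c d = (emb ((c + d) / 2), emb (- 'i%C * (c - d) / 2)).
Proof.
have h (s : R[i]) : emb (s / 2) = 2^-1 *: emb s.
  rewrite !emb_cact -(cactR J) cactM// mulrC; congr (cact (_ * _) _).
  by rewrite fmorphV rmorph_nat.
rewrite /kap /stempair -embD -embB !h; congr (_, _).
rewrite -scalerN; congr (_ *: _).
by rewrite mulNr embN [in RHS]emb_cact -(cactM hJ) cacti -emb_cact.
Qed.

Lemma evp_kapM c d q : evp (cmul (kap c d) q) = cact c (evp q).
Proof.
rewrite kapE evp_cmul; congr (cact _ _).
rewrite [X in _ + X](_ : _ = - ('i%C * 'i%C) * ((c - d) / 2)); last by rewrite !mulrA mulrN.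
by rewrite -expr2 sqr_i opprK mul1r; field.
Qed.

Lemma evm_kapM c d q : evm (cmul (kap c d) q) = cact d (evm q).
Proof.
rewrite kapE evm_cmul; congr (cact _ _).
rewrite [X in _ - X](_ : _ = - ('i%C * 'i%C) * ((c - d) / 2)); last by rewrite !mulrA mulrN.
by rewrite -expr2 sqr_i opprK mul1r; field.
Qed.

Lemma kap_eq p c d : evp p = emb c -> evm p = emb d -> p = kap c d.
Proof. by move=> e1 e2; apply: (ev_inj hJ); rewrite ?evp_kap ?evm_kap. Qed.

Lemma kapM c d c' d' : cmul (kap c d) (kap c' d') = kap (c * c') (d * d').
Proof.
apply: kap_eq; first by rewrite evp_kapM evp_kap -embE embM.
by rewrite evm_kapM evm_kap -embE embM.
Qed.

Lemma kapD c d c' d' : kap c d + kap c' d' = kap (c + c') (d + d').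
Proof.
apply: kap_eq; first by rewrite evpD !evp_kap embD.
by rewrite evmD !evm_kap embD.
Qed.

Lemma kapN c d : - kap c d = kap (- c) (- d).
Proof.
apply: kap_eq; first by rewrite evpN !evp_kap embN.
by rewrite evmN !evm_kap embN.
Qed.

Lemma coneE : cone = kap 1 1.
Proof. by apply: kap_eq; rewrite emb1 /evp /evm /= amul0r ?addr0 ?subr0. Qed.

Lemma evp_calg x : evp (calg x) = x.
Proof. by rewrite /evp /= amul0r addr0. Qed.
Lemma evm_calg x : evm (calg x) = x.
Proof. by rewrite /evm /= amul0r subr0. Qed.

Lemma calg_emb c : calg (emb c) = kap c c.
Proof. by apply: kap_eq; rewrite ?evp_calg ?evm_calg. Qed.

Lemma cscalE z : cscal z = kap z (z^*)%C.
Proof.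
apply: kap_eq; first by rewrite /evp /= /areal amulZr amul1r.
by rewrite /evm /= /areal amulZr amul1r -scaleNr; case: z.
Qed.

Lemma cpow_kap c d n : cpow (kap c d) n = kap (c ^+ n) (d ^+ n).
Proof.
elim: n => [|n IH]; first by rewrite !expr0 -coneE.
by rewrite /cpow iterS -/(cpow _ n) IH kapM !exprS.
Qed.

(** [cinv] selects some inverse in all of A (x) C. Evaluating the equation of a right inverse at J
    and at - J determines both evaluations of the selected element, hence the element. *)
Lemma cinv_kap c d : c != 0 -> d != 0 -> cinv (kap c d) = kap c^-1 d^-1.
Proof.
move=> c0 d0; rewrite /cinv; case: xgetP => [q _ /= [q1 _]|/(_ (kap c^-1 d^-1)) []].
  have := congr1 evp q1; have := congr1 evm q1.
  rewrite evp_kapM evm_kapM coneE evp_kap evm_kap => e2 e1; apply: kap_eq.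
    by rewrite -(cact1 J (evp q)) -(mulVf c0) -cactM// e1 -embE embM// mulr1.
  by rewrite -(cact1 J (evm q)) -(mulVf d0) -cactM// e2 -embE embM// mulr1.
by rewrite /= !kapM !mulVf// !mulfV// -coneE.
Qed.

Lemma pow_stemE w n z : pow_stem (emb w) n z = kap ((z - w) ^+ n) (((z^*)%C - w) ^+ n).
Proof. by rewrite /pow_stem cscalE calg_emb kapN kapD cpow_kap. Qed.

Lemma evp_pow_stem w n z p :
  evp (cmul (pow_stem (emb w) n z) p) = cact ((z - w) ^+ n) (evp p).
Proof. by rewrite pow_stemE evp_kapM. Qed.
Lemma evm_pow_stem w n z p :
  evm (cmul (pow_stem (emb w) n z) p) = cact (((z^*)%C - w) ^+ n) (evm p).
Proof. by rewrite pow_stemE evm_kapM. Qed.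

(* The value at a + b I of the slice function with value u at a + b J and
   value v at a - b J. *)
Definition repf (I u v : A) : A := 2^-1 *: (u + v) - I ** (2^-1 *: (J ** (u - v))).

Lemma repfE I p : p.1 + I ** p.2 = repf I (evp p) (evm p).
Proof. by rewrite -{1 2}[p](stempairK hJ) /repf /= amulNr. Qed.

Lemma repfJ u v : repf J u v = u.
Proof. by rewrite -[RHS](evp_stempair hJ u v) /evp /= amulNr. Qed.

Lemma repfB I u v u' v' : repf I u v - repf I u' v' = repf I (u - u') (v - v').
Proof.
rewrite /repf !amulZr !amulBr.
by apply: coord_eq => i; rewrite !(coordD, coordN, coordZ); ring.
Qed.

End Evaluation.

(** * Cauchy theory and estimates for A-valued functions *)

Section VectorCauchy.
Context {R : realType} {A : altStarAlgType R}.
Implicit Types (x u v a : A) (z w c d : R[i]) (D E : set R[i]) (r : R).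
Implicit Types (phi psi : R[i] -> A).

Local Notation normc := (@Normc.normc R).

Variable J : A.
Hypothesis hJ : J ** J = - aone.

Local Notation cact := (cact J).
Local Notation lc := (lc J).
Local Notation vhol := (vhol J).

Lemma continuous_cact (c : R -> R[i]) (g : R -> A) :
  continuous (c : R -> R[i]^o) -> continuous g ->
  continuous (fun t => cact (c t) (g t)).
Proof.
move=> cc cg t; have FF : Filter (nbhs t) by exact: nbhs_filter.
apply/(lc_cvgP J FF) => i; under eq_fun do rewrite (lcM hJ); rewrite (lcM hJ).
apply: (cvg_complexM FF); first exact: cc.
exact: (iffLR (lc_cvgP J FF g (g t)) (cg t) i).
Qed.

Section Disc.
Variables (w : R[i]) (r : R).
Hypothesis r0 : 0 < r.

Local Notation zeta := (circle w r).

Definition vcoef n phi : A := (2 * pi)^-1 *: vintegral 0 (2 * pi)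
  (fun t => cact ((zeta t - w)^-1 ^+ n) (phi (zeta t))).

Definition vrem n phi z : A := (2 * pi)^-1 *: vintegral 0 (2 * pi)
  (fun t => cact ((zeta t - z)^-1 * (zeta t - w)^-1 ^+ n * (zeta t - w)) (phi (zeta t))).

Let wd : disc w r w.
Proof. by apply/discP; rewrite subrr Normc.normc0. Qed.

Lemma continuous_vcoef n phi : continuous (fun t => phi (zeta t)) ->
  continuous (fun t => cact ((zeta t - w)^-1 ^+ n) (phi (zeta t))).
Proof.
move=> cphi.
exact: (continuous_cact (@continuous_circle_inv _ w r r0 w n wd) cphi).
Qed.

Lemma continuous_vrem n phi z : continuous (fun t => phi (zeta t)) -> disc w r z ->
  continuous (fun t => cact ((zeta t - z)^-1 * (zeta t - w)^-1 ^+ n * (zeta t - w))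
    (phi (zeta t))).
Proof.
move=> cphi zr; apply: continuous_cact => // t.
have FF : Filter (nbhs t) by exact: nbhs_filter.
apply: (cvg_complexM FF); last exact: continuous_circle_sub.
apply: (cvg_complexM FF); last exact: (@continuous_circle_inv _ w r r0 w n wd).
exact: (@continuous_circle_inv _ w r r0 z 1 zr).
Qed.

Let twopiV : ((2 * pi)^-1)%:C = (2 * pi)%:C^-1 :> R[i].
Proof. by rewrite fmorphV. Qed.

Lemma lc_vcoef i n phi : continuous (fun t => phi (zeta t)) ->
  lc i (vcoef n phi) = ccoef w r n (fun z => lc i (phi z)).
Proof.
move=> cphi; rewrite /vcoef lcZ// lc_vintegral; last first.
  exact/coord_continuousP/continuous_vcoef.
by rewrite twopiV; congr (_ * cint _); apply/funext => t; rewrite lcM.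
Qed.

Lemma lc_vrem i n phi z : continuous (fun t => phi (zeta t)) -> disc w r z ->
  lc i (vrem n phi z) = crem w r n (fun z => lc i (phi z)) z.
Proof.
move=> cphi zr; rewrite /vrem lcZ// lc_vintegral; last first.
  exact/coord_continuousP/continuous_vrem.
by rewrite twopiV; congr (_ * cint _); apply/funext => t; rewrite lcM.
Qed.

Lemma vhol_vrem n phi : continuous (fun t => phi (zeta t)) ->
  exists psi, vhol (disc w r) (vrem n phi) psi.
Proof.
move=> cphi; exists (vder (vrem n phi)); apply: vhol_vder; first exact: open_disc.
move=> i.
have ci : continuous (fun t => lc i (phi (zeta t)) : R[i]^o).
  move=> t; have FF : Filter (nbhs t) by exact: nbhs_filter.
  exact: (iffLR (lc_cvgP J FF (fun t => phi (zeta t)) _) (cphi t) i).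
have [h' hh'] := hol_crem (h := fun z => lc i (phi z)) r0 n ci; exists h'.
apply: (hol_eq (@open_disc _ w r) _ _ hh') => // z zr.
by rewrite lc_vrem.
Qed.

Section Holomorphic.
Variable D : set R[i].
Hypothesis oD : open (D : set R[i]^o).
Hypothesis rD : forall z, normc (z - w) <= r -> D z.

Lemma vhol_circle_continuous phi psi : vhol D phi psi ->
  continuous (fun t => phi (zeta t)).
Proof.
move=> hh t; apply: (cvg_comp (zeta : R -> R[i]^o) (phi : R[i]^o -> A)
  (@continuous_circle _ w r t)).
by apply: (vhol_continuous oD hh); apply: rD; rewrite normc_circle// ltW.
Qed.

Lemma vrem_taylor phi psi n z : vhol D phi psi -> disc w r z ->
  phi z - \sum_(0 <= k < n) cact ((z - w) ^+ k) (vcoef k phi) =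
  cact ((z - w) ^+ n) (vrem n phi z).
Proof.
move=> hh zr; have cphi := vhol_circle_continuous hh.
apply: (@lc_eq _ _ J) => i; rewrite [RHS](lcM hJ) lcB (lc_sum hJ) lc_vrem//.
rewrite -(crem_taylor oD r0 rD n (hh i) zr); congr (_ - _).
by apply: eq_bigr => k _; rewrite (lcM hJ) lc_vcoef.
Qed.

Lemma vhol_iter_vcoef (phis : nat -> R[i] -> A) n :
  (forall n, vhol D (phis n) (phis n.+1)) ->
  phis n w = n`!%:R *: vcoef n (phis 0%N).
Proof.
move=> hh; have cphi := vhol_circle_continuous (hh 0%N).
apply: (@lc_eq _ _ J) => i; rewrite (lcZ hJ) lc_vcoef//.
rewrite (@hol_iter_ccoef _ D w r oD r0 rD (fun n z => lc i (phis n z))) ?rmorph_nat//.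
by move=> k; exact: hh.
Qed.

End Holomorphic.

Section Bounds.
Variables (K K1 : R).
Hypothesis K0 : 0 < K.
Hypothesis KP : forall x y : A, `|x ** y| <= K * `|x| * `|y|.
Hypothesis K10 : 0 < K1.
Hypothesis K1P : forall (a b M : R) (g : R -> A), a <= b -> coord_continuous g ->
  (forall t, t \in `[a, b] -> `|g t| <= M) -> `|vintegral a b g| <= K1 * M * (b - a).
Hypothesis nJ : `|J| = 1.

(** The real part contributes 1 and the imaginary part K, because J has norm 1 but left
    multiplication by J is controlled only by [KP]. *)
Lemma cact_bound c v : `|cact c v| <= (1 + K) * normc c * `|v|.
Proof.
rewrite /cact (le_trans (ler_normD _ _))// !normrZ !mulrDl mul1r lerD//.
  by rewrite ler_wpM2r// normr_Re_le.
rewrite -[leRHS]mulrA mulrCA; apply: ler_pM => //; first exact: normr_Im_le.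
by rewrite (le_trans (KP _ _))// nJ mulr1.
Qed.

Lemma normc_ge0 c : 0 <= normc c.
Proof. by rewrite normcE_sqrt sqrtr_ge0. Qed.

Lemma normcX c n : normc (c ^+ n) = normc c ^+ n.
Proof.
elim: n => [|n IH]; first by rewrite !expr0 Normc.normc1.
by rewrite !exprS Normc.normcM IH.
Qed.

Lemma mean_bound (M : R) (g : R -> A) : continuous g ->
  (forall t, `|g t| <= M) -> `|(2 * pi)^-1 *: vintegral 0 (2 * pi) g| <= K1 * M.
Proof.
move=> cg gM; have p0 : 0 < 2 * pi :> R by exact: twopi_gt0.
rewrite normrZ ger0_norm ?invr_ge0 ?(ltW p0)// ler_pdivrMl// [leRHS]mulrC.
rewrite -[X in _ <= _ * X]subr0; apply: K1P => //; first exact: ltW.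
exact: coord_continuousP.
Qed.

Lemma vcoef_bound n phi (M : R) : continuous (fun t => phi (zeta t)) ->
  (forall t, `|phi (zeta t)| <= M) ->
  `|vcoef n phi| <= K1 * (1 + K) * r ^- n * M.
Proof.
move=> cphi phiM; rewrite -!mulrA; apply: mean_bound; first exact: continuous_vcoef.
move=> t; rewrite (le_trans (cact_bound _ _))// -mulrA ler_pM2l ?addr_gt0//.
rewrite normcX Normc.normcV (normc_circle _ _ (ltW r0)) exprVn ler_wpM2l//.
by rewrite invr_ge0 exprn_ge0// ltW.
Qed.

(** One factor 1 + K comes from the action of the kernel under the integral, the other from that of
    (z - w)^n outside. On the circle |zeta - z| is at least r - |z - w|, and the numerator r is the
    speed of the parametrization. *)
Lemma vrem_bound n phi z (M : R) : continuous (fun t => phi (zeta t)) ->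
  disc w r z -> (forall t, `|phi (zeta t)| <= M) ->
  `|cact ((z - w) ^+ n) (vrem n phi z)| <=
  K1 * (1 + K) ^+ 2 * M * (normc (z - w) / r) ^+ n * (r / (r - normc (z - w))).
Proof.
move=> cphi zr phiM; have M0 : 0 <= M by rewrite (le_trans _ (phiM 0)).
have s0 := normc_ge0 (z - w); have /discP sr := zr.
set s := normc (z - w) in s0 sr *.
have rs : 0 < r - s by rewrite subr_gt0.
have K1' : 0 < 1 + K by rewrite addr_gt0.
rewrite (le_trans (cact_bound _ _))// normcX -/s.
have : `|vrem n phi z| <= K1 * ((1 + K) * ((r - s)^-1 * r ^- n * r) * M).
  apply: mean_bound; first exact: continuous_vrem.
  move=> t; rewrite (le_trans (cact_bound _ _))//; apply: ler_pM => //.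
    by rewrite mulr_ge0 ?normc_ge0// ltW.
  rewrite ler_pM2l// !Normc.normcM normcX !Normc.normcV (normc_circle _ _ (ltW r0)) exprVn.
  rewrite ler_pM2r// ler_pM2r ?invr_gt0 ?exprn_gt0//.
  rewrite lef_pV2 ?posrE//; last first.
    rewrite lt_neqAle normc_ge0 andbT eq_sym; apply/eqP => /Normc.eq0_normc/eqP.
    by rewrite (negbTE (disc_circle_neq _ r0 zr)).
  rewrite lerBlDr -{1}(normc_circle w t (ltW r0)).
  rewrite -[circle w r t - w](subrKA z) (le_trans (le_normcD _ _))//.
move=> H; apply: (le_trans (ler_wpM2l _ H)).
  by rewrite mulr_ge0 ?exprn_ge0// ltW.
rewrite le_eqVlt; apply/orP; left; apply/eqP.
by rewrite expr_div_n; field; rewrite gt_eqF//= expf_neq0// gt_eqF.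
Qed.

(** The half sum costs 1; the term I (J (u - v)) / 2 costs one factor K for each of the two
    products. *)
Lemma repf_bound (I u v : A) (M : R) : `|I| = 1 -> `|u| <= M -> `|v| <= M ->
  `|repf J I u v| <= (1 + K ^+ 2) * M.
Proof.
move=> nI uM vM; have M0 : 0 <= M by rewrite (le_trans _ uM).
have h (a b : A) : `|a| <= M -> `|b| <= M -> `|2^-1 *: (a + b)| <= M.
  move=> aM bM; rewrite normrZ ger0_norm ?invr_ge0// mulrC ler_pdivrMr//.
  by rewrite (le_trans (ler_normD _ _))// mulr_natr mulr2n lerD.
have hJ' (a : A) : `|a| <= M -> `|J ** a| <= K * M.
  by move=> aM; rewrite (le_trans (KP _ _))// nJ mulr1 ler_pM2l.
rewrite /repf (le_trans (ler_normB _ _))// mulrDl mul1r lerD ?h//.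
rewrite (le_trans (KP _ _))// nI mulr1 expr2 -mulrA ler_pM2l//.
by rewrite -amulZr; apply: hJ'; apply: h => //; rewrite normrN.
Qed.

End Bounds.
End Disc.
End VectorCauchy.

(** * Geometry of the quadratic cone *)

Section QuadraticCone.
Context {R : realType} {A : altStarAlgType R}.
Implicit Types (x y u v a I J : A) (z w c d : R[i]) (D E : set R[i]) (r : R).

Local Notation Re := (@complex.Re R).
Local Notation Im := (@complex.Im R).
Local Notation normc := (@Normc.normc R).

Lemma aconj1 : aconj (aone : A) = aone.
Proof. by rewrite -[RHS]aconjK -[aconj aone in RHS]amul1l aconjM aconjK amul1l. Qed.

Lemma emb_real J (s : R) : emb J s%:C = areal s.
Proof. by rewrite /emb /= scale0r addr0. Qed.

Lemma emb_i J : emb J 'i%C = J.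
Proof. by rewrite /emb /areal /= scale0r scale1r add0r. Qed.

Lemma aconj_emb J c : SA J -> aconj (emb J c) = emb J (c^*)%C.
Proof.
move=> SJ; rewrite /emb /areal aconjD !aconjZ aconj1 SA_conj//.
by case: c => a b /=; rewrite scalerN scaleNr.
Qed.

Lemma atrace_emb J c : SA J -> atrace (emb J c) = areal (2 * Re c).
Proof.
move=> SJ; rewrite /atrace aconj_emb// -embD -(emb_real J); congr (emb J _).
by apply: complex_eqP; case: c => a b /=; ring.
Qed.

Lemma asqnorm_emb J c : SA J -> asqnorm (emb J c) = areal (Re c ^+ 2 + Im c ^+ 2).
Proof.
move=> SJ; rewrite /asqnorm aconj_emb// embM ?SJ.2// -(emb_real J); congr (emb J _).
by apply: complex_eqP; case: c => a b /=; ring.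
Qed.

Lemma QA_emb J c : SA J -> QA (emb J c).
Proof.
move=> SJ; have [c0|c0] := eqVneq (Im c) 0.
  by left; exists (Re c); rewrite /emb c0 scale0r addr0.
right; exists (2 * Re c), (Re c ^+ 2 + Im c ^+ 2); split.
- exact: atrace_emb.
- exact: asqnorm_emb.
- rewrite exprMn -natrX mulrDr ltrDl mulr_gt0// lt_neqAle sqr_ge0 andbT eq_sym.
  by rewrite sqrf_eq0.
Qed.

Lemma QA_embP x : (SA : set A) !=set0 -> QA x ->
  exists J c, SA J /\ x = emb J c.
Proof.
move=> [J0 SJ0] [[s ->]|[s [m [ht hn sm]]]].
  by exists J0, s%:C; rewrite emb_real.
(* Completing the square in x^2 = s x - m gives (x - s / 2)^2 = - b^2, and the inequality of the
   cone makes b nonzero. *)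
pose b := Num.sqrt (m - s ^+ 2 / 4).
have b2 : b ^+ 2 = m - s ^+ 2 / 4.
  by rewrite sqr_sqrtr// subr_ge0 ler_pdivrMr// mulrC ltW.
have b0 : b != 0.
  by rewrite -sqrf_eq0 b2 gt_eqF// subr_gt0 ltr_pdivrMr// mulrC.
have xc : aconj x = areal s - x by rewrite -ht /atrace addrAC subrr add0r.
have xx : x ** x = s *: x - areal m.
  by rewrite -hn /asqnorm xc amulBr /areal amulZr amul1r opprB addrC subrK.
pose I := b^-1 *: (x - areal (s / 2)).
have xI : x = emb I ((s / 2) +i* b).
  by rewrite /emb /= /I scalerA mulfV// scale1r addrC subrK.
have st : (x - areal (s / 2)) ** (x - areal (s / 2)) = - (b ^+ 2 *: aone).
  rewrite b2 amulBl !amulBr xx /areal !amulZl !amulZr !amul1l !amul1r.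
  by apply: coord_eq => i; rewrite !(coordD, coordN, coordZ); field.
have II : I ** I = - aone.
  by rewrite /I amulZl amulZr scalerA st -scaleNr scalerA mulrN -invfM -expr2 mulVf
    ?expf_neq0// scaleN1r.
have cI : aconj I = - I.
  rewrite /I aconjZ aconjD xc -[RHS]scalerN; congr (_ *: _).
  rewrite -[- areal (s / 2)]scaleN1r aconjZ /areal aconjZ aconj1 scaleN1r.
  by apply: coord_eq => i; rewrite !(coordD, coordN, coordZ); field.
exists I, ((s / 2) +i* b); split=> //; split=> //.
right; exists 0, 1; split.
- by rewrite /atrace cI subrr /areal scale0r.
- by rewrite /asqnorm cI amulNr II opprK /areal scale1r.
- by rewrite expr0n /= mulr1.
Qed.

Lemma CJ_embP J x : CJ J x <-> exists c, x = emb J c.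
Proof.
split=> [[[a b] _ <-]|[[a b] ->]]; first by exists (a +i* b).
by exists (a, b).
Qed.

Lemma emb_opp J c : emb (- J) c = emb J (c^*)%C.
Proof. by case: c => a b; rewrite /emb /= scalerN scaleNr. Qed.

Lemma emb_uniq I J z w : SA I -> SA J -> emb I z = emb J w ->
  (z = w \/ z = (w^*)%C) /\ (Im w != 0 -> I = J \/ I = - J).
Proof.
move=> SI SJ e; have [e1 e2 e3] := slice_coord_uniq SI SJ e; split.
  case/orP : e3 => /eqP e3; [left|right].
    by apply: complex_eqP.
  by case: z w e1 e3 {e e2} => a b [a' b'] /= -> ->; rewrite opprK.
move=> w0; case/orP : e3 => /eqP e3.
  by left; move: e2; rewrite -e3 => /(scalerI w0).
right; apply: (scalerI w0).
by rewrite scalerN -e2 e3 scaleNr.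
Qed.

Lemma Omega_emb D J z : (forall z, D z -> D (z^*)%C) -> SA J ->
  Omega D (emb J z) -> D z.
Proof.
move=> cD SJ [a [b [I [SI Dz e]]]].
have [[-> //|->] _] := @emb_uniq J I z (a +i* b) SJ SI e.
exact: cD.
Qed.

Lemma Omega_of D J z : SA J -> D z -> Omega D (emb J z).
Proof. by move=> SJ Dz; exists (Re z), (Im z), J; split=> //; case: z Dz. Qed.

Lemma OmegaP D x : Omega D x -> exists I z, [/\ SA I, D z & x = emb I z].
Proof. by move=> [a [b [I [SI Dz ->]]]]; exists I, (a +i* b). Qed.

Section Norm.
Hypothesis hN : cone_norm A.

Lemma norm_emb J c : SA J -> `|emb J c| = normc c.
Proof.
by move=> SJ; rewrite (hN (QA_emb c SJ) (asqnorm_emb c SJ)) normcE_sqrt.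
Qed.

Lemma norm_SA J : SA J -> `|J| = 1.
Proof. by move=> SJ; rewrite -{1}[J]emb_i norm_emb// normcE_sqrt /= expr0n expr1n add0r sqrtr1. Qed.

Lemma aRe_emb J c : SA J -> aRe (emb J c) = areal (Re c).
Proof.
move=> SJ; by rewrite /aRe -/(atrace _) atrace_emb// /areal scalerA mulrA mulVf ?mul1r ?pnatr_eq0.
Qed.

Lemma aIm_emb J c : SA J -> aIm (emb J c) = Im c *: J.
Proof.
move=> SJ; rewrite /aIm aconj_emb// -embB.
have -> : c - (c^*)%C = 0 +i* (2 * Im c).
  by apply: complex_eqP; case: c => a b /=; ring.
by rewrite /emb /areal /= scale0r add0r scalerA mulrA mulVf ?mul1r// pnatr_eq0.
Qed.

Lemma norm_areal (s : R) : (SA : set A) !=set0 -> `|areal s : A| = `|s|.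
Proof.
by move=> [J SJ]; rewrite -(emb_real J) norm_emb// normcE_sqrt /= expr0n addr0 sqrtr_sqr.
Qed.

Lemma sigmaA_same J z w : SA J -> sigmaA (emb J z) (emb J w) = normc (z - w).
Proof.
move=> SJ; rewrite /sigmaA; case: asboolP => [_|[]]; first by rewrite -embB norm_emb.
by exists J; split=> //; apply/CJ_embP; [exists z|exists w].
Qed.

Lemma normc_conj c : normc (c^*)%C = normc c.
Proof. by case: c => a b /=; rewrite sqrrN. Qed.

(* Either x lies in C_J, or sigma is the larger of the two plane distances. *)
Lemma sigmaA_cases I J z w : SA I -> SA J ->
  let s := sigmaA (emb I z) (emb J w) in
  (exists2 z', emb I z = emb J z' & s = normc (z' - w)) \/
  [/\ normc (z - w) <= s, normc ((z^*)%C - w) <= s &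
      s = normc (z - w) \/ s = normc ((z^*)%C - w)].
Proof.
move=> SI SJ s; have hS : (SA : set A) !=set0 by exists J.
rewrite /s /sigmaA; case: asboolP => [[K [SK /CJ_embP[z' xz'] /CJ_embP[w' yw']]]|_].
  (* A real centre lies in every C_I: the distance may be computed in the plane of [x], and both
     plane distances coincide. *)
  have [w0|w0] := eqVneq (Im w) 0.
    right; have wE : emb J w = emb I w by rewrite /emb w0 !scale0r.
    have -> : normc ((z^*)%C - w) = normc (z - w).
      rewrite -(normc_conj (z - w)) rmorphB; congr (normc (_ - _)).
      by case: w w0 {yw' wE s} => a b /= ->; rewrite oppr0.
    by rewrite wE -embB norm_emb//; split=> //; left.
  left; have [_ /(_ w0) KJ] := emb_uniq SK SJ (esym yw').
  case: KJ => KJ; [exists z'|exists (z'^*)%C]; rewrite ?xz' KJ ?emb_opp//.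
    by rewrite -embB norm_emb.
  by rewrite -embB norm_emb.
right; rewrite !aRe_emb// !aIm_emb// !normrZ (norm_SA SI) (norm_SA SJ) !mulr1.
have -> : areal (Re z) - areal (Re w) = areal (Re z - Re w) :> A.
  by rewrite /areal scalerBl.
rewrite norm_areal//.
have -> : normc (z - w) = Num.sqrt (`|Re z - Re w| ^+ 2 + `|Im z - Im w| ^+ 2).
  by rewrite normcE_sqrt ReD ReN ImD ImN !real_normK ?num_real.
have -> : normc ((z^*)%C - w) = Num.sqrt (`|Re z - Re w| ^+ 2 + `|Im z + Im w| ^+ 2).
  rewrite normcE_sqrt !real_normK ?num_real//; case: z w {s} => a b [a' b'] /=.
  by rewrite -opprD sqrrN.
have le1 : `|Im z - Im w| <= `|Im z| + `|Im w| by exact: ler_normB.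
have le2 : `|Im z + Im w| <= `|Im z| + `|Im w| by exact: ler_normD.
split.
- by rewrite ler_wsqrtr// lerD2l lerXn2r ?nnegrE ?addr_ge0.
- by rewrite ler_wsqrtr// lerD2l lerXn2r ?nnegrE ?addr_ge0.
(* For real numbers |a| + |b| is the larger of |a - b| and |a + b|, according to the signs. *)
have : `|Im z| + `|Im w| = `|Im z - Im w| \/ `|Im z| + `|Im w| = `|Im z + Im w|.
  case: (lerP 0 (Im z)) => hz; case: (lerP 0 (Im w)) => hw.
  - by right; rewrite !ger0_norm ?addr_ge0.
  - left; rewrite (ger0_norm hz) (ltr0_norm hw) ger0_norm// subr_ge0.
    by rewrite (le_trans (ltW hw)).
  - left; rewrite (ltr0_norm hz) (ger0_norm hw) ler0_norm; first by rewrite opprB addrC.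
    by rewrite subr_le0 (le_trans (ltW hz)).
  - right; rewrite (ltr0_norm hz) (ltr0_norm hw) ler0_norm ?opprD//.
    by rewrite -[leRHS]addr0 lerD// ltW.
by move=> [->|->]; [left|right].
Qed.

(** Points of the closed disc are limits of points of the open disc inside the plane C_J. This
    identifies the boundary of [BJ] and puts the closed disc in the closure of [SigmaA]. *)
Lemma emb_approx J w r z (U : set A) : SA J -> 0 < r -> normc (z - w) <= r ->
  nbhs (emb J z) U -> exists2 z', disc w r z' & U (emb J z').
Proof.
move=> SJ r0 zr /nbhs_ballP[e /= e0 eU].
(* The point is pulled towards the centre by the factor 1 - s, a displacement of at most s r, hence
   at most e / 2. *)
pose s := Num.min 1 (e / (2 * r)).
have s0 : 0 < s by rewrite lt_min ltr01 divr_gt0// mulr_gt0.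
have s1 : s <= 1 by rewrite ge_min lexx.
have nC (a : R) : 0 <= a -> normc a%:C = a.
  by move=> a0; rewrite normcE_sqrt/= expr0n addr0 sqrtr_sqr ger0_norm.
have n0 : 0 <= normc (z - w) by rewrite normcE_sqrt sqrtr_ge0.
exists (w + (1 - s)%:C * (z - w)).
  apply/discP; rewrite addrAC subrr add0r Normc.normcM nC ?subr_ge0//.
  apply: (@le_lt_trans _ _ ((1 - s) * r)); first by rewrite ler_wpM2l// subr_ge0.
  by rewrite mulrBl mul1r gtrBl mulr_gt0.
apply: eU; rewrite -ball_normE /ball_/= -embB norm_emb//.
have -> : z - (w + (1 - s)%:C * (z - w)) = s%:C * (z - w).
  by rewrite rmorphB rmorph1; ring.
rewrite Normc.normcM nC ?(ltW s0)//.
apply: (@le_lt_trans _ _ (e / (2 * r) * r)).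
  apply: ler_pM => //; first exact: ltW.
  by rewrite ge_min lexx orbT.
by rewrite (_ : e / (2 * r) * r = e / 2) ?ltr_pdivrMr ?ltr_pMr ?ltr1n//; field; rewrite gt_eqF.
Qed.

Lemma bdBJ_circle J w r t : SA J -> 0 < r -> bdBJ J (emb J w) r (emb J (circle w r t)).
Proof.
move=> SJ r0; have nr := normc_circle w t (ltW r0).
have CJt : CJ J (emb J (circle w r t)) by apply/CJ_embP; exists (circle w r t).
split; [split=> //|].
  move=> U /(emb_approx SJ r0 (_ : normc (circle w r t - w) <= r)).
  rewrite nr lexx => /(_ isT)[z' /discP z'r Uz']; exists (emb J z'); split=> //.
  split; first by apply/CJ_embP; exists z'.
  by rewrite -embB norm_emb.
by apply: subset_closure; split=> // -[_]; rewrite -embB norm_emb// nr ltxx.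
Qed.

Lemma bdBJ_sub J w r p : SA J -> bdBJ J (emb J w) r p ->
  exists2 z, p = emb J z & normc (z - w) = r.
Proof.
move=> SJ [[/CJ_embP[z ->] c1] c2]; exists z => //.
have cn : continuous (fun q : A => `|q - emb J w|).
  move=> q; apply: cvg_norm; apply: cvgB; [exact: cvg_id|exact: cvg_cst].
apply/eqP; rewrite -(norm_emb _ SJ) embB eq_le; apply/andP; split.
  have cl : closed ((fun q : A => `|q - emb J w|) @^-1` [set s | s <= r]).
    by apply: preimage_closed => [q _|]; [exact: cn|exact: closed_le].
  have : closure (BJ J (emb J w) r) `<=` (fun q : A => `|q - emb J w|) @^-1` [set s | s <= r].
    rewrite [X in _ `<=` X](closure_id _).1//; apply: closureS => q [_ /ltW //].
  by move/(_ _ c1).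
have cl : closed ((fun q : A => `|q - emb J w|) @^-1` [set s | r <= s]).
  by apply: preimage_closed => [q _|]; [exact: cn|exact: closed_ge].
have : closure (CJ J `\` BJ J (emb J w) r) `<=`
    (fun q : A => `|q - emb J w|) @^-1` [set s | r <= s].
  rewrite [X in _ `<=` X](closure_id _).1//; apply: closureS => q [Cq nBq].
  by rewrite /= leNgt; apply/negP => h; apply: nBq.
by move/(_ _ c2).
Qed.

End Norm.

(** The arc cosine parametrizes the upper half and 2 pi minus it the lower half. Covering the circle
    by a compact interval gives boundedness of f on the boundary. *)
Lemma circle_surj w r z : 0 < r -> normc (z - w) = r ->
  exists2 t, t \in `[0, 2 * pi] & z = circle w r t.
Proof.
move=> r0 zr; pose a := Re (z - w) / r; pose b := Im (z - w) / r.
have ab : a ^+ 2 + b ^+ 2 = 1.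
  rewrite !expr_div_n -mulrDl -[X in X / _]sqr_sqrtr ?addr_ge0 ?sqr_ge0//.
  by rewrite -normcE_sqrt zr divff// expf_neq0// gt_eqF.
have a1 : -1 <= a <= 1.
  rewrite -ler_norml -(@expr_le1 _ 2)// -ab real_normK ?num_real// lerDl sqr_ge0//.
have zE (p s : R) : a = p -> b = s -> z = w + r%:C * (p +i* s).
  move=> <- <-; rewrite /a /b; apply/eqP; rewrite addrC -subr_eq; apply/eqP.
  apply: complex_eqP; rewrite ?ReM ?ImM /= !mul0r ?subr0 ?addr0 mulrC divfK ?gt_eqF//.
have sE : sin (acos a) = `|b|.
  by rewrite sin_acos// -ab addrAC subrr add0r sqrtr_sqr.
have [b0|b0] := lerP 0 b.
  exists (acos a).
    by rewrite in_itv/= acos_ge0// (le_trans (acos_lepi _))// ler_pMl ?pi_gt0// ler1n.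
  by rewrite /circle; apply: zE; [rewrite acosK|rewrite sE ger0_norm].
exists (2 * pi - acos a).
  rewrite in_itv/= subr_ge0 (le_trans (acos_lepi _))/=; last 2 first.
  - by [].
  - by rewrite ler_pMl ?pi_gt0// ler1n.
  by rewrite gerBl acos_ge0.
have cE (x : R) : cos (2 * pi - x) = cos x.
  by rewrite mulr_natl cosB cos2pi sin2pi mul1r mul0r addr0.
have sE2 (x : R) : sin (2 * pi - x) = - sin x.
  by rewrite mulr_natl sinB cos2pi sin2pi mul0r mul1r sub0r.
by rewrite /circle; apply: zE; [rewrite cE acosK|rewrite sE2 sE ltr0_norm// opprK].
Qed.

End QuadraticCone.

(** * Taylor expansions of slice regular functions *)

Section SliceTaylor.
Context {R : realType} {A : altStarAlgType R}.
Implicit Types (x u v a I : A) (z c d : R[i]).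

Local Notation Re := (@complex.Re R).
Local Notation Im := (@complex.Im R).
Local Notation normc := (@Normc.normc R).

Lemma slice_repf (J I : A) (D : set R[i]) (G : R[i] -> A * A) z : SA J -> SA I ->
  stem D G -> D z -> slice G (emb I z) = repf J I (evp J (G z)) (evm J (G z)).
Proof.
by case: z => p q SJ SI sG Dz; rewrite -(repfE SJ.2) -(sliceE sG Dz SI).
Qed.

Lemma repf_sum (J I : A) (p q : nat -> A) u v n :
  repf J I u v - \sum_(0 <= k < n) repf J I (p k) (q k) =
  repf J I (u - \sum_(0 <= k < n) p k) (v - \sum_(0 <= k < n) q k).
Proof.
elim: n => [|n IH]; first by rewrite !big_nil !subr0.
rewrite !big_nat_recr//= [- (_ + repf _ _ _ _)]opprD addrA IH repfB.
by congr repf; rewrite opprD addrA.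
Qed.

Lemma cvg_series_geometric (s : nat -> A) (l : A) (B q : R) : 0 <= q < 1 ->
  (forall n, `|l - series s n| <= B * q ^+ n) -> series s @ \oo --> l.
Proof.
move=> /andP[q0 q1] H; apply/cvgrPdist_le => e e0.
have B1 : 0 < `|B| + 1 by rewrite ltr_wpDl.
have : q ^+ n @[n --> \oo] --> 0 by apply: cvg_expr; rewrite ger0_norm.
have eB : 0 < e / (`|B| + 1) by rewrite divr_gt0.
move=> /cvgrPdist_le/(_ _ eB); apply: filterS => n.
rewrite sub0r normrN ger0_norm ?exprn_ge0// => qn.
rewrite (le_trans (H n))// (@le_trans _ _ ((`|B| + 1) * (e / (`|B| + 1))))//; last first.
  by rewrite mulrC divfK ?gt_eqF.
apply: (@le_trans _ _ ((`|B| + 1) * q ^+ n)); last by rewrite ler_pM2l.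
by rewrite ler_wpM2r ?exprn_ge0// (le_trans (ler_norm _))// lerDl.
Qed.

Section Slice.
Hypothesis hN : cone_norm A.
Variables (D : set R[i]) (F : R[i] -> A * A) (f : A -> A) (J : A) (w : R[i]) (r : R).
Hypothesis oD : open (D : set R[i]^o).
Hypothesis cD : forall z, D z -> D (z^*)%C.
Hypothesis sF : stem D F.
Hypothesis hF : holomorphic_on D F.
Hypothesis fF : forall x, Omega D x -> f x = slice F x.
Hypothesis SJ : SA J.
Hypothesis r0 : 0 < r.
Hypothesis rD : forall z, normc (z - w) <= r -> D z.

Local Notation y := (emb J w).
Local Notation phi := (fun z => evp J (F z)).
Local Notation zeta := (circle w r).
Local Notation cact := (cact J).

Let hJ : J ** J = - aone := SJ.2.

Let wd : disc w r w.
Proof. by apply/discP; rewrite subrr Normc.normc0. Qed.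

Let dD z : disc w r z -> D z.
Proof. by move=> /discP/ltW; exact: rD. Qed.

Lemma vhol_iter n : vhol J D (fun z => evp J (iter n dz F z))
  (fun z => evp J (iter n.+1 dz F z)).
Proof.
have [_ h] := stem_holomorphic_iter hJ n oD cD sF hF.
exact: (holomorphic_vhol hJ oD h).
Qed.

Lemma slice_deriv_vcoef n : slice_deriv F n y = n`!%:R *: vcoef J w r n phi.
Proof.
have [s _] := stem_holomorphic_iter hJ n oD cD sF hF.
rewrite /slice_deriv (slice_repf SJ SJ s (dD wd)) repfJ//.
exact: (vhol_iter_vcoef hJ r0 oD rD n vhol_iter).
Qed.

Lemma coef_vcoef n : n`!%:R^-1 *: slice_deriv F n y = vcoef J w r n phi.
Proof.
by rewrite slice_deriv_vcoef scalerA mulVf ?scale1r// pnatr_eq0 -lt0n fact_gt0.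
Qed.

Lemma taylor_term_repf n I z : SA I ->
  taylor_term F y n (emb I z) =
  repf J I (cact ((z - w) ^+ n) (vcoef J w r n phi))
           (cact (((z^*)%C - w) ^+ n) (vcoef J w r n phi)).
Proof.
move=> SI; rewrite /taylor_term coef_vcoef /slice_pow.
rewrite (@slice_repf J I setT) ?evp_pow_stem ?evm_pow_stem ?evp_calg ?evm_calg//.
apply: (stem_ev hJ) => // c _.
by rewrite evp_pow_stem ?evm_pow_stem// evp_calg evm_calg.
Qed.

Lemma f_repf I z : SA I -> D z -> f (emb I z) = repf J I (phi z) (phi (z^*)%C).
Proof.
move=> SI Dz; rewrite fF; last exact: Omega_of.
by rewrite (slice_repf SJ SI sF Dz) -(evp_conj _ sF Dz).
Qed.

Lemma f_emb z : D z -> f (emb J z) = phi z.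
Proof. by move=> Dz; rewrite f_repf// repfJ. Qed.

Lemma remainder_repf n I z : SA I -> disc w r z -> disc w r (z^*)%C ->
  f (emb I z) - \sum_(0 <= k < n) taylor_term F y k (emb I z) =
  repf J I (cact ((z - w) ^+ n) (vrem J w r n phi z))
           (cact (((z^*)%C - w) ^+ n) (vrem J w r n phi (z^*)%C)).
Proof.
move=> SI zr zr'; rewrite (f_repf SI (dD zr)).
under eq_bigr do rewrite taylor_term_repf//.
by rewrite repf_sum !(vrem_taylor hJ r0 oD rD n (vhol_iter 0)).
Qed.

(** In the plane of y only [z] has to lie in the disc: a point of [SigmaA] on C_J may have its
    conjugate outside, where [remainder_repf] does not apply. *)
Lemma remainder_emb n z : disc w r z ->
  f (emb J z) - \sum_(0 <= k < n) taylor_term F y k (emb J z) =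
  cact ((z - w) ^+ n) (vrem J w r n phi z).
Proof.
move=> zr; rewrite (f_emb (dD zr)).
under eq_bigr do rewrite taylor_term_repf// repfJ//.
by rewrite (vrem_taylor hJ r0 oD rD n (vhol_iter 0)).
Qed.

Lemma continuous_phi_circle : continuous (fun t => phi (zeta t)).
Proof. exact: (vhol_circle_continuous r0 oD rD (vhol_iter 0)). Qed.

Lemma circ_emb t : circ J y r t = emb J (zeta t).
Proof.
rewrite /circ /circle embD; congr (_ + _).
rewrite -[RHS]embM// emb_real /areal amulZl amul1l /emb /areal /=.
by [].
Qed.

Lemma dcirc_emb t : dcirc J r t = emb J ('i%C * (zeta t - w)).
Proof.
rewrite /dcirc /circle addrAC subrr add0r mulrCA.
rewrite -[RHS]embM// emb_real /areal amulZl amul1l; congr (_ *: _).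
by rewrite /emb /areal /= !mul0r !mul1r sub0r add0r.
Qed.

(** Under C_J = C the differential is i (zeta - w) dt: it lowers the exponent n + 1 to n, and its i
    cancels the J of the prefactor. *)
Lemma cauchy_coef n : vcoef J w r n phi = ainv ((2 * pi) *: J) **
  circle_int J y r (fun zeta => ainv (apow (zeta - y) n.+1)) f.
Proof.
have -> : (2 * pi) *: J = emb J ((2 * pi)%:C * 'i%C).
  by rewrite -embM// emb_real emb_i /areal amulZl amul1l.
have pi0 : (2 * pi)%:C != 0 :> R[i] by rewrite eq_complex/= gt_eqF// twopi_gt0.
have i0 : 'i%C != 0 :> R[i] by rewrite eq_complex/= oner_eq0 andbF.
rewrite ainv_emb ?mulf_neq0// embE.
pose g t := cact 'i%C (cact ((zeta t - w)^-1 ^+ n) (phi (zeta t))).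
have -> : circle_int J y r (fun zeta => ainv (apow (zeta - y) n.+1)) f =
    vintegral 0 (2 * pi) g.
  rewrite /circle_int; congr vintegral; apply/funext => t.
  have n0 : zeta t - w != 0 by exact: disc_circle_neq.
  rewrite circ_emb dcirc_emb -embB apow_emb// ainv_emb ?expf_neq0// embM// embE.
  rewrite f_emb; last by apply: rD; rewrite normc_circle// ltW.
  rewrite /g cactM//; congr (cact _ _).
  by rewrite mulrCA exprSr invfM mulfVK// exprVn.
have cg := coord_continuousP (continuous_vcoef hJ r0 (n := n) (phi := phi) continuous_phi_circle).
rewrite -(linear_vintegral (linear_cact J 'i%C) cg) cactM// invfM mulfVK//.
by rewrite /vcoef -(cactR J) fmorphV.
Qed.

Lemma lensP z : lens w r z <-> disc w r z /\ disc w r (z^*)%C.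
Proof.
have h : disc (w^*)%C r z <-> disc w r (z^*)%C.
  split=> /discP H; apply/discP; rewrite -normc_conj.
    by rewrite rmorphB/= conjcK.
  by rewrite rmorphB/= conjcK.
by split=> -[h1 h2]; split=> //; apply/h.
Qed.

Lemma lens_conj z : lens w r z -> lens w r (z^*)%C.
Proof. by move=> /lensP[h1 h2]; apply/lensP; rewrite conjcK. Qed.

Lemma open_lens : open (lens w r : set R[i]^o).
Proof. by apply: openI; exact: open_disc. Qed.

Lemma DeltaC_emb c z : DeltaC (emb J c) z =
  kap J ((z - c) * (z - (c^*)%C)) (((z^*)%C - c) * ((z^*)%C - (c^*)%C)).
Proof.
rewrite /DeltaC atrace_emb// asqnorm_emb// -!(emb_real J) !calg_emb// (cscalE hJ).
rewrite !kapM// kapN// !kapD//; congr kap; apply: complex_eqP; case: c z => p q [p' q'] /=; ring.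
Qed.

Let kern n z t : R[i] := (zeta t - z)^-1 * (zeta t - w)^-1 ^+ n * (zeta t - w).

(** Delta vanishes at zeta and also at its conjugate. Excluding the second zero requires the
    conjugate of [z] in the disc, which is why the remainder lives on the lens. *)
Lemma circle_neq_conj z t : disc w r (z^*)%C -> z - ((zeta t)^*)%C != 0.
Proof.
move=> zr; have := disc_circle_neq t r0 zr; apply: contraNneq => e.
by rewrite -(conjcK (zeta t)) -rmorphB/= -oppr_eq0 -rmorphN/= opprB e conjc0.
Qed.

(** Both evaluations of the slice kernel reduce to the ordinary Cauchy kernel, at [z] and at its
    conjugate: the factor conj(zeta) - z cancels one factor of Delta, and the inverse of J cancels
    the i of the differential. *)
Lemma rem_integrand n z t : lens w r z ->
  cmul (cmul (cmul (cmul (cmul (cinv (DeltaC (circ J y r t) z))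
    (calg (aconj (circ J y r t)) - cscal z)) (calg (ainv J)))
    (calg (ainv (apow (circ J y r t - y) n)))) (calg (dcirc J r t)))
    (calg (f (circ J y r t)))
  = stempair J (cact (kern n z t) (phi (zeta t))) (cact (kern n (z^*)%C t) (phi (zeta t))).
Proof.
move=> /lensP[z1 z2].
have n0 : zeta t - w != 0 by exact: disc_circle_neq.
have n1 : zeta t - z != 0 by exact: disc_circle_neq.
have n2 : zeta t - (z^*)%C != 0 by exact: disc_circle_neq.
have n3 : z - ((zeta t)^*)%C != 0 by exact: circle_neq_conj.
have n4 : (z^*)%C - ((zeta t)^*)%C != 0 by apply: circle_neq_conj; rewrite conjcK.
have n1' : z - zeta t != 0 by rewrite -oppr_eq0 opprB.
have n2' : (z^*)%C - zeta t != 0 by rewrite -oppr_eq0 opprB.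
have i0 : 'i%C != 0 :> R[i] by rewrite eq_complex/= oner_eq0 andbF.
rewrite circ_emb dcirc_emb DeltaC_emb cinv_kap ?mulf_neq0//.
rewrite aconj_emb// -embB apow_emb// ainv_emb ?expf_neq0//.
rewrite -[X in ainv X]emb_i ainv_emb// !calg_emb// (cscalE hJ) kapN// kapD// !kapM//.
rewrite f_emb; last by apply: rD; rewrite normc_circle// ltW.
have E c : c - zeta t != 0 -> c - ((zeta t)^*)%C != 0 ->
   ((c - zeta t) * (c - ((zeta t)^*)%C))^-1 * (((zeta t)^*)%C - c) * 'i%C^-1 *
   ((zeta t - w) ^+ n)^-1 * ('i%C * (zeta t - w)) =
   (zeta t - c)^-1 * (zeta t - w)^-1 ^+ n * (zeta t - w).
  move=> m1 m2; rewrite exprVn.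
  have -> : ((c - zeta t) * (c - ((zeta t)^*)%C))^-1 * (((zeta t)^*)%C - c) =
      (zeta t - c)^-1.
    by rewrite -[_^* - c]opprB -[zeta t - c]opprB invrN mulrN invfM mulfVK.
  have gen (a b p q : R[i]) : b != 0 -> a * b^-1 * p * (b * q) = a * p * q.
    by move=> b0; field.
  exact: gen.
apply: (ev_inj hJ).
  by rewrite evp_kapM// evp_stempair// evp_calg E.
by rewrite evm_kapM// evm_stempair// evm_calg E.
Qed.

Lemma linear_evp I : linear (evp I : A * A -> A).
Proof.
move=> s p q; rewrite /evp /= amulDr amulZr scalerDr.
by apply: coord_eq => i; rewrite !(coordD, coordN, coordZ); ring.
Qed.

Lemma linear_evm I : linear (evm I : A * A -> A).
Proof.
move=> s p q; rewrite /evm /= amulDr amulZr scalerDr scalerN opprD.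
by apply: coord_eq => i; rewrite !(coordD, coordN, coordZ); ring.
Qed.

Lemma coord_continuous_stempair (g k : R -> A) : continuous g -> continuous k ->
  coord_continuous (fun t => stempair J (g t) (k t)).
Proof.
move=> cg ck.
have lg : linear (fun u => stempair J u 0).
  move=> s u v; rewrite /stempair !addr0 !subr0 amulDr amulZr; congr (_, _) => /=.
    by apply: coord_eq => i; rewrite !(coordD, coordN, coordZ); ring.
  by apply: coord_eq => i; rewrite !(coordD, coordN, coordZ); ring.
have lk : linear (fun u => stempair J 0 u).
  move=> s u v; rewrite /stempair !add0r !amulNr amulDr amulZr; congr (_, _) => /=.
    by apply: coord_eq => i; rewrite !(coordD, coordN, coordZ); ring.
  by apply: coord_eq => i; rewrite !(coordD, coordN, coordZ); ring.
have -> : (fun t => stempair J (g t) (k t)) = (fun t => stempair J (g t) 0 + stempair J 0 (k t)).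
  apply/funext => t; rewrite /stempair addr0 subr0 !add0r.
  congr (_, _) => /=; first by rewrite scalerDr.
  by rewrite amulBr amulNr; apply: coord_eq => i; rewrite !(coordD, coordN, coordZ); ring.
apply: coord_continuousD.
  exact: (coord_continuous_linear lg (coord_continuousP cg)).
exact: (coord_continuous_linear lk (coord_continuousP ck)).
Qed.

(** The remainder stem function carries no normalization, so the mean in [vrem] is multiplied back
    by 2 pi. *)
Definition rem_slice n z : A := (2 * pi) *: vrem J w r n phi z.

Lemma coord_continuous_rem n z : lens w r z -> coord_continuous (fun t =>
  stempair J (cact (kern n z t) (phi (zeta t))) (cact (kern n (z^*)%C t) (phi (zeta t)))).
Proof.
move=> /lensP[z1 z2]; apply: coord_continuous_stempair.
  exact: (continuous_vrem hJ r0 (n := n) (phi := phi) continuous_phi_circle z1).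
exact: (continuous_vrem hJ r0 (n := n) (phi := phi) continuous_phi_circle z2).
Qed.

Lemma rem_stemE n z : lens w r z ->
  rem_stem J y r f n z = stemify J (rem_slice n.+1) z.
Proof.
move=> zl; have cs := coord_continuous_rem (n := n.+1) zl.
have vE c : rem_slice n.+1 c =
    vintegral 0 (2 * pi) (fun t => cact (kern n.+1 c t) (phi (zeta t))).
  by rewrite /rem_slice /vrem scalerA mulfV ?scale1r// gt_eqF// twopi_gt0.
have -> : rem_stem J y r f n z = vintegral 0 (2 * pi) (fun t =>
    stempair J (cact (kern n.+1 z t) (phi (zeta t)))
      (cact (kern n.+1 (z^*)%C t) (phi (zeta t)))).
  rewrite /rem_stem /circle_intC; congr vintegral; apply/funext => t.
  exact: rem_integrand.
apply: (ev_inj hJ).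
  rewrite (linear_vintegral (linear_evp J) cs) /stemify evp_stempair// vE.
  by congr vintegral; apply/funext => t; rewrite evp_stempair.
rewrite (linear_vintegral (linear_evm J) cs) /stemify evm_stempair// vE.
by congr vintegral; apply/funext => t; rewrite evm_stempair.
Qed.

Lemma rem_stem_stem n : stem (lens w r) (rem_stem J y r f n).
Proof.
move=> z zl; rewrite (rem_stemE _ zl) (rem_stemE _ (lens_conj zl)).
exact: stem_stemify zl.
Qed.

Lemma rem_stem_holomorphic n : holomorphic_on (lens w r) (rem_stem J y r f n).
Proof.
have [psi hpsi] := vhol_vrem hJ r0 n.+1 continuous_phi_circle.
have h : vhol J (lens w r) (rem_slice n.+1) (fun z => (2 * pi) *: psi z).
  move=> i; have H := holZ (2 * pi)%:C (hol_sub (_ : lens w r `<=` disc w r) (hpsi i)).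
  apply: (hol_eq open_lens _ _ (H _)); last by move=> c [].
    by move=> c _; rewrite /rem_slice (lcZ hJ).
  by move=> c _; rewrite (lcZ hJ).
have [H _] := vhol_holomorphic hJ open_lens lens_conj h.
by apply: (holomorphic_on_eq open_lens _ H) => z zl; rewrite rem_stemE.
Qed.

Lemma rem_stem_remainder n x : Omega (lens w r) x ->
  f x - \sum_(0 <= k < n.+1) taylor_term F y k x =
  (2 * pi)^-1 *: slice (fun z => cmul (pow_stem y n.+1 z) (rem_stem J y r f n z)) x.
Proof.
move=> /OmegaP[I [z [SI zl ->]]]; have /lensP[z1 z2] := zl.
have ss : stem (lens w r) (fun z => cmul (pow_stem y n.+1 z) (rem_stem J y r f n z)).
  apply: (stem_ev hJ); first exact: lens_conj.
  move=> c cl; rewrite evp_pow_stem// evm_pow_stem//.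
  by rewrite (evp_conj J (rem_stem_stem n) cl).
rewrite remainder_repf// (slice_repf SJ SI ss zl) evp_pow_stem// evm_pow_stem//.
rewrite (rem_stemE _ zl) /stemify evp_stempair// evm_stempair// /rem_slice.
have gen : (2 * pi)^-1 / 2 * (2 * pi) = 2^-1 :> R.
  by rewrite mulrAC mulVf ?mul1r// gt_eqF// twopi_gt0.
move: (vrem _ _ _ _ _ z) (vrem _ _ _ _ _ (z^*)%C) => U V; rewrite !cactZr.
rewrite /repf -scalerDr -scalerBr !amulZr scalerBr; congr (_ - _).
  by rewrite !scalerA gen.
by rewrite !scalerA (mulrA (2 * pi)^-1) gen.
Qed.

Lemma rem_stem_assoc n x : (forall a b c : A, a ** (b ** c) = (a ** b) ** c) ->
  Omega (lens w r) x ->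
  slice (rem_stem J y r f n) x =
  circle_int J y r
    (fun zeta => ainv (Delta zeta x) ** (aconj zeta - x) ** ainv J
                 ** ainv (apow (zeta - y) n.+1)) f.
Proof.
move=> assoc /OmegaP[I [z [SI zl ->]]]; have /lensP[z1 z2] := zl.
have hI : I ** I = - aone := SI.2.
rewrite (slice_repf SI SI (rem_stem_stem n) zl) repfJ// /rem_stem /circle_intC.
rewrite linear_vintegral; first last.
- rewrite (_ : (fun t => _) = fun t => stempair J (cact (kern n.+1 z t) (phi (zeta t)))
    (cact (kern n.+1 (z^*)%C t) (phi (zeta t)))); first exact: coord_continuous_rem.
  by apply/funext => t; exact: rem_integrand.
- exact: linear_evp.
rewrite /circle_int; congr vintegral; apply/funext => t.
(* The evaluation is at the unit I of [x], while the constants lie in C_J; associativity lets I pass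
   through each of these right factors. *)
have evr p a : evp I (cmul p (calg a)) = evp I p ** a.
  by rewrite /evp /cmul /= !amul0r subr0 add0r amulDl assoc.
rewrite !evr; congr (_ ** _ ** _ ** _ ** _).
rewrite circ_emb; set c := zeta t.
pose d := (z - c) * (z - (c^*)%C).
have d0 : d != 0.
  apply: mulf_neq0; last exact: circle_neq_conj.
  by rewrite -oppr_eq0 opprB; exact: disc_circle_neq.
(* Delta has real coefficients, so it lies in R (x) C, where the description by evaluations is the
   same for I as for J. *)
have -> : DeltaC (emb J c) z = kap I d (d^*)%C.
  rewrite DeltaC_emb (_ : ((z^*)%C - c) * _ = (d^*)%C); last first.
    by rewrite /d rmorphM/= !rmorphB/= conjcK mulrC.
  by rewrite -(cscalE hJ) -(cscalE hI).
have -> : Delta (emb J c) (emb I z) = emb I d.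
  rewrite /Delta atrace_emb// asqnorm_emb// -!(emb_real I) !embM// -embB -embD.
  by congr (emb I _); apply: complex_eqP; rewrite /d; case: (c) (z) => p q [p' q'] /=; ring.
rewrite cinv_kap ?conjc_eq0// evp_kapM// ainv_emb// -(embE I); congr (_ ** _).
rewrite evpD evpN evp_calg; congr (_ - _).
by rewrite (cscalE hI) evp_kap.
Qed.

End Slice.
End SliceTaylor.

(** * Uniform estimates and convergence *)

Section Bounds.
Context {R : realType} {A : altStarAlgType R}.
Implicit Types (x u v a I : A) (z c d : R[i]).

Local Notation normc := (@Normc.normc R).

Lemma supnorm_ub (E : set A) (g : A -> A) (M : R) (p : A) :
  (forall q, E q -> `|g q| <= M) -> E p -> `|g p| <= supnorm E g.
Proof.
move=> gM Ep; apply: ub_le_sup; last by exists p.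
by exists M => _ [q Eq <-]; exact: gM.
Qed.

Lemma closed_disc_sub (D : set R[i]) (J : A) w (r : R) : cone_norm A ->
  (forall z, D z -> D (z^*)%C) -> SA J -> 0 < r ->
  closQ (SigmaA (emb J w) r) `<=` Omega D ->
  forall z, normc (z - w) <= r -> D z.
Proof.
move=> hN cD SJ r0 SD z zr; apply: (Omega_emb cD SJ); apply: SD; split; last exact: QA_emb.
move=> U /(emb_approx hN SJ r0 zr)[z' /discP z'r Uz'].
exists (emb J z'); split=> //; split; first exact: QA_emb.
by rewrite sigmaA_same.
Qed.

(** Monotonicity in the distance lets [sigmaA] replace each of the plane distances that it
    dominates. *)
Lemma ratio_le (r s s' : R) n : 0 < r -> 0 <= s -> s <= s' -> s' < r ->
  (s / r) ^+ n * (r / (r - s)) <= (s' / r) ^+ n * (r / (r - s')).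
Proof.
move=> r0 s0 ss' s'r; have sr := le_lt_trans ss' s'r.
have rV : 0 <= r^-1 by rewrite invr_ge0 ltW.
apply: ler_pM.
- by rewrite exprn_ge0// mulr_ge0.
- by rewrite mulr_ge0 ?invr_ge0 ?subr_ge0// ltW.
- by apply: lerXn2r; rewrite ?nnegrE ?mulr_ge0 ?ler_wpM2r// (le_trans s0).
- by rewrite ler_pM2l// lef_pV2 ?posrE ?subr_gt0// lerD2l lerN2.
Qed.

Section Slice.
Hypothesis hN : cone_norm A.
Variables (D : set R[i]) (F : R[i] -> A * A) (f : A -> A) (J : A) (w : R[i]) (r : R).
Hypothesis oD : open (D : set R[i]^o).
Hypothesis cD : forall z, D z -> D (z^*)%C.
Hypothesis sF : stem D F.
Hypothesis hF : holomorphic_on D F.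
Hypothesis fF : forall x, Omega D x -> f x = slice F x.
Hypothesis SJ : SA J.
Hypothesis r0 : 0 < r.
Hypothesis rD : forall z, normc (z - w) <= r -> D z.

Local Notation y := (emb J w).
Local Notation phi := (fun z => evp J (F z)).

Let hJ : J ** J = - aone := SJ.2.

(** [sup] takes a default value on unbounded sets, so boundedness has to be known before [supnorm]
    can serve as an upper bound. *)
Lemma bdBJ_bounded : exists M, forall p, bdBJ J y r p -> `|f p| <= M.
Proof.
have cphi := continuous_phi_circle oD cD sF hF SJ r0 rD.
have cn : continuous (fun t => `|phi (circle w r t)|).
  by move=> t; apply: cvg_norm; exact: cphi.
have [c _ cM] := EVT_max (ltW (@twopi_gt0 R)) (continuous_subspaceT cn).
exists `|phi (circle w r c)| => p /(bdBJ_sub hN SJ)[z -> zr].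
have [t t2 zE] := circle_surj r0 zr.
rewrite (f_emb sF fF SJ); last by apply: rD; rewrite zr.
by rewrite zE; exact: cM.
Qed.

Section Constants.
Variables (K K1 M : R).
Hypothesis K0 : 0 < K.
Hypothesis KP : forall u v : A, `|u ** v| <= K * `|u| * `|v|.
Hypothesis K10 : 0 < K1.
Hypothesis K1P : forall (a b N : R) (g : R -> A), a <= b -> coord_continuous g ->
  (forall t, t \in `[a, b] -> `|g t| <= N) -> `|vintegral a b g| <= K1 * N * (b - a).
Hypothesis MP : forall p, bdBJ J y r p -> `|f p| <= M.

Let phiM t : `|phi (circle w r t)| <= M.
Proof.
have := MP (bdBJ_circle hN w t SJ r0); rewrite (f_emb sF fF SJ)//.
by apply: rD; rewrite normc_circle// ltW.
Qed.

Let cphi := continuous_phi_circle oD cD sF hF SJ r0 rD.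

Lemma coef_bound n : n`!%:R^-1 * `|slice_deriv F n y| <= K1 * (1 + K) * r ^- n * M.
Proof.
rewrite -[n`!%:R^-1]ger0_norm ?invr_ge0// -normrZ (coef_vcoef oD cD sF hF SJ r0 rD).
exact: (vcoef_bound hJ r0 K0 KP K1P (norm_SA hN SJ) n cphi phiM).
Qed.

(** On C_J a single remainder is estimated; elsewhere [repf] combines two. The factor 1 + K^2
    belongs to the second case and, being at least 1, gives a common constant. *)
Lemma remainder_bound n x : QA x -> sigmaA x y < r ->
  `|f x - \sum_(0 <= k < n) taylor_term F y k x| <=
  (1 + K ^+ 2) * (K1 * (1 + K) ^+ 2) * M *
    ((sigmaA x y / r) ^+ n * (r / (r - sigmaA x y))).
Proof.
have hS : (SA : set A) !=set0 by exists J.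
move=> /(QA_embP hS)[I [z [SI ->]]]; set s := sigmaA _ _ => sr.
have M0 : 0 <= M by rewrite (le_trans _ (phiM 0)).
have C0 : 0 <= K1 * (1 + K) ^+ 2 * M.
  by apply: mulr_ge0 => //; apply: mulr_ge0; [exact: ltW|exact/exprn_ge0/ltW/addr_gt0].
have one z' : normc (z' - w) <= s ->
    `|cact J ((z' - w) ^+ n) (vrem J w r n phi z')| <=
    K1 * (1 + K) ^+ 2 * M * ((s / r) ^+ n * (r / (r - s))).
  move=> z's; have z'r : disc w r z' by apply/discP; exact: le_lt_trans sr.
  apply: (le_trans (vrem_bound hJ r0 K0 KP K1P (norm_SA hN SJ) n cphi z'r phiM)).
  by rewrite -mulrA ler_wpM2l// ratio_le// normc_ge0.
rewrite -[X in _ <= X]mulrA -[X in _ <= X]mulrA [_ * (M * _)]mulrA.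
have [[z' zz' sE]|[s1 s2 _]] := sigmaA_cases hN z w SI SJ.
  have z'r : disc w r z' by apply/discP; rewrite -sE.
  rewrite zz' (remainder_emb oD cD sF hF fF SJ r0 rD)//.
  apply: (le_trans (one _ _)); first by rewrite /s sE.
  rewrite ler_peMl// ?lerDl ?sqr_ge0// mulr_ge0// mulr_ge0 ?exprn_ge0//.
    by rewrite divr_ge0// ?(ltW r0)// /s sE normc_ge0.
  by rewrite divr_ge0 ?subr_ge0// ltW.
have z1 : disc w r z by apply/discP; exact: le_lt_trans sr.
have z2 : disc w r (z^*)%C by apply/discP; exact: le_lt_trans sr.
rewrite (remainder_repf oD cD sF hF fF SJ r0 rD)//.
apply: (repf_bound K0 KP) => //; [exact: norm_SA|exact: norm_SA|exact: one|exact: one].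
Qed.

Lemma sigmaA_lens x : Omega (lens w r) x -> QA x /\ sigmaA x y < r.
Proof.
move=> /OmegaP[I [z [SI zl ->]]]; have /lensP[z1 z2] := zl.
split; first exact: QA_emb.
move/discP : z1 => z1; move/discP : z2 => z2.
have [[z' zz' ->]|[_ _ [->|->]]] := sigmaA_cases hN z w SI SJ => //.
have [[<-//|e] _] := emb_uniq SI SJ zz'.
by rewrite -(conjcK z') -e.
Qed.

Lemma taylor_cvg x : SigmaA y r x ->
  series (fun n => taylor_term F y n x) @ \oo --> f x.
Proof.
move=> [Qx sr].
apply: (@cvg_series_geometric _ _ _ _ ((1 + K ^+ 2) * (K1 * (1 + K) ^+ 2) * M *
  (r / (r - sigmaA x y))) (sigmaA x y / r)).
  rewrite ltr_pdivrMr// mul1r sr andbT divr_ge0 ?(ltW r0)//.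
  have hS : (SA : set A) !=set0 by exists J.
  have [I [z [SI ->]]] := QA_embP hS Qx.
  have [[z' _ ->]|[s1 _ _]] := sigmaA_cases hN z w SI SJ; first exact: normc_ge0.
  exact: le_trans (normc_ge0 _) s1.
move=> n; apply: (le_trans (remainder_bound n Qx sr)).
by rewrite [(_ / r) ^+ n * _]mulrC [leLHS]mulrA.
Qed.

End Constants.
End Slice.
End Bounds.

Theorem theorem4p1 (R : realType) (A : altStarAlgType R)
    (hS : (SA : set A) !=set0) (hN : cone_norm A) :
  exists C C' : R, [/\ 0 < C, 0 < C' &
    forall (D : set R[i]) (F : R[i] -> A * A) (f : A -> A)
      (y J : A) (xi eta r : R),
    D !=set0 -> open (D : set R[i]^o) -> (forall z, D z -> D (z^*)%C) ->
    connected (Omega D : set A) ->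
    slice_regular D F f ->
    Omega D y -> SA J -> y = areal xi + eta *: J ->
    0 < r -> closQ (SigmaA y r) `<=` Omega D ->
    let w := xi +i* eta in
    [/\
      forall x, SigmaA y r x ->
        series (fun n => taylor_term F y n x) @ \oo --> f x,
      (forall n : nat,
        n`!%:R^-1 *: slice_deriv F n y =
        ainv ((2 * pi) *: J) **
          circle_int J y r (fun zeta => ainv (apow (zeta - y) n.+1)) f) /\
      (forall n : nat,
        n`!%:R^-1 * `|slice_deriv F n y| <=
        C * r ^- n * supnorm (bdBJ J y r) f),
      (Omega (lens w r) : set A) !=set0 ->
      D w /\
      forall n : nat,
      [/\ stem (lens w r) (rem_stem J y r f n),
          holomorphic_on (lens w r) (rem_stem J y r f n),
          (forall x : A, Omega (lens w r) x ->
            f x - \sum_(0 <= k < n.+1) taylor_term F y k x =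
            (2 * pi)^-1 *:
              slice (fun z => cmul (pow_stem y n.+1 z) (rem_stem J y r f n z)) x)
        & ((forall a b c : A, a ** (b ** c) = (a ** b) ** c) ->
           forall x : A, Omega (lens w r) x ->
            slice (rem_stem J y r f n) x =
            circle_int J y r
              (fun zeta => ainv (Delta zeta x) ** (aconj zeta - x) ** ainv J
                           ** ainv (apow (zeta - y) n.+1)) f)]
    & (Omega (lens w r) : set A) !=set0 ->
      forall (n : nat) (x : A), Omega (lens w r) x ->
        `|f x - \sum_(0 <= k < n.+1) taylor_term F y k x| <=
        C' * supnorm (bdBJ J y r `|` bdBJ J (aconj y) r) f
          * (sigmaA x y / r) ^+ n * (sigmaA x y / (r - sigmaA x y))]].
Proof.
have [K K0 KP] := amul_bound A; have [K1 K10 K1P] := vintegral_bound A.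
(* The constants of [vcoef_bound] and of [repf_bound] applied to [vrem_bound]; they are fixed before
   the domain, the function, the centre and the radius. *)
exists (K1 * (1 + K)), ((1 + K ^+ 2) * (K1 * (1 + K) ^+ 2)).
have K' : 0 < 1 + K by rewrite addr_gt0.
split; first by rewrite mulr_gt0.
  by rewrite !mulr_gt0// ?exprn_gt0// ltr_pwDl// sqr_ge0.
move=> D F f y J xi eta r D0 oD cD _ [sF hF fF] Oy SJ -> r0 SD w.
rewrite -[areal xi + eta *: J]/(emb J w) in SD *.
have rD := closed_disc_sub hN cD SJ r0 SD.
have wD : D w by apply: rD; rewrite subrr Normc.normc0 ltW.
have [M MP] := bdBJ_bounded hN oD cD sF hF fF SJ r0 rD.
have MS p : bdBJ J (emb J w) r p -> `|f p| <= supnorm (bdBJ J (emb J w) r) f.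
  exact: supnorm_ub MP.
split.
- move=> x; exact: (taylor_cvg hN oD cD sF hF fF SJ r0 rD K0 KP K10 K1P MP).
- split=> n.
    rewrite (coef_vcoef oD cD sF hF SJ r0 rD).
    exact: (cauchy_coef oD cD sF hF fF SJ r0 rD).
  exact: (coef_bound hN oD cD sF hF fF SJ r0 rD K0 KP K1P MS).
- move=> _; split=> // n; split.
  + exact: (rem_stem_stem oD cD sF hF fF SJ r0 rD).
  + exact: (rem_stem_holomorphic oD cD sF hF fF SJ r0 rD).
  + move=> x; exact: (rem_stem_remainder oD cD sF hF fF SJ r0 rD).
  + move=> assoc x; exact: (rem_stem_assoc oD cD sF hF fF SJ r0 rD).
move=> _ n x xl.
(* Conjugation invariance of [D] puts the reflected closed disc in [D] too, so f is bounded on both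
   circles and the supremum over their union is finite. *)
have rD' z : Normc.normc (z - (w^*)%C) <= r -> D z.
  move=> zr; rewrite -(conjcK z); apply/cD/rD.
  by rewrite -(normc_conj (_ - w)) rmorphB/= conjcK.
have [M' MP'] := bdBJ_bounded hN oD cD sF hF fF SJ r0 rD'.
have MU p : bdBJ J (emb J w) r p ->
    `|f p| <= supnorm (bdBJ J (emb J w) r `|` bdBJ J (aconj (emb J w)) r) f.
  move=> pw; apply: (@supnorm_ub _ _ _ _ (Num.max M M')); last by left.
  move=> q [/MP h|]; first by rewrite le_max h.
  by rewrite aconj_emb// => /MP' h; rewrite le_max h orbT.
have [Qx sr] := sigmaA_lens hN SJ xl.
apply: (le_trans (remainder_bound hN oD cD sF hF fF SJ r0 rD K0 KP K10 K1P MU n.+1 Qx sr)).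
(* The sum up to n leaves the power n + 1, and one factor s / r times r / (r - s) is s / (r - s). *)
rewrite le_eqVlt; apply/orP; left; apply/eqP.
rewrite -[RHS]mulrA; congr (_ * _); rewrite exprSr.
by field; rewrite gt_eqF ?subr_gt0// gt_eqF.
Qed.
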